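(* Let $M$ be Minkowski space, $\mathcal{H}$ a complex Hilbert space, and $a\mapsto U(a)$ a strongly continuous unitary representation on $\mathcal{H}$ of the translation group of $M$ such that for every future-directed timelike unit vector $a$ the generator $H(a)$ of the one-parameter group $t\mapsto U(ta)$ is bounded below (spectrum condition). Fix a family $\mathcal{S}$ of parallel spacelike hyperplanes foliating $M$ (so $S\in\mathcal{S}$ implies $S+a\in\mathcal{S}$ for all $a\in M$), and for each $S\in\mathcal{S}$ a family $\mathcal{F}(S)$ of subsets of $S$ (''spatial sets'') that contains a covering family of bounded subsets of $S$ and such that $\mathcal{F}(S+a)=\{\Delta+a:\Delta\in\mathcal{F}(S)\}$ for all $a\in M$. Let $\Delta\mapsto E_\Delta$ be a map assigning to each spatial set $\Delta\in\bigcup_{S\in\mathcal{S}}\mathcal{F}(S)$ an effect $E_\Delta$ on $\mathcal{H}$ (not necessarily a projection), satisfying: (1) Translation covariance: $U(a)E_\Delta U(a)^{*}=E_{\Delta+a}$ for all $a\in M$ and all spatial sets $\Delta$; (2) Localizability: for each $S\in\mathcal{S}$ and $\Delta_1,\Delta_2\in\mathcal{F}(S)$ with $\Delta_1\cap\Delta_2=\emptyset$, one has $E_{\Delta_1}E_{\Delta_2}=E_{\Delta_2}E_{\Delta_1}=0$; (3) Local commutativity: for $S_1,S_2\in\mathcal{S}$, $\Delta_1\in\mathcal{F}(S_1)$, $\Delta_2\in\mathcal{F}(S_2)$ spacelike separated, one has $E_{\Delta_1}E_{\Delta_2}=E_{\Delta_2}E_{\Delta_1}$. Then $E_\Delta=0$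 for every bounded spatial set $\Delta$.
   Context: An effect is a bounded operator $E$ on $\mathcal{H}$ with $0\le E\le I$. Two subsets $\Delta_1,\Delta_2\subset M$ are spacelike separated if $x-y$ is a spacelike vector for every $x\in\Delta_1$, $y\in\Delta_2$. A subset of a hyperplane $S$ is bounded if it is bounded in the Euclidean metric induced on $S$. *)

(* Defs.v *)
From Stdlib Require Import Reals.
Open Scope R_scope.

Record C := mkC { Cre : R ; Cim : R }.
Definition C0 : C := mkC 0 0.
Definition C1 : C := mkC 1 0.
Definition Ci : C := mkC 0 1.
Definition RtoC (r : R) : C := mkC r 0.
Definition Cadd (z w : C) : C := mkC (Cre z + Cre w) (Cim z + Cim w).
Definition Cmul (z w : C) : C :=
  mkC (Cre z * Cre w - Cim z * Cim w) (Cre z * Cim w + Cim z * Cre w).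
Definition Copp (z : C) : C := mkC (- Cre z) (- Cim z).
Definition Cconj (z : C) : C := mkC (Cre z) (- Cim z).

Record Hilbert := {
  hcar :> Type;
  hzero : hcar;
  hadd : hcar -> hcar -> hcar;
  hopp : hcar -> hcar;
  hscal : C -> hcar -> hcar;
  hinner : hcar -> hcar -> C;
  hadd_assoc : forall x y z, hadd x (hadd y z) = hadd (hadd x y) z;
  hadd_comm : forall x y, hadd x y = hadd y x;
  hadd_zero : forall x, hadd x hzero = x;
  hadd_opp : forall x, hadd x (hopp x) = hzero;
  hscal_one : forall x, hscal C1 x = x;
  hscal_mul : forall a b x, hscal (Cmul a b) x = hscal a (hscal b x);
  hscal_addC : forall a b x, hscal (Cadd a b) x = hadd (hscal a x) (hscal b x);
  hscal_addV : forall a x y, hscal a (hadd x y) = hadd (hscal a x) (hscal a y);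
  hinner_add : forall x y z, hinner x (hadd y z) = Cadd (hinner x y) (hinner x z);
  hinner_scal : forall a x y, hinner x (hscal a y) = Cmul a (hinner x y);
  hinner_conj : forall x y, hinner y x = Cconj (hinner x y);
  hinner_pos : forall x, Cim (hinner x x) = 0 /\ 0 <= Cre (hinner x x);
  hinner_def : forall x, hinner x x = C0 -> x = hzero;
  hcomplete : forall u : nat -> hcar,
    (forall eps, eps > 0 -> exists N, forall m n, (m >= N)%nat -> (n >= N)%nat ->
       sqrt (Cre (hinner (hadd (u m) (hopp (u n))) (hadd (u m) (hopp (u n))))) < eps) ->
    exists l, forall eps, eps > 0 -> exists N, forall n, (n >= N)%nat ->
       sqrt (Cre (hinner (hadd (u n) (hopp l)) (hadd (u n) (hopp l)))) < eps
}.

Arguments hzero {h}. Arguments hadd {h}. Arguments hopp {h}.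
Arguments hscal {h}. Arguments hinner {h}.

Definition hsub {H : Hilbert} (x y : H) : H := hadd x (hopp y).
Definition hnorm {H : Hilbert} (x : H) : R := sqrt (Cre (hinner x x)).

Definition linear_op {H : Hilbert} (T : H -> H) : Prop :=
  (forall x y, T (hadd x y) = hadd (T x) (T y)) /\
  (forall a x, T (hscal a x) = hscal a (T x)).

Definition bounded_op {H : Hilbert} (T : H -> H) : Prop :=
  linear_op T /\ exists K, forall x, hnorm (T x) <= K * hnorm x.

Definition adjoint_of {H : Hilbert} (T T' : H -> H) : Prop :=
  forall x y, hinner (T x) y = hinner x (T' y).

Definition is_effect {H : Hilbert} (E : H -> H) : Prop :=
  bounded_op E /\
  forall x, Cim (hinner x (E x)) = 0 /\
            0 <= Cre (hinner x (E x)) <= Cre (hinner x x).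

Definition unitary {H : Hilbert} (T : H -> H) : Prop :=
  linear_op T /\ (forall x y, hinner (T x) (T y) = hinner x y) /\
  (forall y, exists x, T x = y).

Record mink := Mk { m0 : R ; m1 : R ; m2 : R ; m3 : R }.
Definition mzero : mink := Mk 0 0 0 0.
Definition madd (x y : mink) : mink :=
  Mk (m0 x + m0 y) (m1 x + m1 y) (m2 x + m2 y) (m3 x + m3 y).
Definition mopp (x : mink) : mink := Mk (- m0 x) (- m1 x) (- m2 x) (- m3 x).
Definition msub (x y : mink) : mink := madd x (mopp y).
Definition mscal (t : R) (x : mink) : mink :=
  Mk (t * m0 x) (t * m1 x) (t * m2 x) (t * m3 x).
Definition mdot (x y : mink) : R :=
  m0 x * m0 y - m1 x * m1 y - m2 x * m2 y - m3 x * m3 y.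
Definition enorm (x : mink) : R :=
  sqrt (m0 x * m0 x + m1 x * m1 x + m2 x * m2 x + m3 x * m3 x).

Definition timelike (x : mink) : Prop := mdot x x > 0.
Definition spacelike (x : mink) : Prop := mdot x x < 0.
Definition future_timelike_unit (a : mink) : Prop := mdot a a = 1 /\ m0 a > 0.

Definition mset := mink -> Prop.
Definition translate (D : mset) (a : mink) : mset := fun x => D (msub x a).

Definition spacelike_separated (D1 D2 : mset) : Prop :=
  forall x y, D1 x -> D2 y -> spacelike (msub x y).

(* bounded w.r.t. the Euclidean metric induced on a spacelike hyperplane,
   d(x,y) = sqrt(- mdot (x-y) (x-y)) *)
Definition bounded_spatial (D : mset) : Prop :=
  exists Rb, forall x y, D x -> D y -> - mdot (msub x y) (msub x y) <= Rb.

Definition unitary_rep {H : Hilbert} (U : mink -> H -> H) : Prop :=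
  (forall a, unitary (U a)) /\
  (forall x, U mzero x = x) /\
  (forall a b x, U (madd a b) x = U a (U b x)).

Definition strongly_continuous {H : Hilbert} (U : mink -> H -> H) : Prop :=
  forall x a eps, eps > 0 -> exists del, del > 0 /\
    forall b, enorm (msub b a) < del -> hnorm (hsub (U b x) (U a x)) < eps.

(* (psi, phi) with phi = lim_{t->0} (U(ta) psi - psi)/t ; the generator H(a)
   (convention U(ta) = exp(i t H(a))) has domain the set of such psi, and
   H(a) psi = -i phi. *)
Definition gen_derivative {H : Hilbert} (U : mink -> H -> H) (a : mink) (psi phi : H)
  : Prop :=
  forall eps, eps > 0 -> exists del, del > 0 /\
    forall t, t <> 0 -> Rabs t < del ->
      hnorm (hsub (hscal (RtoC (/ t)) (hsub (U (mscal t a) psi) psi)) phi) < eps.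

Definition generator_bounded_below {H : Hilbert} (U : mink -> H -> H) (a : mink)
  : Prop :=
  exists c : R, forall psi phi, gen_derivative U a psi phi ->
    Cre (hinner psi (hscal (Copp Ci) phi)) >= c * Cre (hinner psi psi).

(* Main.v *)
(* Borchers' lemma is the heart of the matter: if [A], [F] are effects with [A F = 0], if the
   generator of [u] is bounded below and if [A] commutes with [F(t) = u(t) F u(-t)] for small [t],
   then [A u(t) F = 0] for all [t].  For [G = 1 - (1-F)^m], which increases to the support projection
   of [F], one has [A G = 0], so the product [G(t + c_1) ... G(t + c_n) F(t)] is annihilated by [A]
   at [t = - c_1, ..., - c_n].  Between analytic vectors its matrix elements are boundary values of a
   function holomorphic above the real axis, by positivity of the energy, and, by commutation with
   [A], also of one holomorphic below; Cauchy's formula holds across the axis and bounds the function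
   by [C q^n], uniformly in [m] and in the nodes.  Letting the [c_i] tend to 0, then [m] and [n] to
   infinity, gives [A u(t) F = 0] for small [t], and for all [t] by uniqueness of analytic
   continuation.

   The continuation of [u] is its Poisson integral.  It is holomorphic because
   [xi(z) = int u(t) x / (t - z)^2 dt] vanishes for [Im z < 0]: its norm grows with [|Im z|] by
   positivity of the generator, yet is at most [pi |x| / |Im z|].

   For a bounded [D] and a far spatial translation [b], the lemma applied to [E D] and [E (D + b)]
   gives [E D U(b + t a) E D = 0] for all [t] and all timelike [a].  These vectors [b + t a] contain a
   half-line [s n^], [s >= S], so [E D U(s n^) E D], again a boundary value of a holomorphic
   function, vanishes for all [s]; at [s = 0] this is [(E D)^2 = 0]. *)

Require Import Defs.
From Stdlib Require Import Reals Lra Lia Psatz ClassicalEpsilon FunctionalExtensionality PropExtensionality List FinFun.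
From Coquelicot Require Import Coquelicot.
Open Scope R_scope.

(** * Hilbert spaces as complete normed modules *)

(** Were [F] a projection, a product of [n + 1] of its translates would tend to [F] as the nodes
    shrink, and the bound [C q^n] could be used directly. For an effect it tends to [F^(n+1)], which
    moves with [n]. Hence [G]: it satisfies [A G = 0] as [F] does, while [G F y] is near [F y]. The
    choices are made in this order: [n]; then [m], making [G^n F y] near [F y] for one vector [y];
    then nodes so small that the product is near [G^n F y]. This is why the bound has to be uniform
    in [m] and in the nodes. The ratio is [q = 1/2]: a zero within [r/24] of 0 gains
    [(r/12) (3/r) = 1/4] against a contour at distance at least [r/3], and each factor [G] costs at
    most 2. Analytic vectors enter because in [u(z) F u(-z)] one of the two outer factors always
    points to the wrong half-plane. On [W (2 i r) y] the right one becomes [W (2 i r - z) y], which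
    exists while [Im z <= 2 r]. Holomorphy is used in one quantitative form, a first-order expansion
    with uniform quadratic remainder. Subdivision then kills the remainders, which yields the
    fundamental theorem of calculus and Cauchy's formula. *)

Lemma discriminant_le (a b c : R) :
  (forall t, 0 <= a * (t * t) + 2 * b * t + c) -> b * b <= a * c.
Proof.
  intros h.
  destruct (Req_dec a 0) as [->|Ha].
  - destruct (Req_dec b 0) as [->|Hb]; [lra|].
    specialize (h ((- c - 1) / (2 * b))).
    replace (0 * _ + 2 * b * ((- c - 1) / (2 * b)) + c) with (-1) in h by (field; lra). lra.
  - assert (0 < a).
    { destruct (Rlt_dec 0 a) as [|Hn]; [easy|exfalso].
      assert (Ha' : a < 0) by lra.
      pose proof (Rabs_pos b). pose proof (Rabs_pos c).
      (* Chosen so that [a t = a - (2 |b| + |c| + 1)] with [t >= 1]: the quadratic term then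
         outweighs the other two and the value at [t] is negative. *)
      pose (t := 1 + (2 * Rabs b + Rabs c + 1) / - a).
      assert (Ht : 1 <= t).
      { unfold t. assert (0 <= (2 * Rabs b + Rabs c + 1) / - a); [|lra].
        apply Rdiv_le_0_compat; lra. }
      specialize (h t).
      assert (e : a * t = a - (2 * Rabs b + Rabs c + 1)) by (unfold t; field; lra).
      pose proof (Rle_abs b). pose proof (Rle_abs c).
      replace (a * (t * t)) with (a * t * t) in h by ring. rewrite e in h. nra. }
    specialize (h (- b / a)).
    replace (a * (- b / a * (- b / a)) + 2 * b * (- b / a) + c) with ((a * c - b * b) / a) in h
      by (field; lra).
    assert (0 <= (a * c - b * b) / a * a) by (apply Rmult_le_pos; lra).
    replace ((a * c - b * b) / a * a) with (a * c - b * b) in H0 by (field; lra). lra.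
Qed.

(** Serves every argument that wants [e / K] where [K] may vanish. *)
Lemma lt_absorb k K y e : 0 <= y -> k <= K -> 0 <= K -> y < e / (K + 1) -> k * y < e.
Proof.
  intros hy hk hK h. apply (Rmult_lt_compat_l (K + 1)) in h; [|lra].
  replace ((K + 1) * (e / (K + 1))) with e in h by (field; lra). nra.
Qed.

Lemma Cmod_Ci : Cmod Ci = 1.
Proof.
  unfold Cmod; simpl. replace (0 * (0 * 1) + 1 * (1 * 1)) with 1 by ring. apply sqrt_1.
Qed.

(** The statement has its own record of complex numbers, the analysis uses Coquelicot's pairs; [ip]
    and [csc] are the inner product and scalar multiplication seen through this translation. *)
Definition toC (z : Defs.C) : C := (Cre z, Cim z).
Definition ofC (z : C) : Defs.C := mkC (fst z) (snd z).
Definition ip {H : Hilbert} (x y : H) : C := toC (hinner x y).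
Definition csc {H : Hilbert} (a : C) (x : H) : H := hscal (ofC a) x.

Lemma toC_ofC z : toC (ofC z) = z.
Proof. now destruct z. Qed.

Section HilbertBasics.
Context {H : Hilbert}.
Implicit Types x y z : H.

Lemma ip_hadd_r x y z : ip x (hadd y z) = (ip x y + ip x z)%C.
Proof. unfold ip. now rewrite hinner_add. Qed.

Lemma ip_csc_r a x y : ip x (csc a y) = (a * ip x y)%C.
Proof. unfold ip, csc. now rewrite hinner_scal. Qed.

Lemma ip_conj x y : ip y x = Cconj (ip x y).
Proof. unfold ip. now rewrite hinner_conj. Qed.

Lemma ip_hadd_l x y z : ip (hadd x y) z = (ip x z + ip y z)%C.
Proof.
  rewrite ip_conj, ip_hadd_r, (ip_conj z x), (ip_conj z y).
  rewrite Cplus_conj. reflexivity.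
Qed.

Lemma ip_csc_l a x y : ip (csc a x) y = (Cconj a * ip x y)%C.
Proof. now rewrite ip_conj, ip_csc_r, Cmult_conj, <- ip_conj. Qed.

Lemma ip_self x : ip x x = RtoC (Re (ip x x)) /\ 0 <= Re (ip x x).
Proof.
  destruct (hinner_pos H x) as [h1 h2]. unfold ip, toC, RtoC; simpl. now rewrite h1.
Qed.

Lemma csc_1 x : csc 1 x = x.
Proof. apply hscal_one. Qed.

Lemma csc_csc a b x : csc a (csc b x) = csc (a * b)%C x.
Proof. unfold csc. now rewrite <- hscal_mul. Qed.

Lemma csc_hadd a x y : csc a (hadd x y) = hadd (csc a x) (csc a y).
Proof. apply hscal_addV. Qed.

Lemma csc_plus_l a b x : csc (a + b)%C x = hadd (csc a x) (csc b x).
Proof. unfold csc. now rewrite <- hscal_addC. Qed.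

Lemma hadd_cancel x y z : hadd x y = hadd x z -> y = z.
Proof.
  intros e. rewrite <- (hadd_zero H y), <- (hadd_opp H x), hadd_comm.
  rewrite <- (hadd_zero H z), <- (hadd_opp H x), (hadd_comm H z).
  now rewrite (hadd_comm H x (hopp x)), <- 2 hadd_assoc, e.
Qed.

Lemma csc_0 x : csc 0 x = hzero.
Proof.
  apply (hadd_cancel (csc 0 x)). rewrite <- csc_plus_l, hadd_zero. f_equal. ring.
Qed.

Lemma hopp_csc x : hopp x = csc (-1) x.
Proof.
  apply (hadd_cancel x). rewrite hadd_opp.
  transitivity (hadd (csc 1 x) (csc (-1) x)); [|now rewrite csc_1].
  rewrite <- csc_plus_l, <- (csc_0 x). f_equal.
  apply injective_projections; simpl; ring.
Qed.

Lemma hnorm_sq x : hnorm x * hnorm x = Re (ip x x).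
Proof. apply sqrt_sqrt. apply (proj2 (ip_self x)). Qed.

Lemma hnorm_ge0 x : 0 <= hnorm x.
Proof. apply sqrt_pos. Qed.

Lemma hnorm_eq0 x : hnorm x = 0 -> x = hzero.
Proof.
  intros h. apply hinner_def. pose proof (hnorm_sq x) as e. rewrite h in e.
  destruct (hinner_pos H x) as [h1 _]. unfold ip, toC in e; simpl in e.
  destruct (hinner x x) as [p q]; simpl in *. unfold Defs.C0. f_equal; lra.
Qed.

(** Stated for an arbitrary positive semidefinite form because [effect_norm_sq] needs it for
    [<x, E y>]. *)
Lemma form_cauchy_schwarz (B : H -> H -> C)
  (Badd : forall x y z, B x (hadd y z) = (B x y + B x z)%C)
  (Bscal : forall a x y, B x (csc a y) = (a * B x y)%C)
  (Bconj : forall x y, B y x = Cconj (B x y))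
  (Bpos : forall x, 0 <= Re (B x x)) x y :
  Cmod (B x y) * Cmod (B x y) <= Re (B x x) * Re (B y y).
Proof.
  assert (Baddl : forall x y z, B (hadd x y) z = (B x z + B y z)%C).
  { intros. now rewrite Bconj, Badd, Cplus_conj, <- !Bconj. }
  assert (Bscall : forall a x y, B (csc a x) y = (Cconj a * B x y)%C).
  { intros. now rewrite Bconj, Bscal, Cmult_conj, <- Bconj. }
  assert (Bre : forall x, Im (B x x) = 0).
  { intros z. pose proof (f_equal Im (Bconj z z)) as e. destruct (B z z); simpl in *; lra. }
  set (b := B x y).
  assert (e : Cmod b * Cmod b = Re b * Re b + Im b * Im b).
  { pose proof (Cmod2_alt b). simpl in *. lra. }
  (* Positivity at [t b x + y] is the quadratic [|b|^2 B(x,x) t^2 + 2 |b|^2 t + B(y,y)]; its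
     discriminant carries one factor [|b|^2] too many, cancelled below. *)
  assert (h : (Cmod b * Cmod b) * (Cmod b * Cmod b)
      <= (Cmod b * Cmod b * Re (B x x)) * Re (B y y)).
  { apply discriminant_le. intros t.
    pose proof (Bpos (hadd (csc (RtoC t * b) x) y)) as p.
    rewrite Badd, 2 Baddl, Bscall, !Bscal, Bscall, (Bconj x y) in p. fold b in p.
    pose proof (Bre x) as q.
    rewrite e. destruct (B x x) as [x1 x2], (B y y) as [y1 y2], b as [b1 b2].
    simpl in *. rewrite q in p. nra. }
  pose proof (Cmod_ge_0 b).
  destruct (Req_dec (Cmod b) 0) as [z|z].
  - rewrite z. pose proof (Bpos x). pose proof (Bpos y). nra.
  - assert (0 < Cmod b * Cmod b) by nra.
    apply (Rmult_le_reg_l (Cmod b * Cmod b)); [easy|]. lra.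
Qed.

Lemma cauchy_schwarz x y : Cmod (ip x y) <= hnorm x * hnorm y.
Proof.
  apply Rsqr_incr_0_var; [|apply Rmult_le_pos; apply hnorm_ge0].
  unfold Rsqr. replace (hnorm x * hnorm y * (hnorm x * hnorm y)) with
    (hnorm x * hnorm x * (hnorm y * hnorm y)) by ring. rewrite 2 hnorm_sq.
  apply (form_cauchy_schwarz ip); intros; [apply ip_hadd_r|apply ip_csc_r|apply ip_conj|apply ip_self].
Qed.

Lemma hnorm_csc a x : hnorm (csc a x) = Cmod a * hnorm x.
Proof.
  apply Rsqr_inj; [apply hnorm_ge0|apply Rmult_le_pos; [apply Cmod_ge_0|apply hnorm_ge0]|].
  unfold Rsqr. rewrite hnorm_sq.
  replace (Cmod a * hnorm x * (Cmod a * hnorm x)) with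
    (Cmod a ^ 2 * (hnorm x * hnorm x)) by ring.
  rewrite hnorm_sq, Cmod2_alt, ip_csc_l, ip_csc_r.
  destruct (ip_self x) as [e _]. rewrite e. destruct a; simpl. ring.
Qed.

Lemma hnorm_hadd x y : hnorm (hadd x y) <= hnorm x + hnorm y.
Proof.
  pose proof (hnorm_ge0 x). pose proof (hnorm_ge0 y).
  apply Rsqr_incr_0_var; [|lra]. unfold Rsqr.
  rewrite hnorm_sq, ip_hadd_r, 2 ip_hadd_l, (ip_conj x y).
  pose proof (cauchy_schwarz x y). pose proof (re_le_Cmod (ip x y)).
  pose proof (Rle_abs (Re (ip x y))).
  pose proof (hnorm_sq x). pose proof (hnorm_sq y).
  destruct (ip x y); simpl in *. nra.
Qed.

End HilbertBasics.

Section HilbertStructures.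
Variable H : Hilbert.

Definition hilbert_AbelianMonoid_mixin := AbelianMonoid.Mixin H hadd hzero
  (hadd_comm H) (hadd_assoc H) (hadd_zero H).
Canonical hilbert_AbelianMonoid := AbelianMonoid.Pack H hilbert_AbelianMonoid_mixin H.

Definition hilbert_AbelianGroup_mixin := AbelianGroup.Mixin hilbert_AbelianMonoid hopp (hadd_opp H).
Canonical hilbert_AbelianGroup := AbelianGroup.Pack H (AbelianGroup.Class _ _ hilbert_AbelianGroup_mixin) H.

(** [RInt] takes values in normed modules over the reals, so the complex space is registered as a
    real one. Complex linearity of integrals is recovered by [hint_csc]. *)
Definition rsc (r : R) (x : H) : H := csc (RtoC r) x.

Lemma rsc_rsc (r s : R) (x : H) : rsc r (rsc s x) = rsc (r * s) x.
Proof. unfold rsc. now rewrite csc_csc, <- RtoC_mult. Qed.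

Lemma rsc_plus_l (r s : R) (x : H) : rsc (r + s) x = hadd (rsc r x) (rsc s x).
Proof. unfold rsc. now rewrite RtoC_plus, csc_plus_l. Qed.

Definition hilbert_ModuleSpace_mixin := ModuleSpace.Mixin R_Ring hilbert_AbelianGroup rsc
  rsc_rsc (fun x => csc_1 x) (fun r x y => csc_hadd (RtoC r) x y) rsc_plus_l.
Canonical hilbert_ModuleSpace := ModuleSpace.Pack R_Ring H
  (ModuleSpace.Class _ _ _ hilbert_ModuleSpace_mixin) H.

Definition hball (x : H) (e : R) (y : H) := hnorm (hadd y (hopp x)) < e.

Lemma hball_center (x : H) (e : posreal) : hball x e x.
Proof.
  unfold hball. rewrite hadd_opp, <- (csc_0 hzero), hnorm_csc, Cmod_0.
  rewrite Rmult_0_l. apply cond_pos.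
Qed.

Lemma hnorm_hsub_sym (x y : H) : hnorm (hadd x (hopp y)) = hnorm (hadd y (hopp x)).
Proof.
  replace (hadd y (hopp x)) with (csc (-1) (hadd x (hopp y))).
  - rewrite hnorm_csc. replace (Cmod (-1)) with 1; [ring|].
    rewrite Cmod_R, Rabs_left; lra.
  - rewrite csc_hadd, <- !hopp_csc, hadd_comm. f_equal.
    rewrite !hopp_csc, csc_csc. transitivity (csc 1 y); [|now rewrite csc_1]. f_equal.
    apply injective_projections; simpl; ring.
Qed.

Lemma hball_sym (x y : H) (e : R) : hball x e y -> hball y e x.
Proof. unfold hball. now rewrite hnorm_hsub_sym. Qed.

Lemma hball_triangle (x y z : H) (e1 e2 : R) :
  hball x e1 y -> hball y e2 z -> hball x (e1 + e2) z.
Proof.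
  unfold hball. intros h1 h2.
  replace (hadd z (hopp x)) with (hadd (hadd y (hopp x)) (hadd z (hopp y))).
  - pose proof (hnorm_hadd (hadd y (hopp x)) (hadd z (hopp y))). lra.
  - rewrite (hadd_comm _ (hadd y (hopp x))), <- hadd_assoc. f_equal.
    rewrite hadd_assoc, (hadd_comm _ (hopp y)), hadd_opp, hadd_comm. apply hadd_zero.
Qed.

Definition hilbert_UniformSpace_mixin :=
  UniformSpace.Mixin H hzero hball hball_center hball_sym hball_triangle.
Canonical hilbert_UniformSpace := UniformSpace.Pack H hilbert_UniformSpace_mixin H.

Canonical hilbert_NormedModuleAux := NormedModuleAux.Pack R_AbsRing H
  (NormedModuleAux.Class R_AbsRing H
    (ModuleSpace.Class _ _ _ hilbert_ModuleSpace_mixin) hilbert_UniformSpace_mixin) H.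

Lemma hnorm_rsc_le (r : R) (x : H) : hnorm (rsc r x) <= abs r * hnorm x.
Proof. unfold rsc. rewrite hnorm_csc, Cmod_R. apply Rle_refl. Qed.

Lemma hball_norm (x y : H) (e : posreal) : hball x e y -> hnorm (hadd y (hopp x)) < 1 * e.
Proof. now rewrite Rmult_1_l. Qed.

Definition hilbert_NormedModule_mixin := NormedModule.Mixin R_AbsRing hilbert_NormedModuleAux
  hnorm 1 hnorm_hadd hnorm_rsc_le (fun x y e h => h) hball_norm hnorm_eq0.
Canonical hilbert_NormedModule := NormedModule.Pack R_AbsRing H
  (NormedModule.Class _ _ _ hilbert_NormedModule_mixin) H.

Definition filter_limit (F : (H -> Prop) -> Prop) : H :=
  epsilon (inhabits hzero) (fun l => forall e : posreal, F (ball l e)).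

Lemma filter_limit_spec (F : (H -> Prop) -> Prop) :
  ProperFilter F -> cauchy F -> forall e : posreal, F (ball (filter_limit F) e).
Proof.
  intros HF HC. apply (epsilon_spec (inhabits hzero) (fun l => forall e : posreal, F (ball l e))).
  assert (ipos : forall n : nat, 0 < / (INR n + 1)).
  { intros n. apply Rinv_0_lt_compat. pose proof (pos_INR n). lra. }
  (* Centres of balls of radius [1/(n+1)] belonging to the filter. Two such balls meet, the filter
     being proper, so the centres form a Cauchy sequence. *)
  pose (u := fun n => epsilon (inhabits hzero) (fun x => F (ball x (mkposreal _ (ipos n))))).
  assert (hu : forall n, F (ball (u n) (mkposreal _ (ipos n)))).
  { intros n. apply (epsilon_spec (inhabits hzero) (fun x => F (ball x (mkposreal _ (ipos n))))), HC. }
  assert (small : forall e, 0 < e -> exists N, forall n, (N <= n)%nat -> / (INR n + 1) < e).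
  { intros e he. destruct (archimed_cor1 e he) as [N [h1 h2]]. exists N. intros n hn.
    apply Rle_lt_trans with (2 := h1). apply Rinv_le_contravar; [now apply lt_0_INR|].
    apply le_INR in hn. lra. }
  assert (cau : forall n m, hnorm (hadd (u m) (hopp (u n))) < / (INR n + 1) + / (INR m + 1)).
  { intros n m. destruct (filter_ex _ (filter_and _ _ (hu n) (hu m))) as [z [h1 h2]].
    apply (hball_triangle _ z); [exact h1|]. apply hball_sym, h2. }
  destruct (hcomplete H u) as [l hl].
  - intros e he. destruct (small (e / 2)) as [N hN]; [lra|]. exists N. intros m n hm hn.
    pose proof (cau n m). pose proof (hN n hn). pose proof (hN m hm). unfold hnorm in *. lra.
  - exists l. intros e. destruct (hl (e / 2)) as [N1 h1]; [pose proof (cond_pos e); lra|].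
    destruct (small (e / 2)) as [N2 h2]; [pose proof (cond_pos e); lra|].
    specialize (h1 (N1 + N2)%nat ltac:(lia)). specialize (h2 (N1 + N2)%nat ltac:(lia)).
    apply filter_imp with (2 := hu (N1 + N2)%nat). intros x hx.
    replace (pos e) with (e / 2 + e / 2) by field.
    apply (hball_triangle _ (u (N1 + N2)%nat)); [exact h1|].
    unfold ball in hx; simpl in hx. unfold hball in hx |- *. lra.
Qed.

Lemma filter_limit_close (F1 F2 : (H -> Prop) -> Prop) :
  filter_le F1 F2 -> filter_le F2 F1 -> close (filter_limit F1) (filter_limit F2).
Proof.
  intros h1 h2. replace F2 with F1; [apply close_refl|].
  apply functional_extensionality; intros P. apply propositional_extensionality.
  split; [apply h2|apply h1].
Qed.

Definition hilbert_CompleteSpace_mixin := CompleteSpace.Mixin hilbert_UniformSpace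
  filter_limit filter_limit_spec filter_limit_close.
Canonical hilbert_CompleteNormedModule := CompleteNormedModule.Pack R_AbsRing H
  (CompleteNormedModule.Class _ _ (NormedModule.class _ hilbert_NormedModule) hilbert_CompleteSpace_mixin) H.

End HilbertStructures.

(** * Integrals of vector-valued functions *)

Section VectorAlgebra.
Context {H : Hilbert}.
Implicit Types x y z : H.

Lemma ip_hopp_r x y : ip x (hopp y) = (- ip x y)%C.
Proof. rewrite hopp_csc, ip_csc_r. apply injective_projections; simpl; ring. Qed.

Lemma ip_hopp_l x y : ip (hopp x) y = (- ip x y)%C.
Proof. rewrite ip_conj, ip_hopp_r, Copp_conj, <- ip_conj. reflexivity. Qed.

Lemma ip_hzero_r x : ip x hzero = 0.
Proof. rewrite <- (csc_0 hzero), ip_csc_r. ring. Qed.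

Lemma ip_hsub_r x y z : ip x (hsub y z) = (ip x y - ip x z)%C.
Proof. unfold hsub. now rewrite ip_hadd_r, ip_hopp_r. Qed.

Lemma ip_hsub_l x y z : ip (hsub x y) z = (ip x z - ip y z)%C.
Proof. unfold hsub. now rewrite ip_hadd_l, ip_hopp_l. Qed.

Lemma hnorm_hzero : hnorm (hzero : H) = 0.
Proof. rewrite <- (csc_0 hzero), hnorm_csc, Cmod_0. ring. Qed.

Lemma hsub_diag x : hsub x x = hzero.
Proof. apply hadd_opp. Qed.

Lemma hsub_eq0 x y : hnorm (hsub x y) = 0 -> x = y.
Proof.
  intros h. apply hnorm_eq0 in h. apply (hadd_cancel (hopp y)).
  rewrite hadd_comm, (hadd_comm _ (hopp y) y), hadd_opp. exact h.
Qed.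

Lemma ip_ext x y : (forall v, ip v x = ip v y) -> x = y.
Proof.
  intros h. apply hsub_eq0.
  assert (e : ip (hsub x y) (hsub x y) = 0) by (rewrite ip_hsub_r, h; ring).
  pose proof (hnorm_sq (hsub x y)) as q. rewrite e in q. simpl in q. nra.
Qed.

Lemma hnorm_hsub_comm x y : hnorm (hsub x y) = hnorm (hsub y x).
Proof. apply hnorm_hsub_sym. Qed.

End VectorAlgebra.

(** A vector identity is tested against an arbitrary [v], which turns it into an identity of complex
    numbers within reach of [ring] and [field]. *)
Ltac vec := apply ip_ext; intros ?v; unfold hsub;
  repeat (rewrite ?ip_hadd_r, ?ip_hopp_r, ?ip_csc_r, ?ip_hzero_r); try ring; try (field; auto).

Section VectorNorms.
Context {H : Hilbert}.
Implicit Types x y z : H.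

Lemma hnorm_hsub_le x y : hnorm (hsub x y) <= hnorm x + hnorm y.
Proof.
  unfold hsub. eapply Rle_trans; [apply hnorm_hadd|].
  rewrite (hopp_csc y), hnorm_csc, Cmod_R, Rabs_left by lra. lra.
Qed.

Lemma hnorm_hsub_triangle x y z : hnorm (hsub x z) <= hnorm (hsub x y) + hnorm (hsub y z).
Proof. replace (hsub x z) with (hadd (hsub x y) (hsub y z)) by vec. apply hnorm_hadd. Qed.

Lemma hnorm_le_hsub x y : hnorm x <= hnorm y + hnorm (hsub x y).
Proof. replace x with (hadd y (hsub x y)) at 1 by vec. apply hnorm_hadd. Qed.

Lemma small_eq x y : (forall e, 0 < e -> hnorm (hsub x y) <= e) -> x = y.
Proof.
  intros h. apply hsub_eq0. pose proof (hnorm_ge0 (hsub x y)).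
  destruct (Req_dec (hnorm (hsub x y)) 0) as [|n]; [easy|].
  specialize (h (hnorm (hsub x y) / 2)). lra.
Qed.

End VectorNorms.

Lemma C_hilbert_complete (u : nat -> C) :
  (forall eps, eps > 0 -> exists N, forall m n, (m >= N)%nat -> (n >= N)%nat ->
     Cmod (u m - u n) < eps) ->
  exists l, forall eps, eps > 0 -> exists N, forall n, (n >= N)%nat -> Cmod (u n - l) < eps.
Proof.
  intros h.
  destruct (Rcomplete.R_complete (fun n => Re (u n))) as [a ha].
  { intros e he. destruct (h e he) as [N hN]. exists N. intros n m hn hm.
    specialize (hN n m hn hm). pose proof (re_le_Cmod (u n - u m)). unfold Rdist.
    destruct (u n), (u m); simpl in *. unfold Rminus. lra. }
  destruct (Rcomplete.R_complete (fun n => Im (u n))) as [b hb].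
  { intros e he. destruct (h e he) as [N hN]. exists N. intros n m hn hm.
    specialize (hN n m hn hm). unfold Rdist.
    pose proof (Rmax_Cmod (u n - u m)%C). pose proof (Rmax_r (Rabs (fst (u n - u m)%C)) (Rabs (snd (u n - u m)%C))).
    destruct (u n), (u m); simpl in *. unfold Rminus. lra. }
  exists (a, b). intros e he.
  destruct (ha (e / 2)) as [N1 h1]; [lra|]. destruct (hb (e / 2)) as [N2 h2]; [lra|].
  exists (N1 + N2)%nat. intros n hn. specialize (h1 n ltac:(lia)). specialize (h2 n ltac:(lia)).
  unfold Rdist in *. replace (u n - (a, b))%C with (RtoC (Re (u n) - a) + Ci * RtoC (Im (u n) - b))%C
    by (destruct (u n); apply injective_projections; simpl; ring).
  eapply Rle_lt_trans; [apply Cmod_triangle|]. rewrite Cmod_mult, 2 Cmod_R.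
  rewrite Cmod_Ci. lra.
Qed.

Lemma C_hnorm (z : C) : sqrt (Cre (ofC (Cconj z * z))) = Cmod z.
Proof. destruct z as [a b]. unfold Cmod; simpl. f_equal. ring. Qed.

(* The complex numbers as a Hilbert space, so that one integral serves vectors and scalars. *)
Definition CH : Hilbert.
Proof.
  refine (Build_Hilbert C 0 Cplus Copp (fun z x => toC z * x)%C (fun x y => ofC (Cconj x * y))
    Cplus_assoc Cplus_comm Cplus_0_r Cplus_opp_r _ _ _ _ _ _ _ _ _ _).
  - intros [x1 x2]. apply injective_projections; simpl; ring.
  - intros [a1 a2] [b1 b2] [x1 x2]. apply injective_projections; simpl; ring.
  - intros [a1 a2] [b1 b2] [x1 x2]. apply injective_projections; simpl; ring.
  - intros a x y. ring.
  - intros [x1 x2] [y1 y2] [z1 z2]. unfold ofC, Defs.Cadd; simpl. f_equal; ring.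
  - intros [a1 a2] [x1 x2] [y1 y2]. unfold ofC, Defs.Cmul; simpl. f_equal; ring.
  - intros [x1 x2] [y1 y2]. unfold ofC, Defs.Cconj; simpl. f_equal; ring.
  - intros [x1 x2]. simpl. split; [ring|nra].
  - intros [x1 x2] e. unfold ofC, Defs.C0 in e. simpl in e. injection e as e1 e2.
    apply injective_projections; simpl; nra.
  - intros u h. destruct (C_hilbert_complete u) as [l hl].
    + intros e he. destruct (h e he) as [N hN]. exists N. intros m n hm hn.
      rewrite <- C_hnorm. exact (hN m n hm hn).
    + exists l. intros e he. destruct (hl e he) as [N hN]. exists N. intros n hn.
      specialize (hN n hn). rewrite <- C_hnorm in hN. exact hN.
Defined.

Lemma hnorm_CH (z : CH) : hnorm z = Cmod z.
Proof. apply C_hnorm. Qed.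

Lemma csc_CH (a : C) (z : CH) : csc a z = (a * z)%C.
Proof. unfold csc. simpl. now rewrite toC_ofC. Qed.

Definition hcont_on {H : Hilbert} (a b : R) (g : R -> H) : Prop :=
  forall t, a <= t <= b -> forall e, 0 < e -> exists d, 0 < d /\
    forall s, a <= s <= b -> Rabs (s - t) < d -> hnorm (hsub (g s) (g t)) < e.

Definition hint {H : Hilbert} (g : R -> H) (a b : R) : H := RInt g a b.

Section Integral.
Context {H : Hilbert}.

(** Retraction onto the interval. It turns continuity relative to [[a, b]] into the two-sided
    continuity at the endpoints that [ex_RInt_continuous] asks for. *)
Definition clamp (a b t : R) : R := Rmax a (Rmin b t).

Lemma clamp_in a b t : a <= b -> a <= clamp a b t <= b.
Proof. intros h. unfold clamp. split; [apply Rmax_l|]. apply Rmax_lub; [easy|apply Rmin_l]. Qed.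

Lemma clamp_id a b t : a <= t <= b -> clamp a b t = t.
Proof. intros [h1 h2]. unfold clamp. now rewrite Rmin_right, Rmax_right by lra. Qed.

Lemma clamp_lip a b s t : Rabs (clamp a b s - clamp a b t) <= Rabs (s - t).
Proof.
  unfold clamp, Rmax, Rmin. repeat destruct Rle_dec; unfold Rabs; repeat destruct Rcase_abs; lra.
Qed.

Lemma ex_hint (g : R -> H) a b : a <= b -> hcont_on a b g -> ex_RInt g a b.
Proof.
  intros hab hg. apply ex_RInt_ext with (fun t => g (clamp a b t)).
  { intros t ht. rewrite Rmin_left, Rmax_right in ht by easy. now rewrite clamp_id by lra. }
  apply (ex_RInt_continuous (V := hilbert_CompleteNormedModule H)). intros t _.
  apply filterlim_locally. intros e.
  destruct (hg (clamp a b t) (clamp_in a b t hab) e (cond_pos e)) as [d [hd hs]].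
  exists (mkposreal d hd). intros s Hs.
  apply hs; [now apply clamp_in|]. eapply Rle_lt_trans; [apply clamp_lip|exact Hs].
Qed.

Lemma hcont_on_sub (g : R -> H) a b c d :
  a <= c -> d <= b -> hcont_on a b g -> hcont_on c d g.
Proof.
  intros h1 h2 hg t ht e he. destruct (hg t ltac:(lra) e he) as [r [hr hs]].
  exists r. split; [easy|]. intros s Hs. apply hs. lra.
Qed.

Lemma hint_norm_le (g : R -> H) (h : R -> R) a b :
  a <= b -> hcont_on a b g -> ex_RInt h a b ->
  (forall t, a <= t <= b -> hnorm (g t) <= h t) -> hnorm (hint g a b) <= RInt h a b.
Proof.
  intros hab hg hh hle.
  apply (norm_RInt_le (V := hilbert_NormedModule H) g h a b); [easy|exact hle| |].
  - apply (RInt_correct (V := hilbert_CompleteNormedModule H)). now apply ex_hint.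
  - now apply (RInt_correct (V := R_CompleteNormedModule)).
Qed.

Lemma hint_norm_const (g : R -> H) a b M :
  a <= b -> hcont_on a b g -> (forall t, a <= t <= b -> hnorm (g t) <= M) ->
  hnorm (hint g a b) <= (b - a) * M.
Proof.
  intros hab hg hM.
  replace ((b - a) * M) with (RInt (fun _ => M) a b) by (now rewrite RInt_const).
  apply hint_norm_le; auto. apply ex_RInt_const.
Qed.

Lemma hint_Chasles (g : R -> H) a b c : a <= b -> b <= c -> hcont_on a c g ->
  hadd (hint g a b) (hint g b c) = hint g a c.
Proof.
  intros h1 h2 hg. apply (RInt_Chasles (V := hilbert_CompleteNormedModule H)).
  - apply ex_hint; [easy|]. apply (hcont_on_sub g a c); auto; lra.
  - apply ex_hint; [easy|]. apply (hcont_on_sub g a c); auto; lra.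
Qed.

Lemma hint_ext (f g : R -> H) a b : a <= b -> (forall t, a <= t <= b -> f t = g t) ->
  hint f a b = hint g a b.
Proof.
  intros hab h. apply (RInt_ext (V := hilbert_CompleteNormedModule H)). intros t ht.
  rewrite Rmin_left, Rmax_right in ht by easy. apply h. lra.
Qed.

Lemma hint_shift (g : R -> H) a b c : a <= b -> hcont_on (a + c) (b + c) g ->
  hint (fun t => g (t + c)) a b = hint g (a + c) (b + c).
Proof.
  intros hab hg.
  pose proof (RInt_comp_lin (V := hilbert_CompleteNormedModule H) g 1 c a b) as e.
  rewrite !Rmult_1_l in e. specialize (e ltac:(apply ex_hint; [lra|easy])).
  unfold hint. rewrite <- e. apply (RInt_ext (V := hilbert_CompleteNormedModule H)).
  intros t _. rewrite Rmult_1_l. symmetry. apply (scal_one (V := hilbert_ModuleSpace H)).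
Qed.

Lemma hint_const (x : H) a b : hint (fun _ => x) a b = csc (RtoC (b - a)) x.
Proof. apply (RInt_const (V := hilbert_CompleteNormedModule H)). Qed.

End Integral.

(** Linearity is over the reals so that complex conjugation qualifies, as in [cint_conj]. *)
Record bounded_real_linear {H H' : Hilbert} (L : H -> H') (K : R) : Prop := {
  brl_add : forall x y, L (hadd x y) = hadd (L x) (L y);
  brl_scal : forall (r : R) x, L (csc (RtoC r) x) = csc (RtoC r) (L x);
  brl_bound : forall x, hnorm (L x) <= K * hnorm x }.

Section LinearMaps.
Context {H H' : Hilbert} (L : H -> H') (K : R) (HL : bounded_real_linear L K).

Lemma brl_hzero : L hzero = hzero.
Proof.
  rewrite <- (csc_0 hzero), (brl_scal _ _ HL). apply csc_0.
Qed.

Lemma brl_hsub x y : L (hsub x y) = hsub (L x) (L y).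
Proof.
  unfold hsub. rewrite (brl_add _ _ HL), 2 hopp_csc. f_equal. apply (brl_scal _ _ HL).
Qed.

Lemma brl_lip x y : hnorm (hsub (L x) (L y)) <= K * hnorm (hsub x y).
Proof. rewrite <- brl_hsub. apply (brl_bound _ _ HL). Qed.

Lemma brl_cont g a b : hcont_on a b g -> hcont_on a b (fun t => L (g t)).
Proof.
  intros hg t ht e he. pose proof (Rabs_pos K).
  destruct (hg t ht (e / (Rabs K + 1))) as [d [hd hs]]; [apply Rdiv_lt_0_compat; lra|].
  exists d. split; [easy|]. intros s hs1 hs2. specialize (hs s hs1 hs2).
  apply Rle_lt_trans with (1 := brl_lip _ _).
  pose proof (Rle_abs K). pose proof (hnorm_ge0 (hsub (g s) (g t))) as p.
  apply (lt_absorb _ (Rabs K)); lra.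
Qed.

(** [L] commutes with every Riemann sum and is Lipschitz, hence with their limit. *)
Lemma hint_linear g a b : a <= b -> hcont_on a b g ->
  hint (fun t => L (g t)) a b = L (hint g a b).
Proof.
  intros hab hg. apply (is_RInt_unique (V := hilbert_CompleteNormedModule H')).
  pose proof (RInt_correct (V := hilbert_CompleteNormedModule H) g a b (ex_hint g a b hab hg)) as hi.
  unfold is_RInt in *.
  assert (sum : forall ptd, Riemann_sum (V := hilbert_ModuleSpace H') (fun t => L (g t)) ptd
     = L (Riemann_sum (V := hilbert_ModuleSpace H) g ptd)).
  { intros ptd. apply SF_cons_ind with (s := ptd).
    - intros x0. unfold Riemann_sum; simpl. symmetry. apply brl_hzero.
    - intros h s IH. rewrite 2 Riemann_sum_cons, IH.
      etransitivity; [|symmetry; apply (brl_add _ _ HL)].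
      apply (f_equal2 hadd); [symmetry; apply (brl_scal _ _ HL)|reflexivity]. }
  apply filterlim_ext with
    (fun ptd => L (scal (sign (b - a)) (Riemann_sum (V := hilbert_ModuleSpace H) g ptd))).
  { intros ptd. rewrite sum. apply (brl_scal _ _ HL). }
  eapply filterlim_comp; [exact hi|]. apply filterlim_locally. intros e.
  pose proof (Rabs_pos K) as pK.
  assert (hd : 0 < e / (Rabs K + 1)) by (apply Rdiv_lt_0_compat; [apply cond_pos|lra]).
  exists (mkposreal _ hd). intros y hy. change (hnorm (hsub y (hint g a b)) < e / (Rabs K + 1)) in hy.
  change (hnorm (hsub (L y) (L (hint g a b))) < e).
  apply Rle_lt_trans with (1 := brl_lip _ _).
  pose proof (Rle_abs K). pose proof (hnorm_ge0 (hsub y (hint g a b))) as p.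
  apply (lt_absorb _ (Rabs K)); lra.
Qed.

End LinearMaps.

Lemma csc_brl {H : Hilbert} (a : C) : bounded_real_linear (csc (H:=H) a) (Cmod a).
Proof.
  split; intros.
  - apply csc_hadd.
  - rewrite 2 csc_csc. f_equal. ring.
  - rewrite hnorm_csc. lra.
Qed.

Section IntegralAlgebra.
Context {H : Hilbert}.
Implicit Types f g : R -> H.

Lemma hcont_on_add a b f g : hcont_on a b f -> hcont_on a b g ->
  hcont_on a b (fun t => hadd (f t) (g t)).
Proof.
  intros hf hg t ht e he.
  destruct (hf t ht (e / 2)) as [d1 [h1 h1']]; [lra|].
  destruct (hg t ht (e / 2)) as [d2 [h2 h2']]; [lra|].
  exists (Rmin d1 d2). split; [now apply Rmin_glb_lt|]. intros s hs1 hs2.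
  specialize (h1' s hs1 (Rlt_le_trans _ _ _ hs2 (Rmin_l _ _))).
  specialize (h2' s hs1 (Rlt_le_trans _ _ _ hs2 (Rmin_r _ _))).
  replace (hsub (hadd (f s) (g s)) (hadd (f t) (g t))) with
    (hadd (hsub (f s) (f t)) (hsub (g s) (g t))) by vec.
  eapply Rle_lt_trans; [apply hnorm_hadd|]. lra.
Qed.

Lemma hcont_on_const a b (x : H) : hcont_on a b (fun _ => x).
Proof. intros t _ e he. exists 1. split; [lra|]. intros. rewrite hsub_diag, hnorm_hzero. easy. Qed.

Lemma hcont_on_ext a b f g : (forall t, a <= t <= b -> f t = g t) -> hcont_on a b f -> hcont_on a b g.
Proof.
  intros h hf t ht e he. destruct (hf t ht e he) as [d [hd hs]]. exists d. split; [easy|].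
  intros s h1 h2. rewrite <- 2 h by easy. now apply hs.
Qed.

Lemma hcont_on_sub_fun a b f g : hcont_on a b f -> hcont_on a b g ->
  hcont_on a b (fun t => hsub (f t) (g t)).
Proof.
  intros hf hg. apply hcont_on_ext with (fun t => hadd (f t) (csc (-1) (g t))).
  { intros t _. unfold hsub. now rewrite hopp_csc. }
  apply hcont_on_add; [easy|]. exact (brl_cont _ _ (csc_brl (-1)) g a b hg).
Qed.

Lemma hcont_on_csc a b (k : R -> CH) g : hcont_on a b k -> hcont_on a b g ->
  hcont_on a b (fun t => csc (k t) (g t)).
Proof.
  intros hk hg t ht e he.
  set (K := Cmod (k t) + 1). set (G := hnorm (g t) + 1).
  assert (0 < K) by (unfold K; pose proof (Cmod_ge_0 (k t)); lra).
  assert (0 < G) by (unfold G; pose proof (hnorm_ge0 (g t)); lra).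
  destruct (hk t ht (Rmin 1 (e / 2 / G))) as [d1 [h1 h1']].
  { apply Rmin_glb_lt; [lra|]. apply Rdiv_lt_0_compat; lra. }
  destruct (hg t ht (e / 2 / K)) as [d2 [h2 h2']]; [apply Rdiv_lt_0_compat; lra|].
  exists (Rmin d1 d2). split; [now apply Rmin_glb_lt|]. intros s hs1 hs2.
  specialize (h1' s hs1 (Rlt_le_trans _ _ _ hs2 (Rmin_l _ _))).
  specialize (h2' s hs1 (Rlt_le_trans _ _ _ hs2 (Rmin_r _ _))).
  change (hsub (k s) (k t)) with (k s - k t)%C in h1'. rewrite hnorm_CH in h1'.
  assert (q1 := Rlt_le_trans _ _ _ h1' (Rmin_l _ _)). assert (q2 := Rlt_le_trans _ _ _ h1' (Rmin_r _ _)).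
  replace (hsub (csc (k s) (g s)) (csc (k t) (g t))) with
    (hadd (csc (k s) (hsub (g s) (g t))) (csc (k s - k t)%C (g t))) by vec.
  eapply Rle_lt_trans; [apply hnorm_hadd|]. rewrite 2 hnorm_csc.
  assert (Cmod (k s) <= K).
  { unfold K. pose proof (hnorm_le_hsub (k s) (k t)) as q. rewrite !hnorm_CH in q.
    change (hsub (k s) (k t)) with (k s - k t)%C in q. lra. }
  assert (a1 : Cmod (k s) * hnorm (hsub (g s) (g t)) <= K * hnorm (hsub (g s) (g t))).
  { apply Rmult_le_compat_r; [apply hnorm_ge0|easy]. }
  assert (a2 : K * hnorm (hsub (g s) (g t)) < e / 2).
  { apply (Rmult_lt_compat_l K) in h2'; [|easy].
    now replace (K * (e / 2 / K)) with (e / 2) in h2' by (field; lra). }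
  assert (a3 : Cmod (k s - k t) * hnorm (g t) <= e / 2 / G * G).
  { apply Rmult_le_compat; [apply Cmod_ge_0|apply hnorm_ge0|lra|unfold G; lra]. }
  replace (e / 2 / G * G) with (e / 2) in a3 by (field; lra). lra.
Qed.

Lemma hint_add f g a b : a <= b -> hcont_on a b f -> hcont_on a b g ->
  hint (fun t => hadd (f t) (g t)) a b = hadd (hint f a b) (hint g a b).
Proof.
  intros hab hf hg. apply (RInt_plus (V := hilbert_CompleteNormedModule H)); now apply ex_hint.
Qed.

Lemma hint_csc (c : C) g a b : a <= b -> hcont_on a b g ->
  hint (fun t => csc c (g t)) a b = csc c (hint g a b).
Proof. intros. apply (hint_linear _ _ (csc_brl c)); easy. Qed.

Lemma hint_sub f g a b : a <= b -> hcont_on a b f -> hcont_on a b g ->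
  hint (fun t => hsub (f t) (g t)) a b = hsub (hint f a b) (hint g a b).
Proof.
  intros hab hf hg.
  rewrite (hint_ext _ (fun t => hadd (f t) (csc (-1) (g t)))) by
    (first [exact hab | intros t _; unfold hsub; now rewrite hopp_csc]).
  rewrite hint_add; [|easy|easy|exact (brl_cont _ _ (csc_brl (-1)) g a b hg)].
  rewrite hint_csc by easy. unfold hsub. now rewrite hopp_csc.
Qed.

End IntegralAlgebra.

(** * Improper integrals and the Poisson kernel *)

(** Cut [[a, b]] into [N] equal pieces: the quadratic errors add up to [K (b - a)^2 / N], which
    tends to 0. This takes the place of a mean value theorem, both for the growth of [|xi|] and for
    [quadR_FTC]. *)
Lemma chain_le (D : R -> R -> R) (a b M K : R) : a <= b ->
  (forall r s t, a <= r -> r <= s -> s <= t -> t <= b -> D r t <= D r s + D s t) ->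
  (forall s t, a <= s -> s <= t -> t <= b -> D s t <= M * (t - s) + K * ((t - s) * (t - s))) ->
  D a b <= M * (b - a).
Proof.
  intros hab htri hq. apply le_epsilon. intros e he.
  set (L := b - a). set (Q := Rabs K * (L * L)).
  assert (hQ : 0 <= Q) by (apply Rmult_le_pos; [apply Rabs_pos|unfold L; nra]).
  destruct (archimed_cor1 (e / (Q + 1))) as [N [hN1 hN2]]; [apply Rdiv_lt_0_compat; lra|].
  assert (hN : 0 < INR N) by now apply lt_0_INR.
  set (h := L / INR N).
  assert (hL : L = INR N * h) by (unfold h; field; lra).
  assert (hh : 0 <= h) by (apply Rdiv_le_0_compat; unfold L; lra).
  assert (st : forall n, (n <= N)%nat -> a + INR n * h <= b).
  { intros n hn. apply le_INR in hn. assert (INR n * h <= INR N * h) by nra. unfold L in hL. lra. }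
  assert (ind : forall n, (n <= N)%nat -> (1 <= n)%nat ->
     D a (a + INR n * h) <= INR n * (M * h + Rabs K * (h * h))).
  { assert (step : forall s, a <= s -> s + h <= b -> D s (s + h) <= M * h + Rabs K * (h * h)).
    { intros s h1 h2. specialize (hq s (s + h) h1 ltac:(lra) h2).
      replace (s + h - s) with h in hq by ring.
      pose proof (Rle_abs K). nra. }
    induction n as [|n IH]; intros h1 h2; [lia|].
    destruct n as [|n].
    - simpl INR. rewrite !Rmult_1_l. apply step; [lra|]. specialize (st 1%nat h1). simpl in st. lra.
    - specialize (IH ltac:(lia) ltac:(lia)).
      pose proof (st (S (S n)) h1) as s1. pose proof (pos_INR (S n)).
      rewrite S_INR in s1 |- *.
      replace (a + (INR (S n) + 1) * h) with (a + INR (S n) * h + h) in s1 |- * by ring.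
      assert (0 <= INR (S n) * h) by nra.
      specialize (htri a (a + INR (S n) * h) (a + INR (S n) * h + h) ltac:(lra) ltac:(lra) ltac:(lra) ltac:(lra)).
      specialize (step (a + INR (S n) * h) ltac:(lra) ltac:(lra)). lra. }
  specialize (ind N (le_n N) hN2).
  replace (a + INR N * h) with b in ind by (unfold L in hL; lra).
  replace (INR N * (M * h + Rabs K * (h * h))) with (M * L + Q * / INR N) in ind.
  2:{ unfold Q. rewrite hL. field. lra. }
  apply Rle_trans with (1 := ind). fold L.
  assert (Q * / INR N <= e); [|lra].
  apply Rle_trans with (Q * (e / (Q + 1))); [apply Rmult_le_compat_l; lra|].
  apply (Rmult_le_reg_r (Q + 1)); [lra|]. unfold Rdiv.
  replace (Q * (e * / (Q + 1)) * (Q + 1)) with (Q * e) by (field; lra). nra.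
Qed.

Definition hcont {H : Hilbert} (g : R -> H) : Prop := forall a b, hcont_on a b g.

Definition is_int {H : Hilbert} (g : R -> H) (v : H) : Prop :=
  forall e, 0 < e -> exists A, 0 < A /\ forall a b, a <= - A -> A <= b ->
    hnorm (hsub (hint g a b) v) < e.

(** An integrable majorant; by [is_int_norm_le], [B] then bounds the norm of the improper
    integral. *)
Record dom (h : R -> R) (B : R) : Prop := {
  dom_cont : forall t, continuous h t;
  dom_pos : forall t, 0 <= h t;
  dom_bound : forall a b, a <= b -> RInt h a b <= B }.

Lemma dom_ex h B a b : dom h B -> ex_RInt h a b.
Proof. intros hd. apply (ex_RInt_continuous (V:=R_CompleteNormedModule)). intros; apply (dom_cont _ _ hd). Qed.

Lemma dom_mono h B a b c d : dom h B -> a <= c -> c <= d -> d <= b ->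
  RInt h a b = RInt h a c + RInt h c d + RInt h d b /\ RInt h c d <= RInt h a b.
Proof.
  intros hd h1 h2 h3.
  assert (e : RInt h a b = RInt h a c + RInt h c d + RInt h d b).
  { rewrite <- (RInt_Chasles (V:=R_CompleteNormedModule) h a d b) by now apply dom_ex with B.
    rewrite <- (RInt_Chasles (V:=R_CompleteNormedModule) h a c d) by now apply dom_ex with B.
    reflexivity. }
  split; [easy|]. rewrite e.
  assert (0 <= RInt h a c) by (apply RInt_ge_0; [easy|now apply dom_ex with B|intros; apply (dom_pos _ _ hd)]).
  assert (0 <= RInt h d b) by (apply RInt_ge_0; [easy|now apply dom_ex with B|intros; apply (dom_pos _ _ hd)]).
  lra.
Qed.

Lemma dom_tail h B e : dom h B -> 0 < e -> exists A, 0 < A /\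
  forall a b, a <= - A -> A <= b -> RInt h a b - RInt h (- A) A < e.
Proof.
  intros hd he.
  (* The supremum of the integrals is nearly attained on some [[a0, b0]]. By positivity any larger
     interval does as well, so the tails are small. *)
  destruct (completeness (fun r => exists a b, a <= b /\ r = RInt h a b)) as [s [s1 s2]].
  { exists B. intros r [a [b [hab ->]]]. now apply (dom_bound _ _ hd). }
  { exists (RInt h 0 0), 0, 0. split; lra. }
  destruct (classic (exists a b, a <= b /\ s - e < RInt h a b)) as [[a0 [b0 [hab h0]]]|n].
  - set (A := Rabs a0 + Rabs b0 + 1).
    pose proof (Rabs_pos a0). pose proof (Rabs_pos b0).
    assert (- A <= a0) by (unfold A; pose proof (Rle_abs (- a0)); rewrite Rabs_Ropp in *; lra).
    assert (b0 <= A) by (unfold A; pose proof (Rle_abs b0); lra).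
    exists A. split; [unfold A; lra|]. intros a b h1 h2.
    destruct (dom_mono h B (- A) A a0 b0 hd) as [_ q]; try lra.
    specialize (s1 (RInt h a b)). simpl in s1. assert (RInt h a b <= s); [apply s1|lra].
    exists a, b. split; [unfold A in *; lra|easy].
  - exfalso. assert (s <= s - e); [|lra]. apply s2. intros r [a [b [hab ->]]].
    apply Rnot_lt_le. intros q. apply n. eauto.
Qed.

Lemma dom_add h1 B1 h2 B2 : dom h1 B1 -> dom h2 B2 -> dom (fun t => h1 t + h2 t) (B1 + B2).
Proof.
  intros d1 d2. split.
  - intros t. apply (continuous_plus (V:=R_NormedModule)); [apply (dom_cont _ _ d1)|apply (dom_cont _ _ d2)].
  - intros t. pose proof (dom_pos _ _ d1 t). pose proof (dom_pos _ _ d2 t). lra.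
  - intros a b hab. rewrite (RInt_plus (V:=R_CompleteNormedModule) h1 h2) by (eapply dom_ex; eauto).
    pose proof (dom_bound _ _ d1 a b hab). pose proof (dom_bound _ _ d2 a b hab).
    unfold plus; simpl. lra.
Qed.

Lemma dom_scal h B c : 0 <= c -> dom h B -> dom (fun t => c * h t) (c * B).
Proof.
  intros hc d. split.
  - intros t. apply (continuous_scal_r (K:=R_AbsRing) (V:=R_NormedModule) c h). apply (dom_cont _ _ d).
  - intros t. pose proof (dom_pos _ _ d t). nra.
  - intros a b hab. rewrite (RInt_scal (V:=R_CompleteNormedModule) h) by (eapply dom_ex; eauto).
    pose proof (dom_bound _ _ d a b hab). unfold scal; simpl. unfold mult; simpl. nra.
Qed.

Section ImproperIntegral.
Context {H : Hilbert}.
Implicit Types g : R -> H.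

Lemma hint_diff_le g h B a b c d : hcont g -> dom h B -> (forall t, hnorm (g t) <= h t) ->
  a <= c -> c <= d -> d <= b ->
  hnorm (hsub (hint g a b) (hint g c d)) <= RInt h a b - RInt h c d.
Proof.
  intros hg hd hle h1 h2 h3.
  rewrite <- (hint_Chasles g a d b), <- (hint_Chasles g a c d) by (lra || apply hg).
  replace (hsub (hadd (hadd (hint g a c) (hint g c d)) (hint g d b)) (hint g c d)) with
    (hadd (hint g a c) (hint g d b)) by vec.
  destruct (dom_mono h B a b c d hd h1 h2 h3) as [-> _].
  eapply Rle_trans; [apply hnorm_hadd|].
  assert (hnorm (hint g a c) <= RInt h a c) by (apply hint_norm_le; auto; now apply dom_ex with B).
  assert (hnorm (hint g d b) <= RInt h d b) by (apply hint_norm_le; auto; now apply dom_ex with B).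
  lra.
Qed.

Lemma is_int_exists g h B : hcont g -> dom h B -> (forall t, hnorm (g t) <= h t) ->
  exists v, is_int g v.
Proof.
  intros hg hd hle.
  assert (tail : forall e, 0 < e -> exists A, 0 < A /\ forall a b, a <= - A -> A <= b ->
     hnorm (hsub (hint g a b) (hint g (- A) A)) < e).
  { intros e he. destruct (dom_tail h B e hd he) as [A [hA ht]]. exists A. split; [easy|].
    intros a b h1 h2. apply Rle_lt_trans with (2 := ht a b h1 h2).
    apply hint_diff_le with B; auto; lra. }
  assert (up : forall A, exists N : nat, forall n, (n >= N)%nat -> A <= INR n).
  { intros A. destruct (INR_unbounded A) as [N hN]. exists N. intros n hn. apply le_INR in hn. lra. }
  destruct (hcomplete H (fun n => hint g (- INR n) (INR n))) as [l hl].
  { intros e he. destruct (tail (e / 2)) as [A [hA ht]]; [lra|].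
    destruct (up A) as [N hN]. exists N. intros m n hm hn.
    specialize (hN m hm) as q1. specialize (hN n hn) as q2.
    change (hnorm (hsub (hint g (- INR m) (INR m)) (hint g (- INR n) (INR n))) < e).
    eapply Rle_lt_trans; [apply (hnorm_hsub_triangle _ (hint g (- A) A))|].
    rewrite (hnorm_hsub_comm (hint g (- A) A)).
    pose proof (ht (- INR m) (INR m) ltac:(lra) ltac:(lra)).
    pose proof (ht (- INR n) (INR n) ltac:(lra) ltac:(lra)). lra. }
  exists l. intros e he. destruct (tail (e / 3)) as [A [hA ht]]; [lra|].
  exists A. split; [easy|]. intros a b h1 h2.
  destruct (hl (e / 3)) as [N1 hN1]; [lra|]. destruct (up A) as [N2 hN2].
  specialize (hN1 (N1 + N2)%nat ltac:(lia)). specialize (hN2 (N1 + N2)%nat ltac:(lia)).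
  change (hnorm (hsub (hint g (- INR (N1 + N2)) (INR (N1 + N2))) l) < e / 3) in hN1.
  pose proof (ht _ _ h1 h2). pose proof (ht (- INR (N1 + N2)) (INR (N1 + N2)) ltac:(lra) ltac:(lra)) as q.
  rewrite hnorm_hsub_comm in q.
  eapply Rle_lt_trans; [apply (hnorm_hsub_triangle _ (hint g (- A) A))|].
  pose proof (hnorm_hsub_triangle (hint g (- A) A) (hint g (- INR (N1 + N2)) (INR (N1 + N2))) l). lra.
Qed.

Lemma is_int_unique g v w : is_int g v -> is_int g w -> v = w.
Proof.
  intros h1 h2. apply small_eq. intros e he.
  destruct (h1 (e / 2)) as [A [hA ha]]; [lra|]. destruct (h2 (e / 2)) as [B [hB hb]]; [lra|].
  specialize (ha (- (A + B)) (A + B) ltac:(lra) ltac:(lra)).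
  specialize (hb (- (A + B)) (A + B) ltac:(lra) ltac:(lra)).
  rewrite hnorm_hsub_comm in ha.
  pose proof (hnorm_hsub_triangle v (hint g (- (A + B)) (A + B)) w). lra.
Qed.

Lemma is_int_ext f g v : (forall t, f t = g t) -> is_int f v -> is_int g v.
Proof. intros h. replace g with f; [easy|]. now apply functional_extensionality. Qed.

Lemma is_int_add f g v w : hcont f -> hcont g -> is_int f v -> is_int g w ->
  is_int (fun t => hadd (f t) (g t)) (hadd v w).
Proof.
  intros hf hg h1 h2 e he.
  destruct (h1 (e / 2)) as [A [hA ha]]; [lra|]. destruct (h2 (e / 2)) as [B [hB hb]]; [lra|].
  exists (A + B). split; [lra|]. intros a b q1 q2.
  rewrite hint_add by (lra || apply hf || apply hg).
  specialize (ha a b ltac:(lra) ltac:(lra)). specialize (hb a b ltac:(lra) ltac:(lra)).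
  replace (hsub (hadd (hint f a b) (hint g a b)) (hadd v w)) with
    (hadd (hsub (hint f a b) v) (hsub (hint g a b) w)) by vec.
  eapply Rle_lt_trans; [apply hnorm_hadd|]. lra.
Qed.

Lemma is_int_norm_le g v h B : hcont g -> dom h B -> (forall t, hnorm (g t) <= h t) ->
  is_int g v -> hnorm v <= B.
Proof.
  intros hg hd hle hv. apply le_epsilon. intros e he.
  destruct (hv e he) as [A [hA ha]]. specialize (ha (- A) A ltac:(lra) ltac:(lra)).
  assert (hnorm (hint g (- A) A) <= RInt h (- A) A).
  { apply hint_norm_le; [lra|apply hg|now apply dom_ex with B|auto]. }
  pose proof (dom_bound _ _ hd (- A) A ltac:(lra)).
  rewrite hnorm_hsub_comm in ha. pose proof (hnorm_le_hsub v (hint g (- A) A)). lra.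
Qed.

Lemma is_int_shift g v c : hcont g -> is_int g v -> is_int (fun t => g (t + c)) v.
Proof.
  intros hg hv e he. destruct (hv e he) as [A [hA ha]].
  exists (A + Rabs c). pose proof (Rabs_pos c). split; [lra|]. intros a b h1 h2.
  rewrite hint_shift by (lra || apply hg). pose proof (Rle_abs c). pose proof (Rle_abs (- c)).
  rewrite Rabs_Ropp in *. apply ha; lra.
Qed.

End ImproperIntegral.

Lemma is_int_linear {H H' : Hilbert} (L : H -> H') K g v : bounded_real_linear L K -> hcont g ->
  is_int g v -> is_int (fun t => L (g t)) (L v).
Proof.
  intros hL hg hv e he. pose proof (Rabs_pos K). pose proof (Rle_abs K).
  destruct (hv (e / (Rabs K + 1))) as [A [hA ha]]; [apply Rdiv_lt_0_compat; lra|].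
  exists A. split; [easy|]. intros a b h1 h2. specialize (ha a b h1 h2).
  rewrite (hint_linear L K hL) by (lra || apply hg).
  apply Rle_lt_trans with (1 := brl_lip _ _ hL _ _).
  pose proof (hnorm_ge0 (hsub (hint g a b) v)).
  apply (lt_absorb _ (Rabs K)); lra.
Qed.

Lemma hcont_csc {H : Hilbert} (k : R -> CH) (g : R -> H) :
  hcont k -> hcont g -> hcont (fun t => csc (k t) (g t)).
Proof. intros hk hg a b. now apply hcont_on_csc. Qed.

Lemma hcont_lip {H : Hilbert} (g : R -> H) K :
  (forall s t, hnorm (hsub (g s) (g t)) <= K * Rabs (s - t)) -> hcont g.
Proof.
  intros h a b t _ e he. pose proof (Rabs_pos K). pose proof (Rle_abs K).
  exists (e / (Rabs K + 1)). split; [apply Rdiv_lt_0_compat; lra|]. intros s _ hs.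
  pose proof (Rabs_pos (s - t)).
  apply Rle_lt_trans with (1 := h s t). apply (lt_absorb _ (Rabs K)); lra.
Qed.

(** [y / PI] times this is the Poisson kernel of the upper half-plane at [x + i y]. *)
Definition cauchy2 (x y t : R) : R := / ((t - x) * (t - x) + y * y).

Lemma cauchy2_denom_pos x y t : 0 < y -> 0 < (t - x) * (t - x) + y * y.
Proof. intros hy. pose proof (Rle_0_sqr (t - x)). unfold Rsqr in *. pose proof (Rmult_lt_0_compat y y hy hy). lra. Qed.

Lemma cauchy2_cont x y t : 0 < y -> continuous (cauchy2 x y) t.
Proof.
  intros hy. apply (ex_derive_continuous (V:=R_NormedModule)). unfold cauchy2. auto_derive.
  pose proof (cauchy2_denom_pos x y t hy). unfold Rminus in *. lra.
Qed.

Lemma cauchy2_RInt x y a b : 0 < y ->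
  RInt (cauchy2 x y) a b = / y * (atan ((b - x) / y) - atan ((a - x) / y)).
Proof.
  intros hy. apply is_RInt_unique.
  replace (/ y * (atan ((b - x) / y) - atan ((a - x) / y))) with
    (minus (/ y * atan ((b - x) / y)) (/ y * atan ((a - x) / y))) by (unfold minus, plus, opp; simpl; ring).
  apply (is_RInt_derive (fun t => / y * atan ((t - x) / y))); intros t _.
  - unfold cauchy2. auto_derive; [easy|].
    pose proof (cauchy2_denom_pos x y t hy).
    assert (0 <= ((t + - x) * / y) ^ 2) by apply pow2_ge_0.
    field. repeat split; try lra; unfold Rminus in *; nra.
  - now apply cauchy2_cont.
Qed.

Lemma cauchy2_dom x y : 0 < y -> dom (cauchy2 x y) (PI / y).
Proof.
  intros hy. split.
  - intros t. now apply cauchy2_cont.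
  - intros t. unfold cauchy2. left. now apply Rinv_0_lt_compat, cauchy2_denom_pos.
  - intros a b hab. rewrite cauchy2_RInt by easy.
    pose proof (atan_bound ((b - x) / y)). pose proof (atan_bound ((a - x) / y)).
    unfold Rdiv. rewrite (Rmult_comm PI). apply Rmult_le_compat_l; [|lra].
    left. now apply Rinv_0_lt_compat.
Qed.

Lemma atan_near_PI2 e : 0 < e -> exists X, forall t, X <= t -> PI / 2 - e < atan t.
Proof.
  intros he. pose proof PI_RGT_0.
  set (d := Rmin e PI / 2). assert (0 < Rmin e PI) by now apply Rmin_glb_lt.
  pose proof (Rmin_l e PI). pose proof (Rmin_r e PI).
  exists (tan (PI / 2 - d)). intros t ht.
  assert (PI / 2 - d <= atan t); [|unfold d in *; lra].
  rewrite <- (atan_tan (PI / 2 - d)) by (unfold d; lra).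
  destruct ht as [ht| <-]; [left; now apply atan_increasing|lra].
Qed.

Lemma cauchy2_mass x y e : 0 < y -> 0 < e -> exists A, 0 < A /\ forall a b, a <= - A -> A <= b ->
  Rabs (y / PI * RInt (cauchy2 x y) a b - 1) < e.
Proof.
  intros hy he. pose proof PI_RGT_0.
  destruct (atan_near_PI2 (e * PI / 2)) as [X hX]; [nra|].
  exists (Rabs X * y + Rabs x + 1). pose proof (Rabs_pos X). pose proof (Rabs_pos x).
  split; [nra|]. intros a b ha hb.
  rewrite cauchy2_RInt by easy.
  assert (h1 : PI / 2 - e * PI / 2 < atan ((b - x) / y)).
  { apply hX. pose proof (Rle_abs X). pose proof (Rle_abs x).
    apply (Rmult_le_reg_r y); [easy|]. unfold Rdiv. rewrite Rmult_assoc, Rinv_l by lra. nra. }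
  assert (h2 : PI / 2 - e * PI / 2 < atan (- ((a - x) / y))).
  { apply hX. pose proof (Rle_abs X). pose proof (Rle_abs (- x)). rewrite Rabs_Ropp in *.
    apply (Rmult_le_reg_r y); [easy|]. unfold Rdiv.
    replace (- ((a - x) * / y) * y) with (x - a) by (field; lra). nra. }
  rewrite atan_opp in h2.
  pose proof (atan_bound ((b - x) / y)). pose proof (atan_bound ((a - x) / y)).
  replace (y / PI * (/ y * (atan ((b - x) / y) - atan ((a - x) / y))) - 1) with
    ((atan ((b - x) / y) - atan ((a - x) / y) - PI) / PI) by (field; lra).
  rewrite Rabs_left1.
  - apply (Rmult_lt_reg_r PI); [easy|].
    replace (- ((atan ((b - x) / y) - atan ((a - x) / y) - PI) / PI) * PI) with
      (PI - (atan ((b - x) / y) - atan ((a - x) / y))) by (field; lra). lra.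
  - apply (Rmult_le_reg_r PI); [easy|]. unfold Rdiv. rewrite Rmult_assoc, Rinv_l by lra. lra.
Qed.

(** * Analytic extension of a one-parameter group with nonnegative generator *)

(* In [pg_pos], [x'] is the derivative of [t -> u(t) x] at 0, so that [- i x'] is the generator
   applied to [x]. *)
Record positive_group {H : Hilbert} (u : R -> H -> H) : Prop := {
  pg_lin : forall t, linear_op (u t);
  pg_ip : forall t x y, ip (u t x) (u t y) = ip x y;
  pg_0 : forall x, u 0 x = x;
  pg_add : forall s t x, u (s + t) x = u s (u t x);
  pg_cont : forall x, hcont (fun t => u t x);
  pg_pos : forall x x',
    (forall e, 0 < e -> exists d, 0 < d /\ forall t, t <> 0 -> Rabs t < d ->
       hnorm (hsub (csc (RtoC (/ t)) (hsub (u t x) x)) x') < e) ->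
    0 <= Re (ip x (csc (- Ci)%C x')) }.

Lemma linear_op_csc {H : Hilbert} (T : H -> H) a x : linear_op T -> T (csc a x) = csc a (T x).
Proof. intros hT. apply (proj2 hT). Qed.

Lemma linear_op_hadd {H : Hilbert} (T : H -> H) x y : linear_op T -> T (hadd x y) = hadd (T x) (T y).
Proof. intros hT. apply (proj1 hT). Qed.

Lemma linear_op_hsub {H : Hilbert} (T : H -> H) x y : linear_op T -> T (hsub x y) = hsub (T x) (T y).
Proof.
  intros hT. unfold hsub. now rewrite linear_op_hadd, 2 hopp_csc, linear_op_csc by easy.
Qed.

Lemma linear_op_hzero {H : Hilbert} (T : H -> H) : linear_op T -> T hzero = hzero.
Proof. intros hT. rewrite <- (csc_0 hzero) at 1. rewrite linear_op_csc by easy. apply csc_0. Qed.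

Lemma linear_op_brl {H : Hilbert} (T : H -> H) K :
  linear_op T -> (forall x, hnorm (T x) <= K * hnorm x) -> bounded_real_linear T K.
Proof.
  intros hT hK. split; [apply hT| |exact hK]. intros r x. now apply linear_op_csc.
Qed.

Definition rk (z : C) (t : R) : C := (/ (RtoC t - z))%C.

Lemma real_minus_neq0 (z : C) (t : R) : Im z <> 0 -> (RtoC t - z)%C <> 0.
Proof. intros hz e. apply hz. apply (f_equal Im) in e. destruct z; simpl in *. lra. Qed.

Lemma Im_le_Cmod (z : C) : Rabs (Im z) <= Cmod z.
Proof. pose proof (Rmax_Cmod z). pose proof (Rmax_r (Rabs (fst z)) (Rabs (snd z))). unfold Im. lra. Qed.

Lemma rk_bound z t m : 0 < m -> m <= Rabs (Im z) -> Cmod (rk z t) <= / m.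
Proof.
  intros hm hz. unfold rk.
  assert (Im z <> 0) by (intros e; rewrite e, Rabs_R0 in hz; lra).
  rewrite Cmod_inv by now apply real_minus_neq0.
  apply Rinv_le_contravar; [easy|]. apply Rle_trans with (1 := hz).
  replace (Rabs (Im z)) with (Rabs (Im (RtoC t - z)%C)); [apply Im_le_Cmod|].
  rewrite <- Rabs_Ropp. f_equal. destruct z; simpl; ring.
Qed.

Lemma rk_sq z t : Im z <> 0 -> Cmod (rk z t) * Cmod (rk z t) = cauchy2 (Re z) (Rabs (Im z)) t.
Proof.
  intros hz. unfold rk, cauchy2. rewrite Cmod_inv by now apply real_minus_neq0.
  rewrite <- Rinv_mult. f_equal. pose proof (Cmod2_alt (RtoC t - z)) as e.
  replace (Rabs (Im z) * Rabs (Im z)) with (Im z * Im z) by (rewrite <- Rabs_mult, Rabs_right; nra).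
  simpl in e. rewrite Rmult_1_r in e. rewrite e. destruct z; simpl; ring.
Qed.

Lemma rk_shift z t s : rk (z + RtoC s) (t + s) = rk z t.
Proof. unfold rk. f_equal. rewrite RtoC_plus. ring. Qed.

Lemma rk_conj z t : rk (Cconj z) t = Cconj (rk z t).
Proof.
  unfold rk. destruct z as [x y]. unfold Cinv, Cconj; simpl.
  apply injective_projections; simpl; [f_equal; ring|]. unfold Rdiv.
  replace (- (0 + - y)) with (- (0 + - y) * 1) by ring.
  rewrite Ropp_mult_distr_l. f_equal; [ring|]. f_equal; ring.
Qed.

Lemma hcont_rk z : Im z <> 0 -> hcont (H:=CH) (rk z).
Proof.
  intros hz. set (m := Rabs (Im z)). assert (hm : 0 < m) by now apply Rabs_pos_lt.
  apply (hcont_lip (H:=CH)) with (/ m * / m). intros s t. rewrite hnorm_CH.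
  change (hsub (H:=CH) (rk z s) (rk z t)) with (rk z s - rk z t)%C.
  replace (rk z s - rk z t)%C with (RtoC (t - s) * rk z s * rk z t)%C.
  2:{ unfold rk. rewrite RtoC_minus. field. split; now apply real_minus_neq0. }
  rewrite 2 Cmod_mult, Cmod_R, (Rabs_minus_sym t s).
  pose proof (rk_bound z s m hm (Rle_refl _)). pose proof (rk_bound z t m hm (Rle_refl _)).
  pose proof (Cmod_ge_0 (rk z s)). pose proof (Cmod_ge_0 (rk z t)).
  rewrite (Rmult_comm _ (Rabs (s - t))), Rmult_assoc.
  apply Rmult_le_compat_l; [apply Rabs_pos|]. apply Rmult_le_compat; auto.
Qed.

(** Kernels [k] with an integrable majorant of mass at most [B]. As [u] is isometric,
    [int k(t) u(t) x dt] then has norm at most [B |x|]. *)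
Definition adm (k : R -> C) (B : R) : Prop :=
  hcont (H:=CH) k /\ exists h, dom h B /\ forall t, Cmod (k t) <= h t.

Lemma hcont_add {H : Hilbert} (f g : R -> H) :
  hcont f -> hcont g -> hcont (fun t => hadd (f t) (g t)).
Proof. intros hf hg a b. now apply hcont_on_add. Qed.

Lemma hcont_Cmult (k k' : R -> C) : hcont (H:=CH) k -> hcont (H:=CH) k' ->
  hcont (H:=CH) (fun t => k t * k' t)%C.
Proof.
  intros h1 h2 a b. apply (hcont_on_ext (H:=CH)) with (fun t => csc (H:=CH) (k t) (k' t)).
  { intros t _. apply csc_CH. }
  now apply hcont_on_csc.
Qed.

Lemma adm_add k1 B1 k2 B2 : adm k1 B1 -> adm k2 B2 -> adm (fun t => k1 t + k2 t)%C (B1 + B2).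
Proof.
  intros [c1 [h1 [d1 q1]]] [c2 [h2 [d2 q2]]]. split.
  - now apply (hcont_add (H:=CH)).
  - exists (fun t => h1 t + h2 t). split; [now apply dom_add|]. intros t.
    eapply Rle_trans; [apply Cmod_triangle|]. specialize (q1 t). specialize (q2 t). lra.
Qed.

Lemma adm_scal c k B : adm k B -> adm (fun t => c * k t)%C (Cmod c * B).
Proof.
  intros [c1 [h1 [d1 q1]]]. split.
  - apply (hcont_Cmult (fun _ => c) k); [|easy]. intros a b. apply (hcont_on_const (H:=CH)).
  - exists (fun t => Cmod c * h1 t). split; [apply dom_scal; [apply Cmod_ge_0|easy]|].
    intros t. rewrite Cmod_mult. apply Rmult_le_compat_l; [apply Cmod_ge_0|easy].
Qed.

(* By [2 |a b| <= |a|^2 + |b|^2], as [cauchy2] is the squared modulus of the Cauchy kernel [rk]. *)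
Lemma adm_rk2 z z' m : 0 < m -> m <= Rabs (Im z) -> m <= Rabs (Im z') ->
  adm (fun t => rk z t * rk z' t)%C (PI / m).
Proof.
  intros hm h1 h2.
  assert (n1 : Im z <> 0) by (intros e; rewrite e, Rabs_R0 in *; lra).
  assert (n2 : Im z' <> 0) by (intros e; rewrite e, Rabs_R0 in *; lra).
  split; [now apply hcont_Cmult; apply hcont_rk|].
  exists (fun t => / 2 * (cauchy2 (Re z) (Rabs (Im z)) t + cauchy2 (Re z') (Rabs (Im z')) t)).
  split.
  - assert (d : dom (fun t => / 2 * (cauchy2 (Re z) (Rabs (Im z)) t + cauchy2 (Re z') (Rabs (Im z')) t))
      (/ 2 * (PI / Rabs (Im z) + PI / Rabs (Im z')))).
    { apply dom_scal; [lra|]. apply dom_add; apply cauchy2_dom; lra. }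
    destruct d as [d1 d2 d3]. split; [easy|easy|]. intros a b hab.
    apply Rle_trans with (1 := d3 a b hab). pose proof PI_RGT_0.
    assert (/ Rabs (Im z) <= / m) by (now apply Rinv_le_contravar).
    assert (/ Rabs (Im z') <= / m) by (now apply Rinv_le_contravar). unfold Rdiv. nra.
  - intros t. rewrite <- 2 rk_sq by easy. rewrite Cmod_mult.
    pose proof (Rle_0_sqr (Cmod (rk z t) - Cmod (rk z' t))). unfold Rsqr in *. lra.
Qed.

Lemma adm_rk z k B m : 0 < m -> m <= Rabs (Im z) -> adm k B -> adm (fun t => rk z t * k t)%C (/ m * B).
Proof.
  intros hm h1 [c [h [d q]]].
  assert (n1 : Im z <> 0) by (intros e; rewrite e, Rabs_R0 in *; lra).
  split; [apply hcont_Cmult; [now apply hcont_rk|easy]|].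
  exists (fun t => / m * h t). split.
  - apply dom_scal; [|easy]. left. now apply Rinv_0_lt_compat.
  - intros t. rewrite Cmod_mult. apply Rmult_le_compat; try apply Cmod_ge_0; [|easy]. now apply rk_bound.
Qed.

Section Group.
Context {H : Hilbert} (u : R -> H -> H) (Hu : positive_group u).
Implicit Types x : H.

Lemma pg_norm t x : hnorm (u t x) = hnorm x.
Proof.
  apply Rsqr_inj; try apply hnorm_ge0. unfold Rsqr. rewrite 2 hnorm_sq. f_equal. apply (pg_ip _ Hu).
Qed.

Lemma pg_brl t : bounded_real_linear (u t) 1.
Proof. apply linear_op_brl; [apply (pg_lin _ Hu)|]. intros x. rewrite pg_norm. lra. Qed.

(* [int k(t) u(t) x dt] over the real line; junk unless [k] is admissible. *)
Definition Kint (k : R -> C) (x : H) : H :=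
  epsilon (inhabits hzero) (is_int (fun t => csc (k t) (u t x))).

Lemma adm_hcont k B x : adm k B -> hcont (fun t => csc (k t) (u t x)).
Proof. intros [c _]. apply hcont_csc; [exact c|apply (pg_cont _ Hu)]. Qed.

Lemma adm_dom k B : adm k B -> exists h, dom h B /\ forall x t, hnorm (csc (k t) (u t x)) <= hnorm x * h t.
Proof.
  intros [_ [h [d q]]]. exists h. split; [easy|]. intros x t. rewrite hnorm_csc, pg_norm, Rmult_comm.
  apply Rmult_le_compat_l; [apply hnorm_ge0|easy].
Qed.

Lemma Kint_spec k B x : adm k B -> is_int (fun t => csc (k t) (u t x)) (Kint k x).
Proof.
  intros ha. apply (epsilon_spec (inhabits hzero) (is_int (fun t => csc (k t) (u t x)))). destruct (adm_dom k B ha) as [h [d q]].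
  apply is_int_exists with (fun t => hnorm x * h t) (hnorm x * B).
  - now apply adm_hcont with B.
  - apply dom_scal; [apply hnorm_ge0|easy].
  - apply q.
Qed.

Lemma Kint_norm k B x : adm k B -> hnorm (Kint k x) <= B * hnorm x.
Proof.
  intros ha. destruct (adm_dom k B ha) as [h [d q]]. rewrite Rmult_comm.
  apply is_int_norm_le with (fun t => csc (k t) (u t x)) (fun t => hnorm x * h t).
  - now apply adm_hcont with B.
  - apply dom_scal; [apply hnorm_ge0|easy].
  - apply q.
  - now apply Kint_spec with B.
Qed.

Lemma Kint_ext k k' x : (forall t, k t = k' t) -> Kint k x = Kint k' x.
Proof. intros h. replace k' with k; [easy|]. now apply functional_extensionality. Qed.

Lemma Kint_add k1 B1 k2 B2 x : adm k1 B1 -> adm k2 B2 ->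
  Kint (fun t => k1 t + k2 t)%C x = hadd (Kint k1 x) (Kint k2 x).
Proof.
  intros a1 a2. eapply is_int_unique; [apply Kint_spec with (B1 + B2); now apply adm_add|].
  eapply is_int_ext; [|exact (is_int_add _ _ _ _ (adm_hcont k1 B1 x a1) (adm_hcont k2 B2 x a2)
    (Kint_spec k1 B1 x a1) (Kint_spec k2 B2 x a2))].
  intros t. simpl. now rewrite csc_plus_l.
Qed.

Lemma Kint_scal c k B x : adm k B -> Kint (fun t => c * k t)%C x = csc c (Kint k x).
Proof.
  intros a. eapply is_int_unique; [eapply Kint_spec, adm_scal, a|].
  eapply is_int_ext; [|exact (is_int_linear _ _ _ _ (csc_brl c) (adm_hcont k B x a) (Kint_spec k B x a))].
  intros t. simpl. now rewrite csc_csc.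
Qed.

Lemma Kint_hadd k B x y : adm k B -> Kint k (hadd x y) = hadd (Kint k x) (Kint k y).
Proof.
  intros a. eapply is_int_unique; [eapply Kint_spec, a|].
  eapply is_int_ext; [|exact (is_int_add _ _ _ _ (adm_hcont k B x a) (adm_hcont k B y a)
    (Kint_spec k B x a) (Kint_spec k B y a))].
  intros t. simpl. now rewrite (linear_op_hadd _ _ _ (pg_lin _ Hu t)), csc_hadd.
Qed.

Lemma Kint_csc k B c x : adm k B -> Kint k (csc c x) = csc c (Kint k x).
Proof.
  intros a. eapply is_int_unique; [eapply Kint_spec, a|].
  eapply is_int_ext; [|exact (is_int_linear _ _ _ _ (csc_brl c) (adm_hcont k B x a) (Kint_spec k B x a))].
  intros t. simpl. rewrite (linear_op_csc _ _ _ (pg_lin _ Hu t)), 2 csc_csc. f_equal. ring.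
Qed.

Lemma Kint_shift k k' B B' s x : adm k B -> adm k' B' -> (forall t, k' (t + s) = k t) ->
  u s (Kint k x) = Kint k' x.
Proof.
  intros a a' hk. eapply is_int_unique.
  - exact (is_int_linear _ _ _ _ (pg_brl s) (adm_hcont k B x a) (Kint_spec k B x a)).
  - eapply is_int_ext; [|exact (is_int_shift _ _ s (adm_hcont k' B' x a') (Kint_spec k' B' x a'))].
    intros t. simpl. rewrite hk, (linear_op_csc _ _ _ (pg_lin _ Hu s)), <- (pg_add _ Hu).
    f_equal. f_equal. ring.
Qed.

(** Reduces the Taylor remainder of a vector integral in its parameter to an algebraic identity
    between kernels, after which [Kint_norm] gives the estimate. *)
Lemma Kint_comb k1 B1 k2 B2 k3 B3 k B c x : adm k1 B1 -> adm k2 B2 -> adm k3 B3 -> adm k B ->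
  (forall t, k1 t - k2 t - c * k3 t = k t)%C ->
  hsub (hsub (Kint k1 x) (Kint k2 x)) (csc c (Kint k3 x)) = Kint k x.
Proof.
  intros a1 a2 a3 a hk.
  rewrite (Kint_ext k (fun t => k1 t + ((-1) * k2 t + (- c) * k3 t))%C) by
    (intros t; rewrite <- hk; apply injective_projections; simpl; ring).
  rewrite (Kint_add k1 B1 _ (Cmod (-1) * B2 + Cmod (- c) * B3)) by
    (try (apply adm_add; apply adm_scal); easy).
  rewrite (Kint_add _ (Cmod (-1) * B2) _ (Cmod (- c) * B3)) by (apply adm_scal; easy).
  rewrite (Kint_scal _ _ B2), (Kint_scal _ _ B3) by easy. vec.
Qed.

End Group.

Section Hardy.
Context {H : Hilbert} (u : R -> H -> H) (Hu : positive_group u).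
Implicit Types x : H.

(** The Cauchy kernel [1/(t - z)] is not integrable over the line; its [z]-derivative is. [dxi] is
    in turn the [z]-derivative of [xi]. *)
Definition xi (z : C) (x : H) : H := Kint u (fun t => rk z t * rk z t)%C x.
Definition dxi (z : C) (x : H) : H := Kint u (fun t => 2 * (rk z t * (rk z t * rk z t)))%C x.

Lemma Rabs_lower_neq0 (m r : R) : 0 < m -> m <= Rabs r -> r <> 0.
Proof. intros h1 h2 ->. rewrite Rabs_R0 in h2. lra. Qed.

(** With [a = rk z t], [b = rk z' t] and [h = z' - z] one has [b - a = h a b], so the remainder
    kernel is [h^2 (a^2 b^2 + 2 a^3 b)]: three quartic terms, each of mass at most [PI / m^3]. *)
Lemma xi_quad z z' m x : 0 < m -> m <= Rabs (Im z) -> m <= Rabs (Im z') ->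
  hnorm (hsub (hsub (xi z' x) (xi z x)) (csc (z' - z)%C (dxi z x))) <=
    3 * PI / (m * m * m) * hnorm x * (Cmod (z' - z) * Cmod (z' - z)).
Proof.
  intros hm h1 h2.
  assert (a3 : adm (fun t => 2 * (rk z t * (rk z t * rk z t)))%C (Cmod 2 * (/ m * (PI / m)))).
  { apply adm_scal, adm_rk; [easy|easy|]. now apply adm_rk2. }
  set (h := (z' - z)%C).
  set (k := fun t => ((h * h) * (rk z t * (rk z' t * (rk z t * rk z' t))
                          + 2 * (rk z t * (rk z t * (rk z t * rk z' t)))))%C).
  assert (a : adm k (Cmod (h * h) * (/ m * (/ m * (PI / m)) + Cmod 2 * (/ m * (/ m * (PI / m)))))).
  { apply adm_scal, adm_add; [|apply adm_scal];
      (apply adm_rk; [easy|easy|]; apply adm_rk; [easy|easy|]; now apply adm_rk2). }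
  unfold xi, dxi.
  rewrite (Kint_comb u Hu _ (PI / m) _ (PI / m) _ (Cmod 2 * (/ m * (PI / m))) k
    (Cmod (h * h) * (/ m * (/ m * (PI / m)) + Cmod 2 * (/ m * (/ m * (PI / m)))))).
  - eapply Rle_trans; [apply (Kint_norm u Hu _ _ _ a)|]. rewrite Cmod_mult, Cmod_R, Rabs_right by lra.
    right. field. lra.
  - now apply adm_rk2.
  - now apply adm_rk2.
  - exact a3.
  - exact a.
  - intros t. unfold k, h, rk.
    apply Rabs_lower_neq0 in h1, h2; try easy.
    field. split; now apply real_minus_neq0.
Qed.

Lemma xi_shift z s x : Im z <> 0 -> u s (xi z x) = xi (z + RtoC s)%C x.
Proof.
  intros hz. assert (hm : 0 < Rabs (Im z)) by now apply Rabs_pos_lt.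
  assert (e : Im (z + RtoC s)%C = Im z) by (destruct z; simpl; ring).
  apply (Kint_shift u Hu _ _ (PI / Rabs (Im z)) (PI / Rabs (Im z))).
  - apply adm_rk2; lra.
  - apply adm_rk2; rewrite ?e; lra.
  - intros t. now rewrite rk_shift.
Qed.

(** [u(t)] moves [xi z x] to [xi (z + t) x], so this vector lies in the domain of the generator and
    [dxi z x] is its derivative along the group. *)
Lemma xi_pos z x : Im z <> 0 -> 0 <= Re (ip (xi z x) (csc (- Ci)%C (dxi z x))).
Proof.
  intros hz. apply (pg_pos u Hu). intros e he.
  set (m := Rabs (Im z)). assert (hm : 0 < m) by now apply Rabs_pos_lt.
  set (K := 3 * PI / (m * m * m) * hnorm x).
  assert (hK : 0 <= K).
  { apply Rmult_le_pos; [|apply hnorm_ge0]. pose proof PI_RGT_0.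
    apply Rdiv_le_0_compat; [lra|]. repeat apply Rmult_lt_0_compat; easy. }
  exists (e / (K + 1)). split; [apply Rdiv_lt_0_compat; lra|]. intros t ht1 ht2.
  rewrite xi_shift by easy.
  pose proof (xi_quad z (z + RtoC t) m x hm (Rle_refl _)) as q.
  replace (z + RtoC t - z)%C with (RtoC t) in q by ring.
  specialize (q ltac:(destruct z; simpl; rewrite Rplus_0_r; apply Rle_refl)). fold K in q.
  assert (ht : (RtoC t)%C <> 0) by (intros e1; apply RtoC_inj in e1; easy).
  replace (hsub (csc (RtoC (/ t)) (hsub (xi (z + RtoC t)%C x) (xi z x))) (dxi z x)) with
    (csc (RtoC (/ t)) (hsub (hsub (xi (z + RtoC t)%C x) (xi z x)) (csc (RtoC t) (dxi z x)))).
  2:{ vec. rewrite RtoC_inv by easy. field. easy. }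
  rewrite hnorm_csc, Cmod_R in *. rewrite Rabs_inv by easy.
  assert (0 < Rabs t) by now apply Rabs_pos_lt.
  apply Rle_lt_trans with (K * Rabs t).
  - apply (Rmult_le_reg_l (Rabs t)); [easy|].
    rewrite <- Rmult_assoc, Rinv_r, Rmult_1_l by lra. lra.
  - apply (lt_absorb _ (K)); lra.
Qed.

(* [|xi(x - i y)|] is nondecreasing in [y > 0], because the generator is nonnegative,
   while it is at most [pi |x| / y]. *)
Lemma xi_zero z x : Im z < 0 -> xi z x = hzero.
Proof.
  intros hz. set (r := Re z). set (m := - Im z). assert (hm : 0 < m) by (unfold m; lra).
  set (f := fun y => xi (r, - y) x).
  assert (bd : forall y, 0 < y -> hnorm (f y) <= PI / y * hnorm x).
  { intros y hy. assert (q : y <= Rabs (Im (r, - y))) by (simpl; rewrite Rabs_left; lra).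
    exact (Kint_norm u Hu _ _ x (adm_rk2 (r, - y) (r, - y) y hy q q)). }
  assert (mono : forall y, m <= y -> hnorm (f m) * hnorm (f m) <= hnorm (f y) * hnorm (f y)).
  { intros y hy. set (D := fun s t => hnorm (f s) * hnorm (f s) - hnorm (f t) * hnorm (f t)).
    assert (D m y <= 0 * (y - m)); [|unfold D in *; lra].
    apply (chain_le D m y 0 (2 * (PI / m * hnorm x) * (3 * PI / (m * m * m) * hnorm x))); [easy| |].
    - intros a b c _ _ _ _. unfold D. lra.
    - intros s t h1 h2 h3.
      pose proof (xi_quad (r, - s) (r, - t) m x hm) as q. simpl in q.
      specialize (q ltac:(rewrite Rabs_left; lra) ltac:(rewrite Rabs_left; lra)).
      (* By holomorphy, moving down by [t - s] changes [f] to first order by [(t - s)] times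
         [- i dxi], the generator applied to [f s]. [xi_pos] makes its inner product with [f s]
         nonnegative, so [|f|] can drop only by the quadratic remainder. *)
      replace ((r, (- t)%R) - (r, (- s)%R))%C with (RtoC (t - s) * (- Ci))%C in q
        by (apply injective_projections; simpl; ring).
      fold (f s) (f t) in q. set (rem := hsub _ _) in q.
      assert (e : f t = hadd (f s) (hadd (csc (RtoC (t - s)) (csc (- Ci)%C (dxi (r, - s) x))) rem))
        by (unfold rem; vec).
      pose proof (xi_pos (r, - s) x) as p. simpl in p. specialize (p ltac:(lra)). fold (f s) in p.
      assert (n : Cmod (RtoC (t - s) * - Ci) = t - s).
      { rewrite Cmod_mult, Cmod_R, Rabs_right by lra. rewrite Cmod_opp, Cmod_Ci. ring. }
      rewrite n in q.
      set (w := csc (- Ci)%C (dxi (r, - s) x)) in *. set (v := hadd (csc (RtoC (t - s)) w) rem) in *.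
      assert (s2 : hnorm (f t) * hnorm (f t) = hnorm (f s) * hnorm (f s) + 2 * Re (ip (f s) v) + hnorm v * hnorm v).
      { rewrite e, 3 hnorm_sq, ip_hadd_r, 2 ip_hadd_l, (ip_conj (f s) v).
        destruct (ip (f s) (f s)), (ip (f s) v), (ip v v). simpl. ring. }
      assert (s3 : Re (ip (f s) v) = (t - s) * Re (ip (f s) w) + Re (ip (f s) rem)).
      { unfold v. rewrite ip_hadd_r, ip_csc_r. destruct (ip (f s) w), (ip (f s) rem). simpl. ring. }
      assert (s4 : - (hnorm (f s) * hnorm rem) <= Re (ip (f s) rem)).
      { pose proof (cauchy_schwarz (f s) rem). pose proof (re_le_Cmod (ip (f s) rem)).
        pose proof (Rle_abs (- Re (ip (f s) rem))). rewrite Rabs_Ropp in *. lra. }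
      assert (s5 : hnorm (f s) * hnorm rem <=
         (PI / m * hnorm x) * (3 * PI / (m * m * m) * hnorm x * ((t - s) * (t - s)))).
      { apply Rmult_le_compat; [apply hnorm_ge0|apply hnorm_ge0| |exact q].
        eapply Rle_trans; [apply bd; lra|]. apply Rmult_le_compat_r; [apply hnorm_ge0|].
        unfold Rdiv. apply Rmult_le_compat_l; [pose proof PI_RGT_0; lra|].
        apply Rinv_le_contravar; lra. }
      assert (s6 : 0 <= (t - s) * Re (ip (f s) w)) by (apply Rmult_le_pos; [lra|exact p]).
      pose proof (Rle_0_sqr (hnorm v)). unfold Rsqr in *. unfold D.
      set (A := PI / m * hnorm x) in *. set (B := 3 * PI / (m * m * m) * hnorm x) in *.
      clearbody A B. rewrite s2, s3. clear - s4 s5 s6 H0. lra. }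
  replace z with (r, - m) by (unfold r, m; rewrite Ropp_involutive; now destruct z).
  change (f m = hzero). apply hnorm_eq0.
  apply Rle_antisym; [|apply hnorm_ge0]. apply le_epsilon. intros e he. rewrite Rplus_0_l.
  pose proof PI_RGT_0. pose proof (hnorm_ge0 x).
  (* A height at which the decay bound [PI |x| / y] is below [e]. *)
  set (y := m + PI * hnorm x / e).
  assert (0 <= PI * hnorm x / e) by (apply Rdiv_le_0_compat; nra).
  assert (hy : m <= y) by (unfold y; lra). specialize (mono y hy). specialize (bd y ltac:(lra)).
  assert (hnorm (f y) <= e).
  { apply Rle_trans with (1 := bd). apply (Rmult_le_reg_r y); [lra|].
    replace (PI / y * hnorm x * y) with (PI * hnorm x) by (field; lra).
    unfold y. rewrite Rmult_plus_distr_l. replace (e * (PI * hnorm x / e)) with (PI * hnorm x) by (field; lra).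
    nra. }
  pose proof (hnorm_ge0 (f y)). pose proof (hnorm_ge0 (f m)).
  apply Rsqr_incr_0_var; [|lra]. unfold Rsqr. nra.
Qed.

(** The Poisson kernel, written with both Cauchy kernels so that [adm_rk2] applies; [V] is the
    Poisson integral of the orbit of [x]. *)
Definition pk (z : C) (t : R) : C := (RtoC (Im z / PI) * (rk z t * rk (Cconj z) t))%C.

Definition V (z : C) (x : H) : H := Kint u (pk z) x.
Definition twopii_inv : C := (RtoC (/ (2 * PI)) * (- Ci))%C.
Definition dV (z : C) (x : H) : H := csc twopii_inv (xi z x).

Lemma Cmod_twopii_inv : Cmod twopii_inv = / (2 * PI).
Proof.
  pose proof PI_RGT_0. unfold twopii_inv. rewrite Cmod_mult, Cmod_R, Cmod_opp, Cmod_Ci, Rabs_right; [ring|].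
  left. apply Rinv_0_lt_compat. lra.
Qed.

Lemma Im_conj z : Im (Cconj z) = - Im z.
Proof. reflexivity. Qed.

Lemma pk_adm z : 0 < Im z -> adm (pk z) 1.
Proof.
  intros hz. pose proof PI_RGT_0. replace 1 with (Cmod (RtoC (Im z / PI)) * (PI / Im z)).
  - apply adm_scal. apply adm_rk2; [easy| |]; rewrite ?Im_conj, ?Rabs_Ropp, Rabs_right; lra.
  - rewrite Cmod_R, Rabs_right; [field; lra|]. apply Rle_ge, Rdiv_le_0_compat; lra.
Qed.

Lemma pk_real z t : 0 < Im z -> pk z t = RtoC (Im z / PI * cauchy2 (Re z) (Im z) t).
Proof.
  intros hz. unfold pk. rewrite rk_conj, <- Cmod2_conj, RtoC_mult. f_equal. f_equal. simpl.
  rewrite Rmult_1_r, rk_sq by lra. now rewrite Rabs_right by lra.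
Qed.

(** Partial fractions: the Poisson kernel is [1/(2 PI i)] times a part holomorphic in [z] minus an
    antiholomorphic one. *)
Lemma pk_cauchy z t : Im z <> 0 -> pk z t = (twopii_inv * (rk z t - rk (Cconj z) t))%C.
Proof.
  intros hz. pose proof PI_RGT_0.
  assert (n1 : (RtoC t - z)%C <> 0) by now apply real_minus_neq0.
  assert (n2 : (RtoC t - Cconj z)%C <> 0) by (apply real_minus_neq0; rewrite Im_conj; lra).
  replace (rk z t - rk (Cconj z) t)%C with ((z - Cconj z) * (rk z t * rk (Cconj z) t))%C
    by (unfold rk; field; easy).
  assert (e : RtoC (Im z / PI) = (twopii_inv * (z - Cconj z))%C).
  { unfold twopii_inv. destruct z as [a b]; apply injective_projections; simpl; field; lra. }
  unfold pk. rewrite e. ring.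
Qed.

Lemma V_norm z x : 0 < Im z -> hnorm (V z x) <= hnorm x.
Proof.
  intros hz. rewrite <- (Rmult_1_l (hnorm x)). apply (Kint_norm u Hu). now apply pk_adm.
Qed.

Lemma V_hadd z x y : 0 < Im z -> V z (hadd x y) = hadd (V z x) (V z y).
Proof. intros hz. apply (Kint_hadd u Hu _ 1). now apply pk_adm. Qed.

Lemma V_csc z c x : 0 < Im z -> V z (csc c x) = csc c (V z x).
Proof. intros hz. apply (Kint_csc u Hu _ 1). now apply pk_adm. Qed.

Lemma V_shift z s x : 0 < Im z -> u s (V z x) = V (z + RtoC s)%C x.
Proof.
  intros hz. assert (e : Im (z + RtoC s)%C = Im z) by (destruct z; simpl; ring).
  apply (Kint_shift u Hu _ _ 1 1); [now apply pk_adm|apply pk_adm; now rewrite e|].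
  intros t. unfold pk. rewrite e, Cplus_conj, rk_shift. f_equal. f_equal.
  replace (Cconj (RtoC s)) with (RtoC s) by (apply injective_projections; simpl; ring).
  apply rk_shift.
Qed.

(* The antiholomorphic part of the Poisson integral is [xi] in the lower half-plane. *)
Lemma V_quad z z' m x : 0 < m -> m <= Im z -> m <= Im z' ->
  hnorm (hsub (hsub (V z' x) (V z x)) (csc (z' - z)%C (dV z x))) <=
    / (m * m) * hnorm x * (Cmod (z' - z) * Cmod (z' - z)).
Proof.
  intros hm h1 h2. pose proof PI_RGT_0.
  assert (r1 : m <= Rabs (Im z)) by (rewrite Rabs_right; lra).
  assert (r2 : m <= Rabs (Im z')) by (rewrite Rabs_right; lra).
  assert (r3 : m <= Rabs (Im (Cconj z))) by (rewrite Im_conj, Rabs_Ropp; lra).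
  assert (r4 : m <= Rabs (Im (Cconj z'))) by (rewrite Im_conj, Rabs_Ropp; lra).
  set (h := (z' - z)%C). set (h' := (Cconj z' - Cconj z)%C). set (c := twopii_inv).
  assert (eh : Cmod h' = Cmod h) by (unfold h', h; now rewrite <- Cminus_conj, Cmod_conj).
  assert (ec : Cmod c = / (2 * PI)) by apply Cmod_twopii_inv.
  (* The second-order remainders of the two Cauchy kernels, from [rk z' - rk z - h rk z^2 = h^2 rk
     z^2 rk z']. Their masses add up to [|h|^2 / m^2]. *)
  set (k1 := fun t => (c * (h * h) * (rk z t * (rk z t * rk z' t)) +
     - c * (h' * h') * (rk (Cconj z) t * (rk (Cconj z) t * rk (Cconj z') t)))%C).
  set (B1 := Cmod (c * (h * h)) * (/ m * (PI / m)) + Cmod (- c * (h' * h')) * (/ m * (PI / m))).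
  assert (a1 : adm k1 B1).
  { apply adm_add; apply adm_scal; (apply adm_rk; [easy|easy|]; now apply adm_rk2). }
  assert (a2 : adm (fun t => rk (Cconj z) t * rk (Cconj z) t)%C (PI / m)) by now apply adm_rk2.
  unfold V, dV, xi. rewrite csc_csc.
  rewrite (Kint_comb u Hu _ 1 _ 1 _ (PI / m)
    (fun t => k1 t + (- c * h') * (rk (Cconj z) t * rk (Cconj z) t))%C
    (B1 + Cmod (- c * h') * (PI / m))).
  - rewrite (Kint_add u Hu k1 B1 _ (Cmod (- c * h') * (PI / m))); [|easy|now apply adm_scal].
    rewrite (Kint_scal u Hu _ _ (PI / m)) by easy.
    (* The term linear in the conjugate increment [h'] is the obstruction to holomorphy. It is [xi]
       at [Cconj z], below the axis, and vanishes there. *)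
    fold (xi (Cconj z) x). rewrite xi_zero by (rewrite Im_conj; lra).
    replace (hadd (Kint u k1 x) (csc (- c * h')%C hzero)) with (Kint u k1 x) by vec.
    eapply Rle_trans; [apply (Kint_norm u Hu _ _ _ a1)|]. unfold B1.
    rewrite !Cmod_mult, Cmod_opp, eh, ec. right. field. lra.
  - apply pk_adm. lra.
  - apply pk_adm. lra.
  - now apply adm_rk2.
  - apply adm_add; [easy|]. now apply adm_scal.
  - intros t. rewrite 2 pk_cauchy by lra. unfold k1, rk, h, h'. fold c.
    field. repeat split; apply real_minus_neq0; rewrite ?Im_conj; lra.
Qed.

End Hardy.

Section Extension.
Context {H : Hilbert} (u : R -> H -> H) (Hu : positive_group u).
Implicit Types x : H.

Lemma hint_poisson x y a b : 0 < y ->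
  hint (fun t => csc (pk (0, y) t) x) a b = csc (RtoC (y / PI * RInt (cauchy2 0 y) a b)) x.
Proof.
  intros hy. pose proof PI_RGT_0. rewrite cauchy2_RInt by easy.
  set (F := fun t => scal (V := hilbert_ModuleSpace H) (/ PI * atan ((t - 0) / y)) x).
  transitivity (minus (F b) (F a)).
  - apply (is_RInt_unique (V := hilbert_CompleteNormedModule H)).
    apply (is_RInt_ext (V := hilbert_NormedModule H)) with (fun t => scal (y / PI * cauchy2 0 y t) x).
    { intros t _. rewrite pk_real by easy. reflexivity. }
    apply (is_RInt_derive (V := hilbert_CompleteNormedModule H) F); intros t _.
    + apply (is_derive_scal_l (K := R_AbsRing) (V := hilbert_NormedModule H)).
      unfold cauchy2. auto_derive; [easy|].
      pose proof (cauchy2_denom_pos 0 y t hy).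
      assert (0 <= ((t + - 0) * / y) ^ 2) by apply pow2_ge_0.
      field. repeat split; try lra; unfold Rminus in *; nra.
    + apply (continuous_scal_l (K := R_AbsRing) (V := hilbert_NormedModule H)).
      apply (continuous_scal_r (K := R_AbsRing) (V := R_NormedModule)). now apply cauchy2_cont.
  - change (hsub (csc (RtoC (/ PI * atan ((b - 0) / y))) x) (csc (RtoC (/ PI * atan ((a - 0) / y))) x) =
      csc (RtoC (y / PI * (/ y * (atan ((b - 0) / y) - atan ((a - 0) / y))))) x).
    set (p := atan ((b - 0) / y)). set (q := atan ((a - 0) / y)).
    replace (y / PI * (/ y * (p - q))) with (/ PI * p - / PI * q) by (field; lra).
    rewrite RtoC_minus. vec.
Qed.

Lemma is_int_poisson x y : 0 < y -> is_int (fun t => csc (pk (0, y) t) x) x.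
Proof.
  intros hy e he. pose proof (hnorm_ge0 x).
  destruct (cauchy2_mass 0 y (e / (hnorm x + 1)) hy) as [A [hA ha]]; [apply Rdiv_lt_0_compat; lra|].
  exists A. split; [easy|]. intros a b h1 h2. rewrite hint_poisson by easy.
  specialize (ha a b h1 h2). set (r := y / PI * RInt (cauchy2 0 y) a b) in *.
  replace (hsub (csc (RtoC r) x) x) with (csc (RtoC (r - 1)) x) by (rewrite RtoC_minus; vec).
  rewrite hnorm_csc, Cmod_R. pose proof (Rabs_pos (r - 1)).
  rewrite Rmult_comm. apply (lt_absorb _ (hnorm x)); lra.
Qed.

Lemma V_boundary x e : 0 < e -> exists d, 0 < d /\
  forall y, 0 < y -> y < d -> hnorm (hsub (V u (0, y) x) x) <= e.
Proof.
  intros he. pose proof (hnorm_ge0 x) as nx. pose proof PI_RGT_0.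
  destruct (pg_cont u Hu x (-1) 1 0 ltac:(lra) (Rmin 1 (e / 2))) as [d [hd hs]].
  { apply Rmin_glb_lt; lra. }
  rewrite (pg_0 u Hu) in hs.
  set (r := Rmin 1 (d / 2)). assert (hr : 0 < r) by (apply Rmin_glb_lt; lra).
  assert (hr1 : r <= 1) by apply Rmin_l. assert (hr2 : r <= d / 2) by apply Rmin_r.
  assert (near : forall t, Rabs t <= r -> hnorm (hsub (u t x) x) <= e / 2).
  { intros t ht. assert (-1 <= t <= 1) by (unfold Rabs in ht; destruct Rcase_abs; lra).
    specialize (hs t ltac:(easy)). rewrite Rminus_0_r in hs. specialize (hs ltac:(lra)).
    pose proof (Rmin_r 1 (e / 2)). lra. }
  exists (e / 2 * r / (4 * hnorm x + 1)). split.
  { apply Rdiv_lt_0_compat; [|lra]. nra. }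
  intros y hy1 hy2.
  (* The first summand dominates the integrand for [|t| <= r], where [u t x] is near [x]; the second
     dominates it for [|t| > r], with 4 as the 2 of [q2] times the 2 of [q1]. The second has mass
     [4 |x| y / r], small with [y]. *)
  set (h := fun t => e / 2 * (y / PI * cauchy2 0 y t) + 4 * hnorm x * y / PI * cauchy2 0 r t).
  assert (hy3 : 0 <= y / PI) by (apply Rdiv_le_0_compat; lra).
  assert (hc : 0 <= 4 * hnorm x * y / PI) by (apply Rdiv_le_0_compat; nra).
  assert (hd' : dom h (e / 2 * (y / PI * (PI / y)) + 4 * hnorm x * y / PI * (PI / r))).
  { apply dom_add.
    - apply dom_scal; [lra|]. apply dom_scal; [easy|]. now apply cauchy2_dom.
    - apply dom_scal; [easy|]. now apply cauchy2_dom. }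
  assert (a : adm (pk (0, y)) 1) by now apply pk_adm.
  apply Rle_trans with (e / 2 * (y / PI * (PI / y)) + 4 * hnorm x * y / PI * (PI / r)).
  - set (g := fun t => hadd (csc (pk (0, y) t) (u t x)) (csc (pk (0, y) t) (csc (-1) x))).
    assert (c1 : hcont (fun t => csc (pk (0, y) t) (u t x))) by now apply adm_hcont with 1.
    assert (c2 : forall z : H, hcont (fun t => csc (pk (0, y) t) z)).
    { intros z. destruct a as [a _]. apply hcont_csc; [exact a|]. intros p q. apply hcont_on_const. }
    apply (is_int_norm_le g) with h.
    + now apply hcont_add.
    + exact hd'.
    + intros t. unfold g.
      replace (hadd (csc (pk (0, y) t) (u t x)) (csc (pk (0, y) t) (csc (-1) x))) with
        (csc (pk (0, y) t) (hsub (u t x) x)) by vec.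
      rewrite hnorm_csc, pk_real, Cmod_R by easy. simpl Re. simpl Im.
      pose proof (dom_pos _ _ (cauchy2_dom 0 y hy1) t) as p1.
      pose proof (dom_pos _ _ (cauchy2_dom 0 r hr) t) as p2.
      rewrite Rabs_right by (apply Rle_ge, Rmult_le_pos; easy). unfold h.
      pose proof (hnorm_ge0 (hsub (u t x) x)) as p3.
      destruct (Rle_lt_dec (Rabs t) r) as [ht|ht].
      * specialize (near t ht). assert (0 <= y / PI * cauchy2 0 y t) by nra.
        assert (0 <= 4 * hnorm x * y / PI * cauchy2 0 r t) by nra. nra.
      * assert (q1 : hnorm (hsub (u t x) x) <= 2 * hnorm x).
        { eapply Rle_trans; [apply hnorm_hsub_le|]. rewrite (pg_norm u Hu). lra. }
        (* For [|t| > r] one has [t^2 + r^2 <= 2 t^2]: the tail of the kernel is bounded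
           independently of the height [y]. *)
        assert (q2 : cauchy2 0 y t <= 2 * cauchy2 0 r t).
        { unfold cauchy2. pose proof (cauchy2_denom_pos 0 y t hy1). pose proof (cauchy2_denom_pos 0 r t hr).
          assert (r * r <= t * t).
          { replace (t * t) with (Rabs t * Rabs t) by (rewrite <- Rabs_mult, Rabs_right; nra). nra. }
          replace (2 * / ((t - 0) * (t - 0) + r * r)) with (/ (((t - 0) * (t - 0) + r * r) / 2)) by (field; lra).
          apply Rinv_le_contravar; [lra|]. nra. }
        assert (y / PI * cauchy2 0 y t * hnorm (hsub (u t x) x) <= y / PI * (2 * cauchy2 0 r t) * (2 * hnorm x)).
        { apply Rmult_le_compat; [nra|easy| |easy]. now apply Rmult_le_compat_l. }
        assert (0 <= e / 2 * (y / PI * cauchy2 0 y t)) by (apply Rmult_le_pos; nra).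
        replace (4 * hnorm x * y / PI * cauchy2 0 r t) with (y / PI * (2 * cauchy2 0 r t) * (2 * hnorm x))
          by (field; lra). lra.
    + replace (hsub (V u (0, y) x) x) with (hadd (V u (0, y) x) (csc (-1) x)) by vec.
      apply is_int_add; [easy|apply c2|now apply Kint_spec with 1|now apply is_int_poisson].
  - replace (e / 2 * (y / PI * (PI / y))) with (e / 2) by (field; lra).
    replace (4 * hnorm x * y / PI * (PI / r)) with (4 * hnorm x * y / r) by (field; lra).
    assert (4 * hnorm x * y / r <= e / 2); [|lra].
    apply (Rmult_le_reg_r r); [easy|]. unfold Rdiv. rewrite Rmult_assoc, Rinv_l, Rmult_1_r by lra.
    apply (Rmult_lt_compat_r (4 * hnorm x + 1)) in hy2; [|lra].
    replace (e / 2 * r / (4 * hnorm x + 1) * (4 * hnorm x + 1)) with (e / 2 * r) in hy2 by (field; lra).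
    unfold Rdiv in *. nra.
Qed.

(* The extension of [u] to the closed upper half-plane; junk below the real axis. *)
Definition W (z : C) (x : H) : H := if Rlt_dec 0 (Im z) then V u z x else u (Re z) x.

Lemma W_real t x : W (RtoC t) x = u t x.
Proof. unfold W. simpl. destruct Rlt_dec as [h|_]; [lra|easy]. Qed.

Lemma W_norm z x : hnorm (W z x) <= hnorm x.
Proof. unfold W. destruct Rlt_dec; [now apply V_norm|]. rewrite (pg_norm u Hu). lra. Qed.

Lemma W_linear z : linear_op (W z).
Proof.
  unfold W. destruct Rlt_dec as [h|_]; [|apply (pg_lin u Hu)]. split.
  - intros. now apply V_hadd.
  - intros a x. replace (hscal a x) with (csc (toC a) x) by (unfold csc; f_equal; now destruct a).
    rewrite V_csc by easy. unfold csc. f_equal. now destruct a.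
Qed.

Lemma W_shift s z x : u s (W z x) = W (z + RtoC s)%C x.
Proof.
  assert (e : Im (z + RtoC s)%C = Im z) by (destruct z; simpl; ring).
  unfold W. rewrite e. destruct Rlt_dec as [h|_]; [now apply V_shift|].
  rewrite <- (pg_add u Hu). f_equal. destruct z; simpl; ring.
Qed.

Lemma W_quad z z' m x : 0 < m -> m <= Im z -> m <= Im z' ->
  hnorm (hsub (hsub (W z' x) (W z x)) (csc (z' - z)%C (dV u z x))) <=
    / (m * m) * hnorm x * (Cmod (z' - z) * Cmod (z' - z)).
Proof.
  intros hm h1 h2. unfold W. destruct Rlt_dec; [|lra]. destruct Rlt_dec; [|lra].
  now apply (V_quad u Hu).
Qed.

Lemma dV_norm z m x : 0 < m -> m <= Im z -> hnorm (dV u z x) <= / m * hnorm x.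
Proof.
  intros hm h1. pose proof PI_RGT_0. unfold dV. rewrite hnorm_csc.
  assert (r1 : m <= Rabs (Im z)) by (rewrite Rabs_right; lra).
  pose proof (Kint_norm u Hu _ _ x (adm_rk2 z z m hm r1 r1)) as q. fold (xi u z x) in q.
  rewrite Cmod_twopii_inv. apply Rle_trans with (/ (2 * PI) * (PI / m * hnorm x)).
  - apply Rmult_le_compat_l; [left; apply Rinv_0_lt_compat; lra|easy].
  - replace (/ (2 * PI) * (PI / m * hnorm x)) with (/ 2 * (/ m * hnorm x)) by (field; lra).
    assert (0 <= / m * hnorm x); [|lra]. apply Rmult_le_pos; [|apply hnorm_ge0].
    left. now apply Rinv_0_lt_compat.
Qed.

Lemma W_lip z z' m x : 0 < m -> m <= Im z -> m <= Im z' -> Cmod (z' - z) <= m ->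
  hnorm (hsub (W z' x) (W z x)) <= 2 / m * hnorm x * Cmod (z' - z).
Proof.
  intros hm h1 h2 h3. pose proof (W_quad z z' m x hm h1 h2) as q.
  pose proof (dV_norm z m x hm h1) as q2. pose proof (hnorm_ge0 x). pose proof (Cmod_ge_0 (z' - z)).
  set (d := Cmod (z' - z)) in *.
  replace (hsub (W z' x) (W z x)) with (hadd (hsub (hsub (W z' x) (W z x)) (csc (z' - z)%C (dV u z x)))
    (csc (z' - z)%C (dV u z x))) by vec.
  eapply Rle_trans; [apply hnorm_hadd|]. rewrite hnorm_csc. fold d.
  assert (d * hnorm (dV u z x) <= d * (/ m * hnorm x)) by now apply Rmult_le_compat_l.
  assert (/ (m * m) * hnorm x * (d * d) <= / m * hnorm x * d).
  { replace (/ (m * m) * hnorm x * (d * d)) with (/ m * hnorm x * d * (d / m)) by (field; lra).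
    rewrite <- (Rmult_1_r (/ m * hnorm x * d)) at 2. apply Rmult_le_compat_l.
    - apply Rmult_le_pos; [|easy]. apply Rmult_le_pos; [|easy]. left. now apply Rinv_0_lt_compat.
    - apply (Rmult_le_reg_r m); [easy|]. unfold Rdiv. rewrite Rmult_assoc, Rinv_l; lra. }
  replace (2 / m * hnorm x * d) with (d * (/ m * hnorm x) + / m * hnorm x * d) by (field; lra). lra.
Qed.

Lemma W_cont z0 x e : 0 <= Im z0 -> 0 < e -> exists d, 0 < d /\
  forall z, 0 <= Im z -> Cmod (z - z0) < d -> hnorm (hsub (W z x) (W z0 x)) < e.
Proof.
  intros hz he. destruct hz as [hz|hz].
  - set (m := Im z0 / 2). assert (hm : 0 < m) by (unfold m; lra). pose proof (hnorm_ge0 x).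
    exists (Rmin m (e / (2 / m * hnorm x + 1))).
    assert (h2 : 0 <= 2 / m * hnorm x) by (apply Rmult_le_pos; [apply Rdiv_le_0_compat; lra|easy]).
    split; [apply Rmin_glb_lt; [easy|apply Rdiv_lt_0_compat; lra]|].
    intros z _ hd. assert (d1 := Rlt_le_trans _ _ _ hd (Rmin_l _ _)).
    assert (d2 := Rlt_le_trans _ _ _ hd (Rmin_r _ _)).
    assert (m <= Im z).
    { pose proof (Im_le_Cmod (z - z0)) as q. pose proof (Rle_abs (- Im (z - z0)%C)) as q2.
      assert (ez : Im (z - z0)%C = Im z - Im z0) by (destruct z, z0; simpl; ring).
      rewrite Rabs_Ropp, ez in q2. rewrite ez in q. unfold m in *. lra. }
    apply Rle_lt_trans with (1 := W_lip z0 z m x hm ltac:(unfold m; lra) ltac:(easy) ltac:(lra)).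
    pose proof (Cmod_ge_0 (z - z0)).
    apply (lt_absorb _ (2 / m * hnorm x)); lra.
  - destruct (V_boundary x (e / 4)) as [d1 [h1 h1']]; [lra|].
    destruct (pg_cont u Hu x (Re z0 - 1) (Re z0 + 1) (Re z0) ltac:(lra) (e / 2)) as [d2 [h2 h2']]; [lra|].
    exists (Rmin 1 (Rmin d1 d2)). split; [repeat apply Rmin_glb_lt; lra|]. intros z hz1 hd.
    assert (c0 := Rlt_le_trans _ _ _ hd (Rmin_l _ _)).
    assert (c12 := Rlt_le_trans _ _ _ hd (Rmin_r _ _)).
    assert (c1 := Rlt_le_trans _ _ _ c12 (Rmin_l _ _)). assert (c2 := Rlt_le_trans _ _ _ c12 (Rmin_r _ _)).
    pose proof (Im_le_Cmod (z - z0)) as q1. pose proof (re_le_Cmod (z - z0)) as q2.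
    destruct z as [a b], z0 as [a0 b0]. simpl in *. rewrite <- hz in *.
    unfold Rminus in q1. rewrite Ropp_0, Rplus_0_r, Rabs_right in q1 by lra.
    assert (ra : Rabs (a - a0) < 1) by (unfold Rminus; lra).
    assert (a0 - 1 <= a <= a0 + 1) by (unfold Rabs in ra; destruct Rcase_abs; lra).
    specialize (h2' a ltac:(easy) ltac:(unfold Rminus; lra)).
    assert (e0 : W (a0, 0) x = u a0 x) by apply (W_real a0).
    rewrite e0. apply Rle_lt_trans with (1 := hnorm_hsub_triangle _ (u a x) _).
    assert (hnorm (hsub (W (a, b) x) (u a x)) <= e / 4); [|lra].
    (* Factoring out the unitary [u a] reduces the approach to any boundary point to the vertical
       approach to 0, with a bound uniform in [a]. *)
    replace (W (a, b) x) with (u a (W (0, b) x)).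
    2:{ rewrite W_shift. f_equal. apply injective_projections; simpl; ring. }
    rewrite <- (linear_op_hsub _ _ _ (pg_lin u Hu a)), (pg_norm u Hu).
    unfold W. simpl. destruct Rlt_dec as [hb|hb].
    + apply h1'; lra.
    + rewrite (pg_0 u Hu), hsub_diag, hnorm_hzero. lra.
Qed.

End Extension.

(** * Contour integrals *)

Definition ccont_on (a b : R) (k : R -> C) : Prop := hcont_on (H:=CH) a b k.

Lemma ccont_on_iff a b k : ccont_on a b k <-> forall t, a <= t <= b -> forall e, 0 < e -> exists d, 0 < d /\
    forall s, a <= s <= b -> Rabs (s - t) < d -> Cmod (k s - k t) < e.
Proof.
  split; intros h t ht e he; destruct (h t ht e he) as [d [hd hs]]; exists d; split; auto;
    intros s h1 h2; specialize (hs s h1 h2); [rewrite hnorm_CH in hs|rewrite hnorm_CH]; exact hs.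
Qed.

Lemma ccont_mult a b k k' : ccont_on a b k -> ccont_on a b k' -> ccont_on a b (fun t => k t * k' t)%C.
Proof.
  intros h1 h2. apply (hcont_on_ext (H:=CH)) with (fun t => csc (H:=CH) (k t) (k' t)).
  { intros t _. apply csc_CH. }
  now apply hcont_on_csc.
Qed.

Lemma ccont_const a b c : ccont_on a b (fun _ => c).
Proof. apply (hcont_on_const (H:=CH)). Qed.

Lemma ccont_sub a b k k' : ccont_on a b k -> ccont_on a b k' -> ccont_on a b (fun t => k t - k' t)%C.
Proof. apply (hcont_on_sub_fun (H:=CH)). Qed.

Lemma ccont_ext a b k k' : (forall t, a <= t <= b -> k t = k' t) -> ccont_on a b k -> ccont_on a b k'.
Proof. apply (hcont_on_ext (H:=CH)). Qed.

Lemma ccont_lip a b k K : (forall s t, a <= s <= b -> a <= t <= b -> Cmod (k s - k t) <= K * Rabs (s - t)) ->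
  ccont_on a b k.
Proof.
  intros h. apply ccont_on_iff. intros t ht e he. pose proof (Rabs_pos K). pose proof (Rle_abs K).
  exists (e / (Rabs K + 1)). split; [apply Rdiv_lt_0_compat; lra|]. intros s h1 hs.
  pose proof (Rabs_pos (s - t)).
  apply Rle_lt_trans with (1 := h s t h1 ht). apply (lt_absorb _ (Rabs K)); lra.
Qed.

Definition cint (k : R -> C) (a b : R) : C := hint (H:=CH) k a b.

Lemma cint_sub k k' a b : a <= b -> ccont_on a b k -> ccont_on a b k' ->
  (cint (fun t => k t - k' t) a b = cint k a b - cint k' a b)%C.
Proof. apply (hint_sub (H:=CH)). Qed.

Lemma cint_ext k k' a b : a <= b -> (forall t, a <= t <= b -> k t = k' t) -> cint k a b = cint k' a b.
Proof. apply (hint_ext (H:=CH)). Qed.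

Lemma cint_scal c k a b : a <= b -> ccont_on a b k -> (cint (fun t => c * k t) a b = c * cint k a b)%C.
Proof.
  intros hab hk. unfold cint. rewrite <- (csc_CH c), <- (hint_csc (H:=CH)) by easy.
  apply (hint_ext (H:=CH)); [easy|]. intros t _. symmetry. apply csc_CH.
Qed.

Lemma cint_const c a b : (cint (fun _ => c) a b = RtoC (b - a) * c)%C.
Proof. unfold cint. rewrite (hint_const (H:=CH)). apply csc_CH. Qed.

Lemma cint_norm k a b M : a <= b -> ccont_on a b k -> (forall t, a <= t <= b -> Cmod (k t) <= M) ->
  Cmod (cint k a b) <= (b - a) * M.
Proof.
  intros hab hk hM. rewrite <- hnorm_CH. apply (hint_norm_const (H:=CH)); auto.
  intros t ht. rewrite hnorm_CH. auto.
Qed.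

Lemma cint_Chasles k a b c : a <= b -> b <= c -> ccont_on a c k ->
  (cint k a b + cint k b c = cint k a c)%C.
Proof. apply (hint_Chasles (H:=CH)). Qed.

Lemma ccont_sub_int k a b c d : a <= c -> d <= b -> ccont_on a b k -> ccont_on c d k.
Proof. apply (hcont_on_sub (H:=CH)). Qed.

(** The values of [k] lie in the disc of centre [i N] and radius [N - m/2], where [N = M^2/m], and
    so does their mean. This disc stays above the real axis. *)
Lemma cint_Im_pos k m M : 0 < m -> ccont_on 0 1 k -> (forall t, 0 <= t <= 1 -> m <= Im (k t)) ->
  (forall t, 0 <= t <= 1 -> Cmod (k t) <= M) -> 0 < Im (cint k 0 1).
Proof.
  intros hm hk hi hM.
  assert (hmM : m <= M).
  { specialize (hi 0 ltac:(lra)). specialize (hM 0 ltac:(lra)).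
    pose proof (Im_le_Cmod (k 0)). pose proof (Rle_abs (Im (k 0))). lra. }
  set (N := M * M / m).
  assert (hNm : N * m = M * M) by (unfold N; field; lra).
  assert (hN : m <= N) by nra.
  assert (q : Cmod (cint (fun t => k t - (0, N))%C 0 1) <= (1 - 0) * (N - m / 2)).
  { apply cint_norm; [lra| |].
    - apply ccont_sub; [easy|apply ccont_const].
    - intros t ht. specialize (hi t ht). specialize (hM t ht).
      pose proof (Cmod_ge_0 (k t)). pose proof (Cmod2_alt (k t)) as e1.
      pose proof (Cmod2_alt (k t - (0, N))) as e2. destruct (k t) as [x y]. simpl in *.
      apply Rsqr_incr_0_var; [|lra]. unfold Rsqr. nra. }
  rewrite cint_sub in q; [|lra|easy|apply ccont_const]. rewrite cint_const in q.
  pose proof (Im_le_Cmod (cint k 0 1 - RtoC (1 - 0) * (0, N))) as p.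
  set (v := cint k 0 1) in *. clearbody v. destruct v as [x y]. simpl in *.
  pose proof (Rle_abs (- (y + - ((1 + - 0) * N + 0 * 0)))) as p2. rewrite Rabs_Ropp in p2.
  unfold Rminus in *. lra.
Qed.

Lemma Rabs_mul_self x : Rabs x * Rabs x = x * x.
Proof. rewrite <- Rabs_mult. apply Rabs_right. pose proof (Rle_0_sqr x). unfold Rsqr in *. lra. Qed.

(** [g] is the derivative of [G], with a quadratic remainder uniform in the base point. *)
Definition quadR (G g : R -> C) (a b K : R) : Prop := forall s t, a <= s <= b -> a <= t <= b ->
  Cmod (G t - G s - RtoC (t - s) * g s) <= K * ((t - s) * (t - s)).

Lemma quadR_cont G g a b K : quadR G g a b K -> ccont_on a b G.
Proof.
  intros hq. apply ccont_on_iff. intros t ht e he.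
  set (L := Cmod (g t) + Rabs K * (b - a) + 1).
  assert (hL : 0 < L).
  { pose proof (Cmod_ge_0 (g t)). pose proof (Rabs_pos K). unfold L. nra. }
  exists (e / L). split; [now apply Rdiv_lt_0_compat|]. intros s hs1 hs2.
  replace (G s - G t)%C with ((G s - G t - RtoC (s - t) * g t) + RtoC (s - t) * g t)%C by ring.
  eapply Rle_lt_trans; [apply Cmod_triangle|]. rewrite Cmod_mult, Cmod_R.
  specialize (hq t s ht hs1). set (d := Rabs (s - t)) in *.
  assert (hd : 0 <= d) by apply Rabs_pos.
  assert (hd2 : d <= b - a) by (unfold d, Rabs; destruct Rcase_abs; lra).
  replace ((s - t) * (s - t)) with (d * d) in hq by (unfold d; now rewrite Rabs_mul_self).
  assert (K * (d * d) <= Rabs K * (b - a) * d).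
  { pose proof (Rle_abs K). pose proof (Rabs_pos K).
    apply Rle_trans with (Rabs K * (d * d)); [apply Rmult_le_compat_r; nra|].
    rewrite Rmult_assoc. apply Rmult_le_compat_l; nra. }
  apply Rle_lt_trans with (L * d); [unfold L; nra|].
  apply (Rmult_lt_compat_l L) in hs2; [|easy].
  now replace (L * (e / L)) with e in hs2 by (field; lra).
Qed.

(** Add the expansion at [s] evaluated at [t] to the one at [t] evaluated at [s]. *)
Lemma quadR_lip G g a b K s t : quadR G g a b K -> a <= s <= b -> a <= t <= b ->
  Cmod (g s - g t) <= 2 * K * Rabs (s - t).
Proof.
  intros hq hs ht. destruct (Req_dec s t) as [<-|n].
  { replace (g s - g s)%C with (RtoC 0) by ring. rewrite Cmod_0, Rminus_diag, Rabs_R0. lra. }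
  assert (hd : 0 < Rabs (s - t)) by (apply Rabs_pos_lt; lra).
  apply (Rmult_le_reg_r (Rabs (s - t))); [easy|].
  rewrite <- Cmod_R, <- Cmod_mult, Cmod_R.
  replace ((g s - g t) * RtoC (s - t))%C with
    ((G s - G t - RtoC (s - t) * g t) + (G t - G s - RtoC (t - s) * g s))%C
    by (rewrite !RtoC_minus; ring).
  eapply Rle_trans; [apply Cmod_triangle|].
  pose proof (hq s t hs ht). pose proof (hq t s ht hs).
  replace (2 * K * Rabs (s - t) * Rabs (s - t)) with (2 * K * (Rabs (s - t) * Rabs (s - t))) by ring.
  rewrite Rabs_mul_self. nra.
Qed.

Lemma quadR_cont' G g a b K : quadR G g a b K -> ccont_on a b g.
Proof. intros hq. apply ccont_lip with (2 * K). intros s t hs ht. now apply quadR_lip with G a b. Qed.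

(** The defect between integral and increment is additive over intervals and quadratically small, so
    [chain_le] with [M = 0] forces it to vanish. *)
Lemma quadR_FTC G g a b K : a <= b -> quadR G g a b K -> cint g a b = (G b - G a)%C.
Proof.
  intros hab hq.
  pose proof (quadR_cont' G g a b K hq) as hg.
  assert (q : Cmod (cint g a b - (G b - G a)) <= 0).
  { replace 0 with (0 * (b - a)) by ring.
    apply (chain_le (fun s t => Cmod (cint g s t - (G t - G s))) a b 0 (3 * Rabs K)); [easy| |].
    - intros r s t h1 h2 h3 h4. rewrite <- (cint_Chasles g r s t); [|easy|easy|].
      + replace (cint g r s + cint g s t - (G t - G r))%C with
          ((cint g r s - (G s - G r)) + (cint g s t - (G t - G s)))%C by ring. apply Cmod_triangle.
      + apply ccont_sub_int with a b; auto.
    - intros s t h1 h2 h3.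
      assert (hs : a <= s <= b) by lra. assert (ht : a <= t <= b) by lra.
      assert (hg' : ccont_on s t g) by (apply ccont_sub_int with a b; auto).
      pose proof (Rle_abs K) as hK. pose proof (Rabs_pos K) as hK'.
      assert (lip : forall r, s <= r <= t -> Cmod (g r - g s) <= 2 * Rabs K * (t - s)).
      { intros r hr. eapply Rle_trans; [apply (quadR_lip G g a b K r s hq); lra|].
        rewrite Rabs_right by lra. apply Rle_trans with (2 * Rabs K * (r - s)).
        - apply Rmult_le_compat_r; lra.
        - apply Rmult_le_compat_l; lra. }
      replace (cint g s t - (G t - G s))%C with
        (cint (fun r => g r - g s)%C s t - (G t - G s - RtoC (t - s) * g s))%C.
      2:{ rewrite cint_sub by (easy || apply ccont_const). rewrite cint_const. ring. }
      unfold Cminus at 1. eapply Rle_trans; [apply Cmod_triangle|]. rewrite Cmod_opp.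
      specialize (hq s t hs ht).
      assert (Cmod (cint (fun r => g r - g s)%C s t) <= (t - s) * (2 * Rabs K * (t - s))).
      { apply cint_norm; auto. apply ccont_sub; [easy|apply ccont_const]. }
      assert (K * ((t - s) * (t - s)) <= Rabs K * ((t - s) * (t - s))) by (apply Rmult_le_compat_r; nra).
      nra. }
  pose proof (Cmod_ge_0 (cint g a b - (G b - G a))).
  assert (e : (cint g a b - (G b - G a))%C = 0) by (apply Cmod_eq_0; lra).
  replace (cint g a b) with ((cint g a b - (G b - G a)) + (G b - G a))%C by ring. rewrite e. ring.
Qed.

Definition seg (a b : C) (s : R) : C := (a + RtoC s * (b - a))%C.

(* Positive iff [w] lies strictly to the left of the oriented line from [a] to [b]. *)
Definition cross (a b w : C) : R := Im ((b - a) * Cconj (a - w))%C.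

(** [d zeta / (zeta - w)] along the segment; [edge] is thus the Cauchy integral of [F] at [w] over
    one side of a contour, without the factor [1/(2 PI i)]. *)
Definition ker (a b w : C) (s : R) : C := ((b - a) / (seg a b s - w))%C.

Definition edge (F : C -> C) (a b w : C) : C := cint (fun s => F (seg a b s) * ker a b w s)%C 0 1.

Definition along (F : C -> C) (a b : C) : Prop := ccont_on 0 1 (fun s => F (seg a b s)).

Lemma Im_Cdiv (u v : C) : v <> 0 -> Im (u / v)%C = Im (u * Cconj v)%C / (Cmod v * Cmod v).
Proof.
  intros n. assert (e := Cmod2_alt v). simpl in e. rewrite Rmult_1_r in e. rewrite e.
  assert (p : 0 < Cmod v * Cmod v) by (apply Rmult_lt_0_compat; now apply Cmod_gt_0).
  rewrite e in p. destruct u, v. simpl in *. field. lra.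
Qed.

Section Edge.
Variables a b : C.

Lemma cross_seg w s : Im ((b - a) * Cconj (seg a b s - w))%C = cross a b w.
Proof. unfold cross, seg. destruct a, b, w. simpl. ring. Qed.

(** When positive, [cross a b w] is [|b - a|] times the distance from [w] to the line through [a]
    and [b]. *)
Lemma seg_dist w s : cross a b w <= Cmod (b - a) * Cmod (seg a b s - w).
Proof.
  rewrite <- (cross_seg w s), <- (Cmod_conj (seg a b s - w)), <- Cmod_mult.
  eapply Rle_trans; [apply Rle_abs|]. apply Im_le_Cmod.
Qed.

Lemma seg_dist_pos w s : 0 < cross a b w -> 0 < Cmod (seg a b s - w).
Proof.
  intros h. pose proof (seg_dist w s). pose proof (Cmod_ge_0 (seg a b s - w)).
  pose proof (Cmod_ge_0 (b - a)). destruct (Req_dec (Cmod (seg a b s - w)) 0); nra.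
Qed.

Lemma seg_neq w s : 0 < cross a b w -> (seg a b s - w)%C <> 0.
Proof. intros h. apply Cmod_gt_0. now apply seg_dist_pos. Qed.

Lemma ker_bound w s : 0 < cross a b w ->
  Cmod (ker a b w s) <= Cmod (b - a) * Cmod (b - a) / cross a b w.
Proof.
  intros h. unfold ker. rewrite Cmod_div by now apply seg_neq.
  pose proof (seg_dist w s). pose proof (seg_dist_pos w s h). pose proof (Cmod_ge_0 (b - a)).
  apply (Rmult_le_reg_r (Cmod (seg a b s - w) * cross a b w)); [now apply Rmult_lt_0_compat|].
  replace (Cmod (b - a) / Cmod (seg a b s - w) * (Cmod (seg a b s - w) * cross a b w))
    with (Cmod (b - a) * cross a b w) by (field; lra).
  replace (Cmod (b - a) * Cmod (b - a) / cross a b w * (Cmod (seg a b s - w) * cross a b w))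
    with (Cmod (b - a) * (Cmod (b - a) * Cmod (seg a b s - w))) by (field; lra).
  now apply Rmult_le_compat_l.
Qed.

Lemma ker_cont w : 0 < cross a b w -> ccont_on 0 1 (ker a b w).
Proof.
  intros h. set (B := Cmod (b - a) * Cmod (b - a) / cross a b w).
  apply ccont_lip with (B * B). intros s t _ _.
  replace (ker a b w s - ker a b w t)%C with (RtoC (t - s) * ker a b w s * ker a b w t)%C.
  2:{ assert (e : RtoC (t - s) = (RtoC t - RtoC s)%C) by apply RtoC_minus. rewrite e. unfold ker.
      assert (n1 := seg_neq w s h). assert (n2 := seg_neq w t h). unfold seg in *. field. easy. }
  rewrite 2 Cmod_mult, Cmod_R, (Rabs_minus_sym t s).
  pose proof (ker_bound w s h). pose proof (ker_bound w t h). fold B in H, H0.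
  rewrite (Rmult_comm (B * B)), Rmult_assoc. apply Rmult_le_compat_l; [apply Rabs_pos|].
  apply Rmult_le_compat; auto; apply Cmod_ge_0.
Qed.

Lemma edge_cont F w : 0 < cross a b w -> along F a b ->
  ccont_on 0 1 (fun s => F (seg a b s) * ker a b w s)%C.
Proof. intros h hF. apply ccont_mult; [exact hF|now apply ker_cont]. Qed.

Lemma edge_ext F G w : (forall s, 0 <= s <= 1 -> F (seg a b s) = G (seg a b s)) -> edge F a b w = edge G a b w.
Proof. intros h. apply cint_ext; [lra|]. intros s hs. now rewrite h. Qed.

Lemma along_sub F G : along F a b -> along G a b -> along (fun z => F z - G z)%C a b.
Proof. intros hF hG. exact (ccont_sub _ _ _ _ hF hG). Qed.

Lemma along_const c : along (fun _ => c) a b.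
Proof. apply ccont_const. Qed.

Lemma edge_sub F G w : 0 < cross a b w -> along F a b -> along G a b ->
  edge (fun z => F z - G z)%C a b w = (edge F a b w - edge G a b w)%C.
Proof.
  intros h hF hG. unfold edge. rewrite <- cint_sub by (lra || now apply edge_cont).
  apply cint_ext; [lra|]. intros s _. ring.
Qed.

Lemma edge_bound F w M : 0 < cross a b w -> along F a b ->
  (forall s, 0 <= s <= 1 -> Cmod (F (seg a b s)) <= M) ->
  Cmod (edge F a b w) <= M * (Cmod (b - a) * Cmod (b - a) / cross a b w).
Proof.
  intros h hF hM. unfold edge.
  eapply Rle_trans; [apply cint_norm with (M := M * (Cmod (b - a) * Cmod (b - a) / cross a b w));
    [lra|now apply edge_cont|]|lra].
  intros s hs. rewrite Cmod_mult. apply Rmult_le_compat; try apply Cmod_ge_0; auto. now apply ker_bound.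
Qed.

(** The imaginary part is the angle under which the segment is seen from [w]. Such angles add up
    along a contour, which makes the normalising factor in Cauchy's formula nonzero. *)
Lemma edge_one_Im w : 0 < cross a b w -> 0 < Im (edge (fun _ => 1) a b w).
Proof.
  intros h. set (D := Cmod (a - w) + Cmod (b - a)).
  assert (hD : forall s, 0 <= s <= 1 -> Cmod (seg a b s - w) <= D).
  { intros s hs. unfold seg. replace (a + RtoC s * (b - a) - w)%C with ((a - w) + RtoC s * (b - a))%C by ring.
    eapply Rle_trans; [apply Cmod_triangle|]. rewrite Cmod_mult, Cmod_R, Rabs_right by lra.
    pose proof (Cmod_ge_0 (b - a)). unfold D. nra. }
  assert (pD : 0 < D).
  { specialize (hD 0 ltac:(lra)). pose proof (seg_dist_pos w 0 h). lra. }
  unfold edge. apply cint_Im_pos with (cross a b w / (D * D)) (Cmod (b - a) * Cmod (b - a) / cross a b w).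
  - apply Rdiv_lt_0_compat; nra.
  - apply (edge_cont (fun _ => 1)); [easy|apply along_const].
  - intros s hs. rewrite Cmult_1_l. specialize (hD s hs).
    pose proof (seg_dist_pos w s h) as p.
    assert (e : Im (ker a b w s) = cross a b w / (Cmod (seg a b s - w) * Cmod (seg a b s - w))).
    { rewrite <- (cross_seg w s). unfold ker. apply Im_Cdiv. now apply seg_neq. }
    rewrite e. unfold Rdiv. apply Rmult_le_compat_l; [lra|]. apply Rinv_le_contravar; nra.
  - intros s hs. rewrite Cmult_1_l. now apply ker_bound.
Qed.

Lemma along_div F c : 0 < cross a b c -> along F a b -> along (fun z => F z / (z - c))%C a b.
Proof.
  intros h hF. unfold along.
  destruct (Ceq_dec (b - a) 0) as [e|n].
  { exfalso. unfold cross in h. rewrite e in h. rewrite Cmult_0_l in h. simpl in h. lra. }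
  apply ccont_ext with (fun s => F (seg a b s) * (/ (b - a) * ker a b c s))%C.
  { intros s _. unfold ker. pose proof (seg_neq c s h). field. easy. }
  apply ccont_mult; [exact hF|]. apply ccont_mult; [apply ccont_const|now apply ker_cont].
Qed.

(** Partial fractions: [(w - c) / ((z - c) (z - w)) = 1/(z - w) - 1/(z - c)]. This is one step of
    Newton interpolation. *)
Lemma edge_rec F c w : 0 < cross a b w -> 0 < cross a b c -> (w - c)%C <> 0 -> along F a b ->
  (edge (fun z => F z / (z - c)) a b w * (w - c) = edge F a b w - edge F a b c)%C.
Proof.
  intros hw hc n hF. unfold edge. rewrite <- cint_sub by (lra || now apply edge_cont).
  rewrite Cmult_comm, <- cint_scal; [|lra|].
  - apply cint_ext; [lra|]. intros s _. unfold ker.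
    pose proof (seg_neq w s hw). pose proof (seg_neq c s hc). field. easy.
  - apply (edge_cont (fun z => F z / (z - c))%C); [easy|now apply along_div].
Qed.

End Edge.

(** Holomorphy on [D] in uniform form, with derivative [F']. *)
Definition quad (D : C -> Prop) (F F' : C -> C) (K : R) : Prop := 0 <= K /\
  forall z z', D z -> D z' -> Cmod (F z' - F z - (z' - z) * F' z) <= K * (Cmod (z' - z) * Cmod (z' - z)).

(* The contour is contracted linearly to [w]; [l] is the contraction ratio. *)
Definition dil (F : C -> C) (w : C) (l : R) (z : C) : C := F (w + RtoC l * (z - w))%C.

Lemma quad_along D F F' K a b w l : quad D F F' K ->
  (forall s, 0 <= s <= 1 -> D (w + RtoC l * (seg a b s - w))%C) ->
  quadR (fun s => dil F w l (seg a b s)) (fun s => RtoC l * (b - a) * F' (w + RtoC l * (seg a b s - w)))%C 0 1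
    (K * (l * l * (Cmod (b - a) * Cmod (b - a)))).
Proof.
  intros [_ hq] hD s t hs ht. specialize (hq _ _ (hD s hs) (hD t ht)).
  replace (w + RtoC l * (seg a b t - w) - (w + RtoC l * (seg a b s - w)))%C with
    (RtoC (t - s) * (RtoC l * (b - a)))%C in hq.
  2:{ assert (e : RtoC (t - s) = (RtoC t - RtoC s)%C) by apply RtoC_minus. rewrite e. unfold seg. ring. }
  rewrite 2 Cmod_mult, 2 Cmod_R in hq. unfold dil.
  rewrite <- (Cmult_assoc (RtoC (t - s))) in hq.
  eapply Rle_trans; [exact hq|]. right.
  transitivity (K * (Rabs (t - s) * Rabs (t - s) * (Rabs l * Rabs l) * (Cmod (b - a) * Cmod (b - a)))); [ring|].
  rewrite 2 Rabs_mul_self. ring.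
Qed.

(** Differentiating [F(w + l (g - w)) g' / (g - w)] in [l] cancels the denominator and leaves
    [F' g'], which is [1/l] times a derivative along the edge. It integrates to the difference of
    the endpoint values. *)
Lemma edge_dil_quad D F F' K a b w l l' : quad D F F' K -> 0 < cross a b w -> 0 < l -> 0 < l' ->
  (forall s, 0 <= s <= 1 -> D (w + RtoC l * (seg a b s - w))%C) ->
  (forall s, 0 <= s <= 1 -> D (w + RtoC l' * (seg a b s - w))%C) ->
  Cmod (edge (dil F w l') a b w - edge (dil F w l) a b w -
      RtoC ((l' - l) / l) * (dil F w l b - dil F w l a)) <=
    K * ((Cmod (a - w) + Cmod (b - a)) * Cmod (b - a)) * ((l' - l) * (l' - l)).
Proof.
  intros hq hw hl hl' hD hD'.
  pose proof (quad_along D F F' K a b w l hq hD) as q.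
  pose proof (quad_along D F F' K a b w l' hq hD') as q'.
  pose proof (quadR_cont _ _ _ _ _ q) as c. pose proof (quadR_cont _ _ _ _ _ q') as c'.
  pose proof (quadR_cont' _ _ _ _ _ q) as d.
  assert (ft := quadR_FTC _ _ 0 1 _ ltac:(lra) q).
  cbv beta in ft. replace (seg a b 1) with b in ft by (unfold seg; ring).
  replace (seg a b 0) with a in ft by (unfold seg; ring). rewrite <- ft.
  rewrite <- cint_scal by (lra || easy). unfold edge.
  rewrite <- cint_sub by (lra || (apply (edge_cont a b); easy)).
  rewrite <- cint_sub; [|lra| |].
  2:{ apply ccont_sub; apply (edge_cont a b); easy. }
  2:{ apply ccont_mult; [apply ccont_const|exact d]. }
  eapply Rle_trans; [apply cint_norm with (M :=
    K * ((Cmod (a - w) + Cmod (b - a)) * Cmod (b - a)) * ((l' - l) * (l' - l)));[lra| |]|lra].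
  - apply ccont_sub; [apply ccont_sub; apply (edge_cont a b); easy|].
    apply ccont_mult; [apply ccont_const|exact d].
  - intros s hs. set (g := seg a b s).
    pose proof (seg_neq a b w s hw) as n. pose proof (seg_dist_pos a b w s hw) as p. fold g in n, p.
    unfold dil. set (z := (w + RtoC l * (g - w))%C). set (z' := (w + RtoC l' * (g - w))%C).
    assert (ez : (z' - z)%C = (RtoC (l' - l) * (g - w))%C).
    { unfold z, z'. rewrite RtoC_minus. ring. }
    replace (F z' * ker a b w s - F z * ker a b w s - RtoC ((l' - l) / l) * (RtoC l * (b - a) * F' z))%C
      with ((F z' - F z - (z' - z) * F' z) * ker a b w s)%C.
    2:{ rewrite ez. unfold ker. fold g. assert (RtoC l <> 0) by (intros e; apply RtoC_inj in e; lra).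
        unfold Rdiv. rewrite RtoC_mult, RtoC_inv by lra. field. easy. }
    rewrite Cmod_mult. destruct hq as [hK hq]. specialize (hq z z' (hD s hs) (hD' s hs)).
    rewrite ez, Cmod_mult, Cmod_R in hq.
    assert (ek : Cmod (ker a b w s) = Cmod (b - a) / Cmod (g - w)).
    { unfold ker. now rewrite Cmod_div. }
    rewrite ek, <- ez in *.
    assert (hg : Cmod (g - w) <= Cmod (a - w) + Cmod (b - a)).
    { unfold g, seg. replace (a + RtoC s * (b - a) - w)%C with ((a - w) + RtoC s * (b - a))%C by ring.
      eapply Rle_trans; [apply Cmod_triangle|]. rewrite Cmod_mult, Cmod_R, Rabs_right by lra.
      pose proof (Cmod_ge_0 (b - a)). nra. }
    pose proof (Cmod_ge_0 (b - a)) as pb.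
    apply Rle_trans with (K * (Rabs (l' - l) * Cmod (g - w) * (Rabs (l' - l) * Cmod (g - w))) *
       (Cmod (b - a) / Cmod (g - w))).
    { apply Rmult_le_compat_r; [now apply Rdiv_le_0_compat|exact hq]. }
    replace (K * (Rabs (l' - l) * Cmod (g - w) * (Rabs (l' - l) * Cmod (g - w))) *
       (Cmod (b - a) / Cmod (g - w))) with
      (K * (Cmod (g - w) * Cmod (b - a)) * (Rabs (l' - l) * Rabs (l' - l))) by (field; lra).
    rewrite Rabs_mul_self. apply Rmult_le_compat_r; [apply Rle_0_sqr|]. apply Rmult_le_compat_l; [easy|].
    now apply Rmult_le_compat_r.
Qed.

(** * Functions holomorphic off the real axis and their zeros *)

Definition box (r T : R) (z : C) : Prop := - r <= Re z <= r /\ 0 <= Im z <= T.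

(** The constants of the expansion may blow up towards the real axis, where continuity alone is
    asked: this is the regularity of a boundary value. *)
Record upper_fun (f : C -> C) (r T : R) : Prop := {
  uf_cont : forall z0, box r T z0 -> forall e, 0 < e -> exists d, 0 < d /\
    forall z, box r T z -> Cmod (z - z0) < d -> Cmod (f z - f z0) < e;
  uf_quad : forall m, 0 < m -> exists F' K, quad (fun z => box r T z /\ m <= Im z) f F' K }.

Lemma Cmod_le_Re_Im z : Cmod z <= Rabs (Re z) + Rabs (Im z).
Proof.
  destruct z as [x y]. replace (x, y) with (RtoC x + RtoC y * Ci)%C
    by (apply injective_projections; simpl; ring).
  eapply Rle_trans; [apply Cmod_triangle|]. rewrite Cmod_mult, 2 Cmod_R.
  rewrite Cmod_Ci. simpl; right; f_equal; [f_equal; ring|rewrite Rmult_1_r; f_equal; ring].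
Qed.

Lemma Re_sub_le z z' : Rabs (Re z - Re z') <= Cmod (z - z').
Proof. pose proof (re_le_Cmod (z - z')). destruct z, z'. simpl in *. unfold Rminus. lra. Qed.

Lemma Im_sub_le z z' : Rabs (Im z - Im z') <= Cmod (z - z').
Proof. pose proof (Im_le_Cmod (z - z')). destruct z, z'. simpl in *. unfold Rminus. lra. Qed.

Section UpperFun.
Variables (r T : R) (hr : 0 < r) (hR : r < T).

Lemma box_convex w z l T' : 0 <= l <= 1 -> box r T' w -> box r T' z -> box r T' (w + RtoC l * (z - w))%C.
Proof.
  intros hl [h1 h2] [h3 h4]. destruct w as [x y], z as [p q]. unfold box in *. simpl in *.
  replace (x + (l * (p + - x) - 0 * (q + - y))) with ((1 - l) * x + l * p) by ring.
  replace (y + (l * (q + - y) + 0 * (p + - x))) with ((1 - l) * y + l * q) by ring.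
  split; split; nra.
Qed.

Lemma box_seg a b s T' : 0 <= s <= 1 -> box r T' a -> box r T' b -> box r T' (seg a b s).
Proof. intros hs ha hb. unfold seg. now apply box_convex. Qed.

Lemma box_le T' z : T' <= T -> box r T' z -> box r T z.
Proof. unfold box. intros; lra. Qed.

Lemma uf_uniform f e : upper_fun f r T -> 0 < e -> exists d, 0 < d /\
  forall z z', box r T z -> box r T z' -> Cmod (z' - z) < d -> Cmod (f z' - f z) < e.
Proof.
  intros [hc _] he.
  (* Retraction onto the box. Precomposed with it, [f] is continuous on the whole plane, as
     [uniform_continuity_2d] requires near the edges. *)
  set (cl := fun x y : R => (clamp (- r) r x, clamp 0 T y) : C).
  assert (bx : forall x y, box r T (cl x y)).
  { intros x y. unfold cl, box; simpl. split; apply clamp_in; lra. }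
  assert (lip : forall x y x' y', Cmod (cl x' y' - cl x y) <= Rabs (x' - x) + Rabs (y' - y)).
  { intros x y x' y'. eapply Rle_trans; [apply Cmod_le_Re_Im|]. unfold cl; simpl.
    pose proof (clamp_lip (- r) r x' x). pose proof (clamp_lip 0 T y' y). unfold Rminus in *. lra. }
  assert (c2 : forall P : C -> R, (forall z z', Rabs (P z' - P z) <= Cmod (z' - z)) ->
     forall x y, continuity_2d_pt (fun x y => P (f (cl x y))) x y).
  { intros P hP x y eps. destruct (hc (cl x y) (bx x y) eps (cond_pos eps)) as [d [hd hs]].
    exists (mkposreal (d / 2) ltac:(lra)). simpl. intros x' y' h1 h2.
    apply Rle_lt_trans with (1 := hP _ _). apply hs; [apply bx|].
    pose proof (lip x y x' y'). lra. }
  assert (he2 : 0 < e / 2) by lra.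
  destruct (uniform_continuity_2d (fun x y => Re (f (cl x y))) (- r) r 0 T
    (fun x y _ _ => c2 Re (fun z z' => Re_sub_le z' z) x y) (mkposreal _ he2)) as [d1 h1].
  destruct (uniform_continuity_2d (fun x y => Im (f (cl x y))) (- r) r 0 T
    (fun x y _ _ => c2 Im (fun z z' => Im_sub_le z' z) x y) (mkposreal _ he2)) as [d2 h2].
  exists (Rmin d1 d2). split; [apply Rmin_glb_lt; apply cond_pos|].
  intros [x y] [x' y'] [b1 b2] [b3 b4] hd. simpl in *.
  assert (q1 := Rlt_le_trans _ _ _ hd (Rmin_l _ _)). assert (q2 := Rlt_le_trans _ _ _ hd (Rmin_r _ _)).
  pose proof (Re_sub_le (x', y') (x, y)) as p1. pose proof (Im_sub_le (x', y') (x, y)) as p2. simpl in p1, p2.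
  specialize (h1 x y x' y' b1 b2 b3 b4 ltac:(lra) ltac:(lra)).
  specialize (h2 x y x' y' b1 b2 b3 b4 ltac:(lra) ltac:(lra)).
  unfold cl in h1, h2. rewrite !clamp_id in h1, h2 by easy.
  eapply Rle_lt_trans; [apply Cmod_le_Re_Im|].
  destruct (f (x', y')), (f (x, y)). simpl in *. unfold Rminus in *. lra.
Qed.

Lemma uf_along f a b : upper_fun f r T -> box r T a -> box r T b -> along f a b.
Proof.
  intros hf ha hb. apply ccont_on_iff. intros t ht e he.
  destruct (uf_cont _ _ _ hf (seg a b t) (box_seg a b t T ht ha hb) e he) as [d [hd hs]].
  pose proof (Cmod_ge_0 (b - a)) as p.
  exists (d / (Cmod (b - a) + 1)). split; [apply Rdiv_lt_0_compat; lra|]. intros s hs1 hs2.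
  apply hs; [now apply box_seg|].
  replace (seg a b s - seg a b t)%C with (RtoC (s - t) * (b - a))%C by (rewrite RtoC_minus; unfold seg; ring).
  rewrite Cmod_mult, Cmod_R. pose proof (Rabs_pos (s - t)).
  rewrite Rmult_comm. apply (lt_absorb _ (Cmod (b - a))); lra.
Qed.

Lemma dil_seg f a b w l s :
  dil f w l (seg a b s) = f (seg (w + RtoC l * (a - w)) (w + RtoC l * (b - w)) s)%C.
Proof. unfold dil, seg. f_equal. ring. Qed.

Lemma uf_along_dil f a b w l : upper_fun f r T -> 0 <= l <= 1 -> box r T a -> box r T b -> box r T w ->
  along (dil f w l) a b.
Proof.
  intros hf hl ha hb hw. unfold along.
  apply (ccont_ext 0 1 (fun s => f (seg (w + RtoC l * (a - w)) (w + RtoC l * (b - w)) s)%C)).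
  { intros s _. symmetry. apply dil_seg. }
  apply uf_along; [easy| |]; now apply box_convex.
Qed.

Definition vshift (f : C -> C) (d : R) (z : C) : C := f (z + (0, d))%C.

Lemma box_vshift z d : 0 <= d <= T - r -> box r r z -> box r T (z + (0, d))%C.
Proof. intros hd [h1 h2]. destruct z; unfold box in *; simpl in *. lra. Qed.

Lemma vshift_quad f d : upper_fun f r T -> 0 < d <= T - r -> exists F' K, quad (box r r) (vshift f d) F' K.
Proof.
  intros hf hd. destruct (uf_quad _ _ _ hf d) as [F' [K [hK hq]]]; [easy|].
  exists (vshift F' d), K. split; [easy|]. intros z z' hz hz'. unfold vshift.
  specialize (hq (z + (0, d)) (z' + (0, d)))%C.
  replace (z' + (0, d) - (z + (0, d)))%C with (z' - z)%C in hq by ring.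
  apply hq; (split; [apply box_vshift; [lra|easy]|]).
  - destruct hz. destruct z; simpl in *. lra.
  - destruct hz'. destruct z'; simpl in *. lra.
Qed.

Lemma vshift_near f e : upper_fun f r T -> 0 < e -> exists d, 0 < d <= T - r /\
  forall z, box r r z -> Cmod (vshift f d z - f z) <= e.
Proof.
  intros hf he. destruct (uf_uniform f e hf he) as [d [hd hs]].
  set (d' := Rmin (d / 2) (T - r)). assert (0 < d') by (apply Rmin_glb_lt; lra).
  assert (d' <= d / 2) by apply Rmin_l. assert (d' <= T - r) by apply Rmin_r.
  exists d'. split; [easy|]. intros z hz. left. apply hs.
  - apply box_le with r; [lra|easy].
  - apply box_vshift; [lra|easy].
  - replace (z + (0, d') - z)%C with (RtoC d' * Ci)%C by (destruct z; apply injective_projections; simpl; ring).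
    rewrite Cmod_mult, Cmod_R, Rabs_right by lra.
    rewrite Cmod_Ci. lra.
Qed.

(** What the vertex [a] contributes to the [l]-derivative of the contracted Cauchy integral. Two
    consecutive edges contribute with opposite signs at their common vertex. *)
Definition vertex_rate (f : C -> C) (w a : C) (l : R) : C := (RtoC (/ l) * dil f w l a)%C.

Lemma ccont_inv l0 : 0 < l0 -> ccont_on l0 1 (fun l => RtoC (/ l)).
Proof.
  intros h. apply ccont_lip with (/ l0 * / l0). intros s t hs ht.
  rewrite <- RtoC_minus, Cmod_R. replace (/ s - / t) with (/ s * / t * (t - s)) by (field; lra).
  rewrite 2 Rabs_mult, (Rabs_minus_sym t s). apply Rmult_le_compat_r; [apply Rabs_pos|].
  rewrite 2 Rabs_right by (left; apply Rinv_0_lt_compat; lra).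
  apply Rmult_le_compat; try (left; apply Rinv_0_lt_compat; lra); apply Rinv_le_contravar; lra.
Qed.

Lemma vertex_rate_cont f w a l0 : upper_fun f r T -> box r T w -> box r T a -> 0 < l0 ->
  ccont_on l0 1 (vertex_rate f w a).
Proof.
  intros hf hw ha hl. apply ccont_mult; [now apply ccont_inv|].
  apply ccont_sub_int with 0 1; [lra|lra|]. exact (uf_along f w a hf hw ha).
Qed.

(* Differentiating the contour integral in the contraction ratio leaves boundary terms only;
   the shift [vshift] moves the contour into the open half-plane, where [f] is holomorphic. *)
Lemma edge_contract f a b w l0 : upper_fun f r T -> 0 < cross a b w ->
  box r r a -> box r r b -> box r r w -> 0 < l0 <= 1 ->
  (edge f a b w - edge (dil f w l0) a b w =
    cint (vertex_rate f w b) l0 1 - cint (vertex_rate f w a) l0 1)%C.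
Proof.
  intros hf hc ha hb hw hl.
  assert (ha' := box_le r a ltac:(lra) ha). assert (hb' := box_le r b ltac:(lra) hb).
  assert (hw' := box_le r w ltac:(lra) hw).
  set (B := Cmod (b - a) * Cmod (b - a) / cross a b w).
  set (X := (edge f a b w - edge (dil f w l0) a b w -
    (cint (vertex_rate f w b) l0 1 - cint (vertex_rate f w a) l0 1))%C).
  (* The identity is exact for the shifted function [F]. Passing from [f] to [F] costs at most [e]
     times a constant in each of the four terms. *)
  assert (hX : forall e, 0 < e -> Cmod X <= (2 * B + 2 / l0) * e).
  { intros e he. destruct (vshift_near f e hf he) as [d [hd near]].
    destruct (vshift_quad f d hf hd) as [F' [K hq]]. set (F := vshift f d) in *.
    set (K' := K * ((Cmod (a - w) + Cmod (b - a)) * Cmod (b - a))).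
    assert (qd : quadR (fun l => edge (dil F w l) a b w)
      (fun l => vertex_rate F w b l - vertex_rate F w a l)%C l0 1 K').
    { intros s t hs ht.
      assert (D : forall l, l0 <= l <= 1 -> forall p, 0 <= p <= 1 -> box r r (w + RtoC l * (seg a b p - w))%C).
      { intros l h p hp. apply box_convex; [lra|easy|]. now apply box_seg. }
      pose proof (edge_dil_quad _ F F' K a b w s t hq hc ltac:(lra) ltac:(lra) (D s hs) (D t ht)) as q.
      unfold vertex_rate.
      replace (RtoC (t - s) * (RtoC (/ s) * dil F w s b - RtoC (/ s) * dil F w s a))%C with
        (RtoC ((t - s) / s) * (dil F w s b - dil F w s a))%C by (unfold Rdiv; rewrite RtoC_mult; ring).
      exact q. }
    pose proof (quadR_FTC _ _ l0 1 _ (proj2 hl) qd) as ft. cbv beta in ft.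
    assert (cF : forall p q, box r r p -> box r r q -> along F p q).
    { intros p q hp hq'. unfold along.
      assert (z1 := quad_along _ F F' K p q p 1 hq).
      assert (z2 := quadR_cont _ _ _ _ _ (z1 ltac:(intros s hs; replace (p + 1 * (seg p q s - p))%C with (seg p q s) by ring; now apply box_seg))).
      eapply ccont_ext; [|exact z2]. intros s _. unfold dil. f_equal. ring. }
    assert (rc : forall p, box r r p -> ccont_on l0 1 (vertex_rate F w p)).
    { intros p hp. apply ccont_mult; [apply ccont_inv; lra|].
      apply ccont_sub_int with 0 1; [lra|lra|]. exact (cF w p hw hp). }
    rewrite cint_sub in ft by (lra || now apply rc).
    assert (dF : along (dil F w l0) a b).
    { unfold along.
      apply (ccont_ext 0 1 (fun s => F (seg (w + RtoC l0 * (a - w)) (w + RtoC l0 * (b - w)) s)%C)).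
      { intros s _. symmetry. apply dil_seg. }
      apply cF; apply box_convex; try easy; lra. }
    assert (dF1 : edge (dil F w 1) a b w = edge F a b w).
    { apply edge_ext. intros s _. unfold dil. f_equal. ring. }
    rewrite dF1 in ft.
    assert (e1 : Cmod (edge f a b w - edge F a b w) <= e * B).
    { rewrite <- edge_sub; [|easy|now apply uf_along|now apply cF].
      apply edge_bound; [easy|apply along_sub; [now apply uf_along|now apply cF]|].
      intros s hs. rewrite <- Cmod_opp.
      replace (- (f (seg a b s) - F (seg a b s)))%C with (F (seg a b s) - f (seg a b s))%C by ring.
      apply near. now apply box_seg. }
    assert (e2 : Cmod (edge (dil f w l0) a b w - edge (dil F w l0) a b w) <= e * B).
    { assert (along (dil f w l0) a b) by (apply uf_along_dil; try easy; lra).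
      rewrite <- edge_sub by easy.
      apply edge_bound; [easy|now apply along_sub|].
      intros s hs. rewrite <- Cmod_opp. unfold dil. set (z := (w + _)%C).
      replace (- (f z - F z))%C with (F z - f z)%C by ring.
      apply near. apply box_convex; [lra|easy|]. now apply box_seg. }
    assert (e3 : forall p, box r r p -> Cmod (cint (vertex_rate f w p) l0 1 - cint (vertex_rate F w p) l0 1) <= e / l0).
    { intros p hp. rewrite <- cint_sub; [|lra| |now apply rc].
      2:{ apply vertex_rate_cont; [easy|easy| |lra]. apply box_le with r; [lra|easy]. }
      eapply Rle_trans; [apply cint_norm with (M := e / l0); [lra| |]|].
      - apply ccont_sub; [|now apply rc]. apply vertex_rate_cont; [easy|easy| |lra].
        apply box_le with r; [lra|easy].
      - intros l hl'. unfold vertex_rate.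
        replace (RtoC (/ l) * dil f w l p - RtoC (/ l) * dil F w l p)%C with
          (- (RtoC (/ l) * (dil F w l p - dil f w l p)))%C by ring.
        rewrite Cmod_opp, Cmod_mult, Cmod_R, Rabs_right by (left; apply Rinv_0_lt_compat; lra).
        unfold Rdiv. rewrite Rmult_comm. apply Rmult_le_compat.
        + apply Cmod_ge_0.
        + left. apply Rinv_0_lt_compat. lra.
        + apply near. apply box_convex; [lra|easy|easy].
        + apply Rinv_le_contravar; lra.
      - assert (0 <= e / l0) by (apply Rdiv_le_0_compat; lra). nra. }
    specialize (e3 b hb) as e3b. specialize (e3 a ha) as e3a.
    replace X with ((edge f a b w - edge F a b w) - (edge (dil f w l0) a b w - edge (dil F w l0) a b w)
      - (cint (vertex_rate f w b) l0 1 - cint (vertex_rate F w b) l0 1)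
      + (cint (vertex_rate f w a) l0 1 - cint (vertex_rate F w a) l0 1))%C.
    2:{ unfold X.
        replace (edge F a b w) with (edge (dil F w l0) a b w +
          (cint (vertex_rate F w b) l0 1 - cint (vertex_rate F w a) l0 1))%C by (rewrite ft; ring). ring. }
    eapply Rle_trans; [apply Cmod_triangle|].
    unfold Cminus at 1. eapply Rle_trans; [apply Rplus_le_compat_r, Cmod_triangle|].
    unfold Cminus at 1. eapply Rle_trans; [apply Rplus_le_compat_r, Rplus_le_compat_r, Cmod_triangle|].
    rewrite 2 Cmod_opp. replace ((2 * B + 2 / l0) * e) with (e * B + e * B + e / l0 + e / l0) by (field; lra).
    lra. }
  assert (pB : 0 <= B).
  { apply Rdiv_le_0_compat; [|easy]. pose proof (Cmod_ge_0 (b - a)). nra. }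
  assert (pl : 0 < 2 / l0) by (apply Rdiv_lt_0_compat; lra).
  assert (z : X = 0).
  { apply Cmod_eq_0. apply Rle_antisym; [|apply Cmod_ge_0]. apply le_epsilon. intros e he.
    set (Q := 2 * B + 2 / l0) in *. assert (pQ : 0 < Q) by (unfold Q; lra).
    specialize (hX (e / Q) (Rdiv_lt_0_compat _ _ he pQ)).
    replace (Q * (e / Q)) with e in hX by (field; lra). lra. }
  unfold X in z.
  replace (edge f a b w - edge (dil f w l0) a b w)%C with
    ((edge f a b w - edge (dil f w l0) a b w - (cint (vertex_rate f w b) l0 1 - cint (vertex_rate f w a) l0 1)) +
     (cint (vertex_rate f w b) l0 1 - cint (vertex_rate f w a) l0 1))%C by ring.
  rewrite z. ring.
Qed.

Lemma edge_scal F c a b w : 0 < cross a b w -> along F a b ->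
  edge (fun z => c * F z)%C a b w = (c * edge F a b w)%C.
Proof.
  intros h hF. unfold edge. rewrite <- cint_scal by (lra || now apply edge_cont).
  apply cint_ext; [lra|]. intros; ring.
Qed.

Lemma edge_contract_limit f a b w e : upper_fun f r T -> 0 < cross a b w ->
  box r r a -> box r r b -> box r r w -> 0 < e ->
  exists l, 0 < l <= 1 /\ forall l0, 0 < l0 <= l ->
    Cmod (edge (dil f w l0) a b w - f w * edge (fun _ => 1) a b w) <= e.
Proof.
  intros hf hc ha hb hw he.
  assert (ha' := box_le r a ltac:(lra) ha). assert (hb' := box_le r b ltac:(lra) hb).
  assert (hw' := box_le r w ltac:(lra) hw).
  set (B := Cmod (b - a) * Cmod (b - a) / cross a b w).
  assert (pB : 0 <= B).
  { apply Rdiv_le_0_compat; [|easy]. pose proof (Cmod_ge_0 (b - a)). nra. }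
  destruct (uf_cont _ _ _ hf w hw' (e / (B + 1))) as [d [hd hs]]; [apply Rdiv_lt_0_compat; lra|].
  set (D := Cmod (a - w) + Cmod (b - a) + 1).
  assert (pD : 1 <= D) by (unfold D; pose proof (Cmod_ge_0 (a - w)); pose proof (Cmod_ge_0 (b - a)); lra).
  set (l := Rmin 1 (d / (2 * D))).
  assert (hl : 0 < l) by (apply Rmin_glb_lt; [lra|apply Rdiv_lt_0_compat; lra]).
  exists l. split; [split; [easy|apply Rmin_l]|]. intros l0 hl0.
  assert (hl1 : l0 <= 1) by (pose proof (Rmin_l 1 (d / (2 * D))); fold l in H; lra).
  assert (hl2 : l0 <= d / (2 * D)) by (pose proof (Rmin_r 1 (d / (2 * D))); fold l in H; lra).
  assert (al : along (dil f w l0) a b) by (apply uf_along_dil; try easy; lra).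
  rewrite <- (edge_scal (fun _ => 1)) by (easy || apply along_const).
  rewrite <- edge_sub; [|easy|easy|apply (along_const a b (f w * 1)%C)].
  eapply Rle_trans; [apply edge_bound with (M := e / (B + 1)); [easy| |]|].
  - apply along_sub; [easy|apply (along_const a b (f w * 1)%C)].
  - intros s h. rewrite Cmult_1_r. unfold dil. left. apply hs.
    + apply box_convex; [lra|easy|]. now apply box_seg.
    + replace (w + RtoC l0 * (seg a b s - w) - w)%C with (RtoC l0 * ((a - w) + RtoC s * (b - a)))%C
        by (unfold seg; ring).
      rewrite Cmod_mult, Cmod_R, Rabs_right by lra.
      assert (Cmod ((a - w) + RtoC s * (b - a)) <= D).
      { eapply Rle_trans; [apply Cmod_triangle|]. rewrite Cmod_mult, Cmod_R, Rabs_right by lra.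
        pose proof (Cmod_ge_0 (b - a)). unfold D. nra. }
      apply Rle_lt_trans with (d / (2 * D) * D).
      { apply Rmult_le_compat; [lra|apply Cmod_ge_0|easy|easy]. }
      replace (d / (2 * D) * D) with (d / 2) by (field; lra). lra.
  - fold B. apply (Rmult_le_reg_r (B + 1)); [lra|].
    replace (e / (B + 1) * B * (B + 1)) with (e * B) by (field; lra). nra.
Qed.

End UpperFun.

(** * Cauchy's formula on the diamond with vertices [r], [i r], [- r], [- i r], and Newton
    interpolation at real zeros *)

Definition Jint (r : R) (f : C -> C) (w : C) : C := (edge f (r, 0) (0, r) w + edge f (0, r) (- r, 0)%R w)%C.

Definition inside (r : R) (w : C) : Prop := Rabs (Re w) + Im w < r.

Definition alongJ (r : R) (f : C -> C) : Prop := along f (r, 0) (0, r) /\ along f (0, r) (- r, 0)%R.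

Definition on_path (r : R) (z : C) : Prop :=
  exists s, 0 <= s <= 1 /\ (z = seg (r, 0) (0, r) s \/ z = seg (0, r) (- r, 0)%R s).

Section Path.
Variable r : R.
Hypothesis hr : 0 < r.

Lemma cross_right w : cross (r, 0) (0, r) w = r * (r - Re w - Im w).
Proof. unfold cross. destruct w; simpl. ring. Qed.

Lemma cross_left w : cross (0, r) (- r, 0)%R w = r * (r + Re w - Im w).
Proof. unfold cross. destruct w; simpl. ring. Qed.

Lemma inside_cross w : inside r w -> 0 < cross (r, 0) (0, r) w /\ 0 < cross (0, r) (- r, 0)%R w.
Proof.
  unfold inside. intros h. rewrite cross_right, cross_left.
  unfold Rabs in h. destruct Rcase_abs; split; apply Rmult_lt_0_compat; lra.
Qed.

Lemma inside_real c : Rabs c < r -> inside r (RtoC c).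
Proof. unfold inside; simpl. lra. Qed.

Lemma path_step2 : Cmod ((0, r) - (r, 0)) * Cmod ((0, r) - (r, 0)) = 2 * (r * r) /\
  Cmod ((- r, 0)%R - (0, r)) * Cmod ((- r, 0)%R - (0, r)) = 2 * (r * r).
Proof.
  pose proof (Cmod2_alt ((0, r) - (r, 0))) as e1. pose proof (Cmod2_alt ((- r, 0)%R - (0, r))) as e2.
  simpl in *. lra.
Qed.

(** The distance from [c] to the nearer edge line is [(r - |c|) / sqrt 2], at least
    [r / (2 sqrt 2)], rounded down to [r / 3]. *)
Lemma on_path_dist z c : on_path r z -> Rabs c <= r / 2 -> r / 3 <= Cmod (z - RtoC c).
Proof.
  intros [s [hs h]] hc. destruct path_step2 as [p1 p2].
  assert (hc' : c <= r / 2 /\ - (r / 2) <= c) by (unfold Rabs in hc; destruct Rcase_abs; lra).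
  assert (aux : forall L d, 0 <= L -> 0 <= d -> L * L = 2 * (r * r) -> r * (r / 2) <= L * d -> r / 3 <= d).
  { intros L d h1 h2 h3 h4. apply Rnot_lt_le. intros n.
    assert (L <= 3 / 2 * r) by (apply Rsqr_incr_0_var; unfold Rsqr; nra). nra. }
  destruct h as [-> | ->].
  - pose proof (seg_dist (r, 0) (0, r) (RtoC c) s) as q. rewrite cross_right in q. simpl Re in q. simpl Im in q.
    apply (aux (Cmod ((0, r) - (r, 0)))); try apply Cmod_ge_0; [easy|]. nra.
  - pose proof (seg_dist (0, r) (- r, 0)%R (RtoC c) s) as q. rewrite cross_left in q. simpl Re in q. simpl Im in q.
    apply (aux (Cmod ((- r, 0)%R - (0, r)))); try apply Cmod_ge_0; [easy|]. nra.
Qed.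

Lemma on_path_neq z c : on_path r z -> Rabs c <= r / 2 -> (z - RtoC c)%C <> 0.
Proof. intros h1 h2. apply Cmod_gt_0. pose proof (on_path_dist z c h1 h2). lra. Qed.

(** Each edge has squared length [2 r^2] and [cross] at least [r^2 / 2], hence contributes at most
    [4 M]. *)
Lemma Jint_bound f w M : inside r w -> Rabs (Re w) + Im w <= r / 2 -> alongJ r f ->
  (forall z, on_path r z -> Cmod (f z) <= M) -> Cmod (Jint r f w) <= 8 * M.
Proof.
  intros hi hw [a1 a2] hM. destruct (inside_cross w hi) as [c1 c2]. destruct path_step2 as [p1 p2].
  assert (hM0 : 0 <= M).
  { eapply Rle_trans; [apply Cmod_ge_0|]. apply (hM (seg (r, 0) (0, r) 0)). exists 0. split; [lra|auto]. }
  unfold Jint. eapply Rle_trans; [apply Cmod_triangle|].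
  assert (q1 := edge_bound _ _ f w M c1 a1 ltac:(intros s hs; apply hM; exists s; auto)).
  assert (q2 := edge_bound _ _ f w M c2 a2 ltac:(intros s hs; apply hM; exists s; auto)).
  rewrite p1, cross_right in q1. rewrite p2, cross_left in q2.
  assert (aux : forall x, r / 2 <= x -> M * (2 * (r * r) / (r * x)) <= 4 * M).
  { intros x hx. rewrite Rmult_comm. apply Rmult_le_compat_r; [easy|].
    apply (Rmult_le_reg_r x); [lra|]. replace (2 * (r * r) / (r * x) * x) with (2 * r) by (field; lra). lra. }
  assert (h : r / 2 <= r - Re w - Im w /\ r / 2 <= r + Re w - Im w).
  { unfold Rabs in hw; destruct Rcase_abs; split; lra. }
  pose proof (aux _ (proj1 h)). pose proof (aux _ (proj2 h)). lra.
Qed.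

Lemma Jint_rec f c w : inside r w -> inside r (RtoC c) -> (w - RtoC c)%C <> 0 -> alongJ r f ->
  (Jint r (fun z => f z / (z - RtoC c)) w * (w - RtoC c) = Jint r f w - Jint r f (RtoC c))%C.
Proof.
  intros hw hc n [a1 a2]. destruct (inside_cross w hw) as [w1 w2]. destruct (inside_cross _ hc) as [c1 c2].
  unfold Jint. rewrite Cmult_plus_distr_r, 2 edge_rec by easy. ring.
Qed.

Lemma Jint_one_Im w : inside r w -> 0 < Im (Jint r (fun _ => 1) w).
Proof.
  intros hw. destruct (inside_cross w hw) as [w1 w2]. unfold Jint.
  pose proof (edge_one_Im _ _ w w1) as p. pose proof (edge_one_Im _ _ w w2) as q.
  set (x := edge _ _ _ _) in *. clearbody x. set (y := edge _ _ _ _) in *. clearbody y.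
  destruct x, y. simpl in *. lra.
Qed.

Fixpoint divs (f : C -> C) (cs : list R) : C -> C :=
  match cs with nil => f | cons c l => fun z => (divs f l z / (z - RtoC c))%C end.

Fixpoint nodes (cs : list R) (w : C) : C :=
  match cs with nil => 1 | cons c l => ((w - RtoC c) * nodes l w)%C end.

Lemma divs_along f cs : alongJ r f -> (forall c, In c cs -> Rabs c < r) -> alongJ r (divs f cs).
Proof.
  intros hf. induction cs as [|c l IH]; intros h; [easy|].
  destruct (IH ltac:(intros; apply h; now right)) as [a1 a2].
  destruct (inside_cross (RtoC c)) as [c1 c2]; [apply inside_real, h; now left|].
  split; now apply along_div.
Qed.

Lemma divs_bound f cs M z : on_path r z -> (forall c, In c cs -> Rabs c <= r / 2) -> Cmod (f z) <= M ->
  Cmod (divs f cs z) <= M * (3 / r) ^ (length cs).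
Proof.
  intros hz. induction cs as [|c l IH]; intros h hM; simpl; [lra|].
  specialize (IH ltac:(intros; apply h; now right) hM).
  assert (hc : Rabs c <= r / 2) by (apply h; now left).
  rewrite Cmod_div by now apply on_path_neq. unfold Rdiv at 1.
  pose proof (on_path_dist z c hz hc) as d. pose proof (Cmod_ge_0 (divs f l z)).
  assert (/ Cmod (z - RtoC c) <= 3 / r).
  { replace (3 / r) with (/ (r / 3)) by (field; lra). apply Rinv_le_contravar; lra. }
  replace (M * (3 / r * (3 / r) ^ length l)) with (M * (3 / r) ^ length l * (3 / r)) by ring.
  apply Rmult_le_compat; auto. left. apply Rinv_0_lt_compat. lra.
Qed.

Lemma nodes_bound cs w k : (forall c, In c cs -> Cmod (w - RtoC c) <= k) -> Cmod (nodes cs w) <= k ^ length cs.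
Proof.
  induction cs as [|c l IH]; intros h; simpl; [rewrite Cmod_1; lra|].
  rewrite Cmod_mult. apply Rmult_le_compat; try apply Cmod_ge_0; [apply h; now left|].
  apply IH. intros; apply h; now right.
Qed.

Lemma nodes_neq0 cs w : (forall c, In c cs -> (w - RtoC c)%C <> 0) -> nodes cs w <> 0.
Proof.
  induction cs as [|c l IH]; intros h; simpl.
  - intros e. apply RtoC_inj in e. lra.
  - apply Cmult_neq_0; [apply h; now left|apply IH; intros; apply h; now right].
Qed.

(* Newton interpolation at real nodes: [L l] is to be a functional of [f / nodes l]. *)
Lemma newton_chain (A : C -> Prop) (L : list R -> C -> C) (cs : list R) :
  (forall c, Rabs c <= r / 2 -> A (RtoC c)) ->
  (forall c l w, A w -> (forall d, In d (c :: l) -> Rabs d <= r / 2) -> (w - RtoC c)%C <> 0 ->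
     (L (c :: l) w * (w - RtoC c) = L l w - L l (RtoC c))%C) ->
  NoDup cs -> (forall c, In c cs -> Rabs c <= r / 2 /\ L nil (RtoC c) = 0) ->
  forall w, A w -> (forall c, In c cs -> (w - RtoC c)%C <> 0) -> (L cs w * nodes cs w = L nil w)%C.
Proof.
  intros hA rec. induction cs as [|c l IH]; intros hnd hz w hw hn; simpl nodes; [ring|].
  inversion_clear hnd as [|? ? nin hnd'].
  specialize (IH hnd' ltac:(intros; apply hz; now right)).
  (* The induction hypothesis at the new node itself: [L l c] times a nonzero product of differences
     is [L nil c = 0]. Here distinctness of the nodes is used. *)
  assert (e0 : L l (RtoC c) = 0).
  { assert (ne : forall d, In d l -> (RtoC c - RtoC d)%C <> 0).
    { intros d hd e. apply nin. replace c with d; [easy|]. rewrite <- RtoC_minus in e. apply RtoC_inj in e. lra. }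
    pose proof (IH (RtoC c) (hA c (proj1 (hz c (or_introl eq_refl)))) ne) as q.
    rewrite (proj2 (hz c (or_introl eq_refl))) in q.
    assert (n := nodes_neq0 l _ ne).
    replace (L l (RtoC c)) with ((L l (RtoC c) * nodes l (RtoC c)) / nodes l (RtoC c))%C by (field; easy).
    rewrite q. field. easy. }
  rewrite Cmult_assoc, rec, e0; [|easy|intros; now apply hz|apply hn; now left].
  rewrite <- (IH w hw) by (intros; apply hn; now right). ring.
Qed.

(** At real [w], the Cauchy integral over the whole diamond of the function given by [f] above and
    by [conj (g (conj z))] below. Conjugation carries the upper edges to the lower ones and reverses
    their orientation, whence the minus sign. *)
Definition Jdiff (f g : C -> C) (w : C) : C := (Jint r f w - Cconj (Jint r g w))%C.

Lemma Jdiff_bound f g c M : Rabs c <= r / 2 -> alongJ r f -> alongJ r g ->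
  (forall z, on_path r z -> Cmod (f z) <= M) -> (forall z, on_path r z -> Cmod (g z) <= M) ->
  Cmod (Jdiff f g (RtoC c)) <= 16 * M.
Proof.
  intros hc hf hg hf' hg'. assert (hi : inside r (RtoC c)) by (apply inside_real; lra).
  assert (hw : Rabs (Re (RtoC c)) + Im (RtoC c) <= r / 2) by (simpl; lra).
  unfold Jdiff, Cminus. eapply Rle_trans; [apply Cmod_triangle|]. rewrite Cmod_opp, Cmod_conj.
  pose proof (Jint_bound f _ M hi hw hf hf'). pose proof (Jint_bound g _ M hi hw hg hg'). lra.
Qed.

Lemma Jdiff_newton f g cs x : alongJ r f -> alongJ r g -> NoDup cs ->
  (forall c, In c cs -> Rabs c <= r / 2 /\ Jdiff f g (RtoC c) = 0) ->
  Rabs x <= r / 2 -> ~ In x cs ->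
  (Jdiff (divs f cs) (divs g cs) (RtoC x) * nodes cs (RtoC x) = Jdiff f g (RtoC x))%C.
Proof.
  intros hf hg hnd hz hx nin.
  apply (newton_chain (fun w => exists y, Rabs y <= r / 2 /\ w = RtoC y)
    (fun l w => Jdiff (divs f l) (divs g l) w) cs); [eauto| |easy|easy|eauto|].
  - intros c l w [y [hy ->]] hl n. unfold Jdiff. simpl divs.
    assert (hc : Rabs c <= r / 2) by (apply hl; now left).
    assert (hl' : forall d, In d l -> Rabs d < r) by (intros d hd; specialize (hl d (or_intror hd)); lra).
    pose proof (Jint_rec (divs f l) c (RtoC y) ltac:(apply inside_real; lra) ltac:(apply inside_real; lra)
      n (divs_along f l hf hl')) as q1.
    pose proof (Jint_rec (divs g l) c (RtoC y) ltac:(apply inside_real; lra) ltac:(apply inside_real; lra)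
      n (divs_along g l hg hl')) as q2.
    apply (f_equal Cconj) in q2. rewrite Cmult_conj, !Cminus_conj in q2.
    assert (ec : forall t, Cconj (RtoC t) = RtoC t) by (intros; apply injective_projections; simpl; ring).
    rewrite !ec in q2.
    set (u := Jint r (fun z => (divs f l z / (z - RtoC c))%C) (RtoC y)) in *.
    set (v := Cconj (Jint r (fun z => (divs g l z / (z - RtoC c))%C) (RtoC y))) in *.
    replace ((u - v) * (RtoC y - RtoC c))%C with (u * (RtoC y - RtoC c) - v * (RtoC y - RtoC c))%C by ring.
    rewrite q1, q2. ring.
  - intros c hc e. apply nin. rewrite <- RtoC_minus in e. apply RtoC_inj in e.
    now replace x with c by lra.
Qed.

Lemma Jint_newton f cs w : alongJ r f -> NoDup cs ->
  (forall c, In c cs -> Rabs c <= r / 2 /\ Jint r f (RtoC c) = 0) ->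
  inside r w -> Im w <> 0 -> (Jint r (divs f cs) w * nodes cs w = Jint r f w)%C.
Proof.
  intros hf hnd hz hw hi.
  apply (newton_chain (inside r) (fun l w => Jint r (divs f l) w) cs); try easy.
  - intros c hc. apply inside_real. lra.
  - intros c l v hv hl n. simpl divs. apply Jint_rec; try easy.
    + apply inside_real. specialize (hl c (or_introl eq_refl)). lra.
    + apply divs_along; [easy|]. intros d hd. specialize (hl d (or_intror hd)). lra.
  - intros c _ e. apply hi. apply (f_equal Im) in e. destruct w; simpl in *. lra.
Qed.

Variable T : R.
Hypothesis hT : r < T.

Lemma box_vertices : box r r (r, 0) /\ box r r (0, r) /\ box r r (- r, 0)%R.
Proof. unfold box; simpl. lra. Qed.

Lemma uf_alongJ f : upper_fun f r T -> alongJ r f.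
Proof.
  intros hf. destruct box_vertices as [b1 [b2 b3]].
  split; apply (uf_along r T); auto; apply (box_le r T r); auto; lra.
Qed.

Lemma Cconj_RtoC t : Cconj (RtoC t) = RtoC t.
Proof. apply injective_projections; simpl; ring. Qed.

Lemma cint_conj k a b : a <= b -> ccont_on a b k -> cint (fun t => Cconj (k t)) a b = Cconj (cint k a b).
Proof.
  intros hab hk. apply (hint_linear (H:=CH) (H':=CH) Cconj 1); auto. split.
  - intros x y. apply Cplus_conj.
  - intros q x. rewrite (csc_CH (RtoC q) x), (csc_CH (RtoC q) (Cconj x)).
    etransitivity; [apply Cmult_conj|]. now rewrite Cconj_RtoC.
  - intros x. rewrite (hnorm_CH x), (hnorm_CH (Cconj x)), Cmod_conj. lra.
Qed.

(* Cauchy's formula for the function equal to [f] above and to [conj (g (conj z))] below the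
   real axis, which need only be continuous across it. *)
Lemma Jdiff_cauchy f g x : upper_fun f r T -> upper_fun g r T ->
  (forall t, - r <= t <= r -> f (RtoC t) = Cconj (g (RtoC t))) -> Rabs x < r ->
  Jdiff f g (RtoC x) = (f (RtoC x) * Jdiff (fun _ => 1) (fun _ => 1) (RtoC x))%C.
Proof.
  intros hf hg hfg hx. set (w := RtoC x).
  assert (hx' : - r <= x <= r) by (unfold Rabs in hx; destruct Rcase_abs; lra).
  assert (bw : box r r w) by (unfold box, w; simpl; lra).
  destruct box_vertices as [b1 [b2 b3]].
  destruct (inside_cross w (inside_real x hx)) as [c1 c2].
  assert (ec : forall h l, upper_fun h r T -> 0 < l <= 1 ->
     (Jint r h w - Jint r (dil h w l) w =
       cint (vertex_rate h w (- r, 0)%R) l 1 - cint (vertex_rate h w (r, 0)) l 1)%C).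
  { intros h l hh hl. unfold Jint.
    pose proof (edge_contract r T hr hT h _ _ w l hh c1 b1 b2 bw hl) as q1.
    pose proof (edge_contract r T hr hT h _ _ w l hh c2 b2 b3 bw hl) as q2.
    set (p1 := edge h (r, 0) (0, r) w) in *. set (p2 := edge h (0, r) (- r, 0)%R w) in *.
    set (p3 := edge (dil h w l) (r, 0) (0, r) w) in *. set (p4 := edge (dil h w l) (0, r) (- r, 0)%R w) in *.
    replace (p1 + p2 - (p3 + p4))%C with ((p1 - p3) + (p2 - p4))%C by ring. rewrite q1, q2. ring. }
  (* Contraction towards the real point [w] keeps the vertices [r] and [- r] on the real axis, where
     [f] and [conj g] agree. Their contributions therefore cancel in [Jdiff], which does not change
     under contraction. *)
  assert (vc : forall y l, 0 < l <= 1 -> - r <= y <= r ->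
     cint (vertex_rate f w (RtoC y)) l 1 = Cconj (cint (vertex_rate g w (RtoC y)) l 1)).
  { intros y l hl hy. assert (by' : box r r (RtoC y)) by (unfold box; simpl; lra).
    rewrite <- cint_conj; [|lra|].
    - apply cint_ext; [lra|]. intros p hp. unfold vertex_rate, dil.
      replace (w + RtoC p * (RtoC y - w))%C with (RtoC (x + p * (y - x)))
        by (unfold w; rewrite RtoC_plus, RtoC_mult, RtoC_minus; ring).
      rewrite Cmult_conj, Cconj_RtoC, hfg; [easy|]. nra.
    - apply (vertex_rate_cont r T); try lra; [easy| |]; apply (box_le r T r); easy || lra. }
  assert (inv : forall l, 0 < l <= 1 -> Jdiff f g w = Jdiff (dil f w l) (dil g w l) w).
  { intros l hl. unfold Jdiff.
    assert (e1 := ec f l hf hl). assert (e2 := ec g l hg hl).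
    change ((- r, 0)%R) with (RtoC (- r)) in e1, e2. change ((r, 0)) with (RtoC r) in e1, e2.
    rewrite (vc (- r) l hl), (vc r l hl), <- Cminus_conj, <- e2, Cminus_conj in e1 by lra.
    replace (Jint r f w) with ((Jint r f w - Jint r (dil f w l) w) + Jint r (dil f w l) w)%C by ring.
    rewrite e1. ring. }
  set (Y := (f w * Jdiff (fun _ => 1) (fun _ => 1) w)%C).
  assert (hY : Y = (f w * Jint r (fun _ => 1) w - Cconj (g w * Jint r (fun _ => 1) w))%C).
  { assert (hfw : f w = Cconj (g w)) by exact (hfg x hx').
    unfold Y, Jdiff. rewrite Cmult_conj, <- hfw. ring. }
  assert (hlim : forall h e, upper_fun h r T -> 0 < e -> exists l, 0 < l <= 1 /\ forall l0, 0 < l0 <= l ->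
     Cmod (Jint r (dil h w l0) w - h w * Jint r (fun _ => 1) w) <= 2 * e).
  { intros h e hh he.
    destruct (edge_contract_limit r T hT h _ _ w e hh c1 b1 b2 bw he) as [l1 [hl1 q1]].
    destruct (edge_contract_limit r T hT h _ _ w e hh c2 b2 b3 bw he) as [l2 [hl2 q2]].
    exists (Rmin l1 l2). split; [split; [now apply Rmin_glb_lt|]|].
    - apply Rle_trans with l1; [apply Rmin_l|lra].
    - intros l0 hl0. specialize (q1 l0 ltac:(pose proof (Rmin_l l1 l2); lra)).
      specialize (q2 l0 ltac:(pose proof (Rmin_r l1 l2); lra)).
      unfold Jint. match goal with |- Cmod ?z <= _ => replace z with
        ((edge (dil h w l0) (r, 0) (0, r) w - h w * edge (fun _ => 1) (r, 0) (0, r) w) +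
         (edge (dil h w l0) (0, r) (- r, 0)%R w - h w * edge (fun _ => 1) (0, r) (- r, 0)%R w))%C by ring end.
      eapply Rle_trans; [apply Cmod_triangle|]. lra. }
  assert (z : (Jdiff f g w - Y)%C = 0).
  { apply Cmod_eq_0. apply Rle_antisym; [|apply Cmod_ge_0]. apply le_epsilon. intros e he.
    destruct (hlim f (e / 4) hf) as [l1 [hl1 q1]]; [lra|]. destruct (hlim g (e / 4) hg) as [l2 [hl2 q2]]; [lra|].
    set (l := Rmin l1 l2). assert (h0 : 0 < l) by now apply Rmin_glb_lt.
    assert (l <= l1) by apply Rmin_l. assert (l <= l2) by apply Rmin_r.
    specialize (q1 l ltac:(lra)). specialize (q2 l ltac:(lra)).
    rewrite (inv l ltac:(lra)), hY. unfold Jdiff.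
    rewrite <- Cmod_conj in q2. rewrite Cminus_conj in q2.
    match goal with |- Cmod ?z <= _ => replace z with
      ((Jint r (dil f w l) w - f w * Jint r (fun _ => 1) w) -
       (Cconj (Jint r (dil g w l) w) - Cconj (g w * Jint r (fun _ => 1) w)))%C by ring end.
    unfold Cminus at 1. eapply Rle_trans; [apply Cmod_triangle|]. rewrite Cmod_opp. lra. }
  replace (Jdiff f g w) with ((Jdiff f g w - Y) + Y)%C by ring. rewrite z. unfold Y. ring.
Qed.

Lemma Jdiff_one_neq0 x : Rabs x < r -> Jdiff (fun _ => 1) (fun _ => 1) (RtoC x) <> 0.
Proof.
  intros hx e. pose proof (Jint_one_Im _ (inside_real x hx)) as p.
  apply (f_equal Im) in e. unfold Jdiff in e. destruct (Jint r (fun _ => 1) (RtoC x)). simpl in *. lra.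
Qed.

(** Dividing by the [n] factors [z - c] costs at most [(3/r)^n] on the contour, while their product
    at [x] is at most [(r/12)^n]. Each zero gains a factor [1/4]. *)
Lemma zero_estimate f g M cs x : upper_fun f r T -> upper_fun g r T ->
  (forall t, - r <= t <= r -> f (RtoC t) = Cconj (g (RtoC t))) ->
  (forall z, on_path r z -> Cmod (f z) <= M) -> (forall z, on_path r z -> Cmod (g z) <= M) ->
  NoDup cs -> (forall c, In c cs -> Rabs c <= r / 24 /\ f (RtoC c) = 0) -> Rabs x <= r / 24 ->
  Cmod (f (RtoC x)) * Cmod (Jdiff (fun _ => 1) (fun _ => 1) (RtoC x)) <= 16 * M * (1 / 4) ^ length cs.
Proof.
  intros hf hg hfg hMf hMg hnd hz hx.
  assert (hM : 0 <= M).
  { eapply Rle_trans; [apply Cmod_ge_0|]. apply (hMf (seg (r, 0) (0, r) 0)). exists 0. split; [lra|auto]. }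
  assert (pp : forall n, 0 <= (1 / 4) ^ n) by (intros; apply pow_le; lra).
  destruct (classic (In x cs)) as [hin|nin].
  { rewrite (proj2 (hz x hin)), Cmod_0, Rmult_0_l. specialize (pp (length cs)). nra. }
  rewrite <- Cmod_mult, <- (Jdiff_cauchy f g x) by (easy || lra).
  rewrite <- (Jdiff_newton f g cs x); try easy; try now apply uf_alongJ.
  2:{ intros c hc. destruct (hz c hc) as [h1 h2]. split; [lra|].
      rewrite Jdiff_cauchy by (easy || lra). rewrite h2. ring. }
  2: lra.
  rewrite Cmod_mult.
  assert (hr2 : forall c, In c cs -> Rabs c <= r / 2) by (intros c hc; destruct (hz c hc); lra).
  assert (q1 : Cmod (Jdiff (divs f cs) (divs g cs) (RtoC x)) <= 16 * (M * (3 / r) ^ length cs)).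
  { apply Jdiff_bound; [lra| | | |].
    - apply divs_along; [now apply uf_alongJ|]. intros c hc. specialize (hr2 c hc). lra.
    - apply divs_along; [now apply uf_alongJ|]. intros c hc. specialize (hr2 c hc). lra.
    - intros z hz'. apply divs_bound; auto.
    - intros z hz'. apply divs_bound; auto. }
  assert (q2 : Cmod (nodes cs (RtoC x)) <= (r / 12) ^ length cs).
  { apply nodes_bound. intros c hc. destruct (hz c hc) as [h1 _]. rewrite <- RtoC_minus, Cmod_R.
    unfold Rabs in *. repeat destruct Rcase_abs; lra. }
  replace (16 * M * (1 / 4) ^ length cs) with (16 * (M * (3 / r) ^ length cs) * (r / 12) ^ length cs).
  - apply Rmult_le_compat; auto; apply Cmod_ge_0.
  - rewrite !Rmult_assoc, <- Rpow_mult_distr. do 3 f_equal. field. lra.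
Qed.

(* As [f] vanishes on the edge [-r, r], Cauchy's formula for the triangle with vertices
   [r, i r, - r] reads [f w * W1 = Jint r f w], with [Im W1 > 0]. *)
Lemma triangle_cauchy f w : upper_fun f r T -> (forall t, - r <= t <= r -> f (RtoC t) = 0) ->
  inside r w -> 0 < Im w -> Jint r f w = 0 -> f w = 0.
Proof.
  intros hf h0 hw hi hJ. destruct box_vertices as [b1 [b2 b3]].
  destruct (inside_cross w hw) as [c1 c2].
  assert (c3 : 0 < cross (- r, 0)%R (r, 0) w).
  { replace (cross (- r, 0)%R (r, 0) w) with (2 * r * Im w) by (unfold cross; destruct w; simpl; ring). nra. }
  assert (bw : box r r w).
  { unfold inside, box in *. unfold Rabs in hw. destruct Rcase_abs; lra. }
  assert (base : edge f (- r, 0)%R (r, 0) w = 0).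
  { rewrite (edge_ext _ _ f (fun _ => RtoC 0 * 0)%C w).
    - rewrite edge_scal; [ring|easy|apply along_const].
    - intros s hs. replace (seg (- r, 0)%R (r, 0) s) with (RtoC (- r + s * (2 * r)))
        by (unfold seg; apply injective_projections; simpl; ring).
      rewrite h0; [ring|nra]. }
  set (W1 := (edge (fun _ => 1) (r, 0) (0, r) w + edge (fun _ => 1) (0, r) (- r, 0)%R w +
    edge (fun _ => 1) (- r, 0)%R (r, 0) w)%C).
  assert (nW : W1 <> 0).
  { intros e. apply (f_equal Im) in e. unfold W1 in e.
    pose proof (edge_one_Im _ _ w c1). pose proof (edge_one_Im _ _ w c2). pose proof (edge_one_Im _ _ w c3).
    assert (im : forall x y z : C, 0 < Im x -> 0 < Im y -> 0 < Im z -> Im (x + y + z)%C <> Im 0).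
    { intros [x1 x2] [y1 y2] [z1 z2]. simpl. intros. lra. }
    now apply im in e. }
  assert (z : (f w * W1)%C = 0).
  { apply Cmod_eq_0. apply Rle_antisym; [|apply Cmod_ge_0]. apply le_epsilon. intros e he.
    assert (he3 : 0 < e / 3) by lra.
    destruct (edge_contract_limit r T hT f _ _ w _ hf c1 b1 b2 bw he3) as [l1 [hl1 q1]].
    destruct (edge_contract_limit r T hT f _ _ w _ hf c2 b2 b3 bw he3) as [l2 [hl2 q2]].
    destruct (edge_contract_limit r T hT f _ _ w _ hf c3 b3 b1 bw he3) as [l3 [hl3 q3]].
    set (l := Rmin l1 (Rmin l2 l3)). assert (hl : 0 < l) by (repeat apply Rmin_glb_lt; easy).
    assert (l <= l1) by apply Rmin_l.
    assert (l <= Rmin l2 l3) by apply Rmin_r.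
    pose proof (Rmin_l l2 l3). pose proof (Rmin_r l2 l3).
    specialize (q1 l ltac:(lra)). specialize (q2 l ltac:(lra)). specialize (q3 l ltac:(lra)).
    assert (hl' : 0 < l <= 1) by lra.
    pose proof (edge_contract r T hr hT f _ _ w l hf c1 b1 b2 bw hl') as k1.
    pose proof (edge_contract r T hr hT f _ _ w l hf c2 b2 b3 bw hl') as k2.
    pose proof (edge_contract r T hr hT f _ _ w l hf c3 b3 b1 bw hl') as k3.
    unfold Jint in hJ. rewrite base in k3.
    set (d1 := edge (dil f w l) (r, 0) (0, r) w) in *.
    set (d2 := edge (dil f w l) (0, r) (- r, 0)%R w) in *.
    set (d3 := edge (dil f w l) (- r, 0)%R (r, 0) w) in *.
    assert (s : (d1 + d2 + d3)%C = 0).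
    { replace (d1 + d2 + d3)%C with ((edge f (r, 0) (0, r) w + edge f (0, r) (- r, 0)%R w) -
        ((edge f (r, 0) (0, r) w - d1) + (edge f (0, r) (- r, 0)%R w - d2) + (0 - d3)))%C by ring.
      rewrite hJ, k1, k2, k3. ring. }
    replace (f w * W1)%C with ((d1 + d2 + d3) -
       ((d1 - f w * edge (fun _ => 1) (r, 0) (0, r) w) +
       (d2 - f w * edge (fun _ => 1) (0, r) (- r, 0)%R w) +
       (d3 - f w * edge (fun _ => 1) (- r, 0)%R (r, 0) w)))%C by (unfold W1; ring).
    rewrite s. unfold Cminus at 1. rewrite Cplus_0_l, Cmod_opp.
    eapply Rle_trans; [apply Cmod_triangle|].
    eapply Rle_trans; [apply Rplus_le_compat_r, Cmod_triangle|]. lra. }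
  replace (f w) with (f w * W1 / W1)%C by (field; easy). rewrite z. field. easy.
Qed.

End Path.

Lemma distinct_nodes n k : 0 < k -> exists cs, NoDup cs /\ length cs = n /\ forall c, In c cs -> 0 < c <= k.
Proof.
  revert k. induction n as [|n IH]; intros k hk.
  - exists nil. repeat split; [constructor|easy|easy].
  - destruct (IH (k / 2) ltac:(lra)) as [cs [h1 [h2 h3]]]. exists (k :: cs). repeat split.
    + constructor; [|easy]. intros h. specialize (h3 k h). lra.
    + simpl. now f_equal.
    + destruct H as [<-|h]; [lra|]. specialize (h3 c h). lra.
    + destruct H as [<-|h]; [lra|]. specialize (h3 c h). lra.
Qed.

Lemma geometric_small q A e : 0 <= q < 1 -> 0 < e -> exists n, A * q ^ n < e.
Proof.
  intros hq he. pose proof (Rabs_pos A). pose proof (Rle_abs A).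
  destruct (pow_lt_1_zero q ltac:(rewrite Rabs_right; lra) (e / (Rabs A + 1))) as [n hn];
    [apply Rdiv_lt_0_compat; lra|].
  exists n. specialize (hn n (le_n n)). assert (p : 0 <= q ^ n) by (apply pow_le; lra).
  rewrite Rabs_right in hn by lra.
  apply (lt_absorb _ (Rabs A)); lra.
Qed.

(** * Zeros of bounded holomorphic functions on the upper half-plane *)

Record half_fun (F : C -> C) (M : R) : Prop := {
  hf_cont : forall z0, 0 <= Im z0 -> forall e, 0 < e -> exists d, 0 < d /\
    forall z, 0 <= Im z -> Cmod (z - z0) < d -> Cmod (F z - F z0) < e;
  hf_quad : forall m, 0 < m -> exists F' K, quad (fun z => m <= Im z) F F' K;
  hf_bound : forall z, 0 <= Im z -> Cmod (F z) <= M }.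

Lemma Im_plus z w : Im (z + w)%C = Im z + Im w.
Proof. destruct z, w. reflexivity. Qed.

Lemma half_shift F M p : 0 <= Im p -> half_fun F M -> half_fun (fun z => F (z + p)%C) M.
Proof.
  intros hp [h1 h2 h3]. split.
  - intros z0 hz e he. destruct (h1 (z0 + p)%C) with e as [d [hd hs]]; [rewrite Im_plus; lra|easy|].
    exists d. split; [easy|]. intros z h1' h2'. apply hs; [rewrite Im_plus; lra|].
    now replace (z + p - (z0 + p))%C with (z - z0)%C by ring.
  - intros m hm. destruct (h2 m hm) as [F' [K [hK hq]]]. exists (fun z => F' (z + p)%C), K. split; [easy|].
    intros z z' hz hz'. specialize (hq (z + p)%C (z' + p)%C).
    replace (z' + p - (z + p))%C with (z' - z)%C in hq by ring.
    apply hq; rewrite Im_plus; lra.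
  - intros z hz. apply h3. rewrite Im_plus. lra.
Qed.

Lemma half_upper F M r T : half_fun F M -> upper_fun F r T.
Proof.
  intros [h1 h2 _]. split.
  - intros z0 [_ hz] e he. destruct (h1 z0 (proj1 hz) e he) as [d [hd hs]]. exists d. split; [easy|].
    intros z [_ hz'] hd'. apply hs; easy.
  - intros m hm. destruct (h2 m hm) as [F' [K [hK hq]]]. exists F', K. split; [easy|].
    intros z z' [_ hz] [_ hz']. now apply hq.
Qed.

(** Plays the role of [g] in [zero_estimate] around an interior point [p]: the function below the
    line through [p] is then [F (z + p)] itself. Keeping [T < Im p] keeps [Cconj z + p] above the
    axis. *)
Definition refl (F : C -> C) (p z : C) : C := Cconj (F (Cconj z + p)%C).

Lemma refl_upper F M p r T : half_fun F M -> T < Im p -> upper_fun (refl F p) r T.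
Proof.
  intros [h1 h2 _] hT. unfold refl.
  assert (e1 : forall z z', Cmod (Cconj (F (Cconj z + p)%C) - Cconj (F (Cconj z' + p)%C)) =
     Cmod (F (Cconj z + p)%C - F (Cconj z' + p)%C)) by (intros; now rewrite <- Cminus_conj, Cmod_conj).
  assert (im : forall z, box r T z -> Im p - T <= Im (Cconj z + p)%C).
  { intros z [_ hz]. rewrite Im_plus, Im_conj. lra. }
  split.
  - intros z0 hz e he. destruct (h1 (Cconj z0 + p)%C) with e as [d [hd hs]]; [specialize (im z0 hz); lra|easy|].
    exists d. split; [easy|]. intros z hz' hd'. rewrite e1. apply hs; [specialize (im z hz'); lra|].
    replace (Cconj z + p - (Cconj z0 + p))%C with (Cconj z - Cconj z0)%C by ring.
    now rewrite <- Cminus_conj, Cmod_conj.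
  - intros m _. destruct (h2 (Im p - T)) as [F' [K [hK hq]]]; [lra|].
    exists (fun z => Cconj (F' (Cconj z + p)%C)), K. split; [easy|]. intros z z' [hz _] [hz' _].
    specialize (hq (Cconj z + p)%C (Cconj z' + p)%C (im z hz) (im z' hz')).
    replace (Cconj z' + p - (Cconj z + p))%C with (Cconj (z' - z)%C) in hq by (rewrite Cminus_conj; ring).
    rewrite Cmod_conj in hq. eapply Rle_trans; [|exact hq]. right.
    rewrite <- Cmod_conj. f_equal. rewrite !Cminus_conj, Cmult_conj, !Cconj_conj. f_equal. f_equal.
    now rewrite Cminus_conj.
Qed.

Lemma on_path_Im r z : 0 < r -> on_path r z -> 0 <= Im z <= r.
Proof.
  intros hr [s [hs [-> | ->]]]; simpl; nra.
Qed.

Lemma quarter_zero a b M : (forall n, Cmod a * Cmod b <= M * (1 / 4) ^ n) -> b <> 0 -> a = 0.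
Proof.
  intros h hb. apply Cmod_eq_0. pose proof (Cmod_ge_0 a). pose proof (proj1 (Cmod_gt_0 b) hb) as pb.
  destruct (Req_dec (Cmod a) 0) as [|n]; [easy|exfalso].
  destruct (geometric_small (1 / 4) M (Cmod a * Cmod b)) as [k hk]; [lra|apply Rmult_lt_0_compat; lra|].
  specialize (h k). lra.
Qed.

Lemma upper_fun_zero r T : upper_fun (fun _ => 0) r T.
Proof.
  split.
  - intros z0 _ e he. exists 1. split; [lra|]. intros. replace (0 - 0)%C with (RtoC 0) by ring. now rewrite Cmod_0.
  - intros m _. exists (fun _ => 0), 0. split; [lra|]. intros z z' _ _.
    replace (0 - 0 - (z' - z) * 0)%C with (RtoC 0) by ring. rewrite Cmod_0. lra.
Qed.

Lemma edge_zero a b w : edge (fun _ => 0) a b w = 0.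
Proof.
  unfold edge. rewrite (cint_ext _ (fun _ => RtoC 0)) by (lra || (intros; ring)).
  rewrite cint_const. ring.
Qed.

(** [Jint r F] vanishes at real points, so interpolation at [n] of them bounds it at [w] by
    [8 M (1/4)^n]. It is therefore 0 at [w], and [triangle_cauchy] concludes. *)
Lemma zero_near F M r w : 0 < r -> half_fun F M -> (forall t, - r <= t <= r -> F (RtoC t) = 0) ->
  0 < Im w -> Cmod w <= r / 24 -> F w = 0.
Proof.
  intros hr hF h0 hi hw.
  assert (uf := half_upper F M r (2 * r) hF). assert (u0 := upper_fun_zero r (2 * r)).
  assert (hT : r < 2 * r) by lra.
  assert (hw1 : Rabs (Re w) + Im w <= r / 12).
  { pose proof (re_le_Cmod w). pose proof (Im_le_Cmod w). pose proof (Rle_abs (Im w)). lra. }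
  assert (hin : inside r w) by (unfold inside; lra).
  apply (triangle_cauchy r hr (2 * r) hT F w uf h0 hin hi).
  assert (aF := uf_alongJ r hr (2 * r) hT F uf).
  (* As [F] vanishes on [[- r, r]], it is continued below by 0, that is, [g = 0]. *)
  assert (J0 : forall c, Rabs c <= r / 2 -> Jint r F (RtoC c) = 0).
  { intros c hc. assert (Rabs c < r) by lra.
    pose proof (Jdiff_cauchy r hr (2 * r) hT F (fun _ => 0) c uf u0) as q.
    specialize (q ltac:(intros t ht; rewrite h0, Cconj_RtoC by easy; reflexivity) ltac:(lra)).
    rewrite h0, Cmult_0_l in q by (apply Rabs_le_between; lra). unfold Jdiff in q.
    assert (z : Jint r (fun _ => 0) (RtoC c) = 0).
    { unfold Jint. rewrite 2 edge_zero. ring. }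
    rewrite z, Cconj_RtoC in q. rewrite <- q. ring. }
  apply (quarter_zero _ 1 (8 * M)).
  2:{ intros e. apply RtoC_inj in e. lra. }
  intros n. rewrite Cmod_1, Rmult_1_r.
  destruct (distinct_nodes n (r / 24)) as [cs [nd [len hcs]]]; [lra|].
  assert (hc2 : forall c, In c cs -> Rabs c <= r / 24).
  { intros c hc. specialize (hcs c hc). rewrite Rabs_right; lra. }
  rewrite <- (Jint_newton r hr F cs w aF nd).
  - rewrite Cmod_mult.
    assert (q1 : Cmod (Jint r (divs F cs) w) <= 8 * (M * (3 / r) ^ length cs)).
    { apply Jint_bound; [easy|easy|lra| |].
      - apply divs_along; [easy|easy|]. intros c hc. specialize (hc2 c hc). lra.
      - intros z hz. apply divs_bound; [easy|easy| |].
        + intros c hc. specialize (hc2 c hc). lra.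
        + apply (hf_bound _ _ hF). now apply (on_path_Im r). }
    assert (q2 : Cmod (nodes cs w) <= (r / 12) ^ length cs).
    { apply nodes_bound. intros c hc. specialize (hcs c hc).
      unfold Cminus. eapply Rle_trans; [apply Cmod_triangle|]. rewrite Cmod_opp, Cmod_R, Rabs_right; lra. }
    replace (8 * M * (1 / 4) ^ n) with (8 * (M * (3 / r) ^ length cs) * (r / 12) ^ length cs).
    + apply Rmult_le_compat; auto; apply Cmod_ge_0.
    + rewrite !Rmult_assoc, <- Rpow_mult_distr, len. do 3 f_equal. field. lra.
  - intros c hc. specialize (hc2 c hc). split; [lra|apply J0; lra].
  - easy.
  - lra.
Qed.

(** Zeros accumulating horizontally at [p] fill a horizontal interval around it. The diamond of size
    [r = Im p / 4] stays in the half-plane, and [96 = 4 * 24]. *)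
Lemma zero_spread F M p x : half_fun F M -> 0 < Im p ->
  (forall n k, 0 < k -> exists cs, NoDup cs /\ length cs = n /\
     forall c, In c cs -> Rabs c <= k /\ F (RtoC c + p)%C = 0) ->
  Rabs x <= Im p / 96 -> F (RtoC x + p)%C = 0.
Proof.
  intros hF hp hz hx. set (r := Im p / 4). assert (hr : 0 < r) by (unfold r; lra).
  assert (hT : r < 2 * r) by lra.
  assert (u1 := half_upper _ M r (2 * r) (half_shift F M p ltac:(lra) hF)).
  assert (u2 := refl_upper F M p r (2 * r) hF ltac:(unfold r; lra)).
  assert (hx' : Rabs x <= r / 24) by (unfold r; lra).
  apply (quarter_zero _ (Jdiff r (fun _ => 1) (fun _ => 1) (RtoC x)) (16 * M)).
  2:{ apply Jdiff_one_neq0; [easy|lra]. }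
  intros n. destruct (hz n (r / 24)) as [cs [nd [len hcs]]]; [lra|]. rewrite <- len.
  apply (zero_estimate r hr (2 * r) hT (fun z => F (z + p)%C) (refl F p) M cs x u1 u2); try easy.
  - intros t _. unfold refl. now rewrite Cconj_RtoC, Cconj_conj.
  - intros z h. apply (hf_bound _ _ hF). apply on_path_Im in h; [|easy]. rewrite Im_plus. lra.
  - intros z h. unfold refl. rewrite Cmod_conj. apply (hf_bound _ _ hF). apply on_path_Im in h; [|easy].
    rewrite Im_plus, Im_conj. unfold r in *. lra.
Qed.

Lemma zero_line F M s k : half_fun F M -> 0 < s -> 0 < k ->
  (forall t, Rabs t <= k -> F (t, s) = 0) -> forall t, F (t, s) = 0.
Proof.
  intros hF hs hk h0.
  (* Zeros on one side of [x] suffice, the sign [e] telling which, since [x] is going to lie towards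
     the end of an interval already covered. *)
  assert (sp : forall x e, (e = 1 \/ e = -1) -> (exists d, 0 < d /\ forall c, 0 < c <= d -> F (x + e * c, s) = 0) ->
     forall y, Rabs (y - x) <= s / 96 -> F (y, s) = 0).
  { intros x e he [d [hd hc]] y hy.
    assert (ad : forall c, (RtoC c + (x, s))%C = (x + c, s)).
    { intros c. apply injective_projections; simpl; ring. }
    replace (y, s) with (RtoC (y - x) + (x, s))%C by (rewrite ad; f_equal; ring).
    apply (zero_spread F M (x, s) (y - x) hF hs); [|exact hy].
    intros n k' hk'. destruct (distinct_nodes n (Rmin d k')) as [cs [nd [len hcs]]]; [now apply Rmin_glb_lt|].
    exists (map (fun c => e * c) cs). split; [|split].
    - apply Injective_map_NoDup; [|easy]. intros a b. destruct he as [-> | ->]; lra.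
    - now rewrite length_map.
    - intros c hc'. apply in_map_iff in hc'. destruct hc' as [b [<- hb]]. specialize (hcs b hb).
      pose proof (Rmin_l d k'). pose proof (Rmin_r d k'). split.
      + rewrite Rabs_mult, (Rabs_right b) by lra. destruct he as [-> | ->].
        * rewrite Rabs_right; lra.
        * rewrite Rabs_left; lra.
      + rewrite ad. apply hc. lra. }
  set (rho := s / 96). assert (hrho : 0 < rho) by (unfold rho; lra).
  (* [zero_spread] reaches [rho] from its centre. Centring at distance [rho] from the target, with
     zeros on the inner side, gains [rho / 2] per step. *)
  assert (ind : forall n t, Rabs t <= rho + INR n * (rho / 2) -> F (t, s) = 0).
  { induction n as [|n IH]; intros t ht.
    - simpl in ht. apply (sp 0 1); [now left| |rewrite Rminus_0_r; fold rho; lra].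
      exists k. split; [easy|]. intros c hc. apply h0. rewrite Rabs_right; lra.
    - destruct (Rle_dec (Rabs t) (rho + INR n * (rho / 2))) as [h|h]; [now apply IH|].
      rewrite S_INR in ht. assert (pn : 0 <= INR n * (rho / 2)) by (apply Rmult_le_pos; [apply pos_INR|lra]).
      destruct (Rle_dec 0 t) as [p|p].
      + rewrite Rabs_right in * by lra. apply (sp (t - rho) (-1)); [now right| |].
        * exists (rho / 2). split; [lra|]. intros c hc. apply IH.
          unfold Rabs. destruct Rcase_abs; lra.
        * fold rho. replace (t - (t - rho)) with rho by ring. rewrite Rabs_right; lra.
      + rewrite Rabs_left in * by lra. apply (sp (t + rho) 1); [now left| |].
        * exists (rho / 2). split; [lra|]. intros c hc. apply IH.
          unfold Rabs. destruct Rcase_abs; lra.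
        * fold rho. replace (t - (t + rho)) with (- rho) by ring. rewrite Rabs_left; lra. }
  intros t. destruct (INR_unbounded (Rabs t / (rho / 2))) as [n hn]. apply (ind n).
  assert (Rabs t < INR n * (rho / 2)); [|lra].
  apply (Rmult_lt_compat_r (rho / 2)) in hn; [|lra].
  replace (Rabs t / (rho / 2) * (rho / 2)) with (Rabs t) in hn by (field; lra). lra.
Qed.

(** Zeros pass from the real interval to the points just above it, from there along a whole
    horizontal line, and back to the real axis by continuity. *)
Lemma half_fun_unique F M r : half_fun F M -> 0 < r -> (forall t, - r <= t <= r -> F (RtoC t) = 0) ->
  forall t, F (RtoC t) = 0.
Proof.
  intros hF hr h0 t.
  (* [|x|] and [s] are at most [r/48], so [x + i s] is within the radius [r/24] of [zero_near]. *)
  assert (up : forall s, 0 < s <= r / 48 -> F (t, s) = 0).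
  { intros s hs. apply (zero_line F M s (r / 48) hF); [lra|lra|]. intros x hx.
    apply (zero_near F M r); [easy|easy|easy|simpl; lra|].
    eapply Rle_trans; [apply Cmod_le_Re_Im|]. simpl. rewrite (Rabs_right s); lra. }
  apply Cmod_eq_0. apply Rle_antisym; [|apply Cmod_ge_0]. apply le_epsilon. intros e he.
  destruct (hf_cont _ _ hF (RtoC t) ltac:(simpl; lra) e he) as [d [hd hs]].
  set (s := Rmin (r / 48) (d / 2)). assert (0 < s) by (apply Rmin_glb_lt; lra).
  assert (s <= r / 48) by apply Rmin_l. assert (s <= d / 2) by apply Rmin_r.
  specialize (hs (t, s) ltac:(simpl; lra)). rewrite (up s) in hs by lra.
  rewrite <- Cmod_opp. replace (- F (RtoC t))%C with (0 - F (RtoC t))%C by ring.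
  rewrite Rplus_0_l. left. apply hs.
  eapply Rle_lt_trans; [apply Cmod_le_Re_Im|]. simpl.
  replace (t + - t) with 0 by ring. replace (s + - 0) with s by ring. rewrite Rabs_R0, Rabs_right; lra.
Qed.

Lemma W_half_fun {H : Hilbert} (u : R -> H -> H) (v x : H) : positive_group u ->
  half_fun (fun z => ip v (W u z x)) (hnorm v * hnorm x).
Proof.
  intros hu. pose proof (hnorm_ge0 v) as pv. split.
  - intros z0 hz e he.
    destruct (W_cont u hu z0 x (e / (hnorm v + 1)) hz) as [d [hd hs]]; [apply Rdiv_lt_0_compat; lra|].
    exists d. split; [easy|]. intros z h1 h2. specialize (hs z h1 h2).
    rewrite <- ip_hsub_r. eapply Rle_lt_trans; [apply cauchy_schwarz|].
    pose proof (hnorm_ge0 (hsub (W u z x) (W u z0 x))).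
    apply (lt_absorb _ (hnorm v)); lra.
  - intros m hm. exists (fun z => ip v (dV u z x)), (hnorm v * (/ (m * m) * hnorm x)). split.
    + apply Rmult_le_pos; [easy|]. apply Rmult_le_pos; [|apply hnorm_ge0]. left. apply Rinv_0_lt_compat. nra.
    + intros z z' h1 h2. rewrite <- ip_hsub_r, <- ip_csc_r, <- ip_hsub_r.
      eapply Rle_trans; [apply cauchy_schwarz|]. rewrite Rmult_assoc.
      apply Rmult_le_compat_l; [easy|]. now apply W_quad.
  - intros z _. eapply Rle_trans; [apply cauchy_schwarz|]. apply Rmult_le_compat_l; [easy|]. now apply W_norm.
Qed.

Lemma group_vanishing {H : Hilbert} (u : R -> H -> H) (v x : H) (a b : R) : positive_group u -> a < b ->
  (forall t, a <= t <= b -> ip v (u t x) = 0) -> forall t, ip v (u t x) = 0.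
Proof.
  intros hu hab h t. set (c := (a + b) / 2). set (r := (b - a) / 2).
  assert (q : forall s, ip v (W u (RtoC s) (u c x)) = 0).
  { apply (half_fun_unique _ _ r (W_half_fun u v (u c x) hu)); [unfold r; lra|].
    intros s hs. rewrite W_real, <- (pg_add u hu). apply h. unfold c, r in *. lra. }
  specialize (q (t - c)). rewrite W_real, <- (pg_add u hu) in q. now replace (t - c + c) with t in q by ring.
Qed.

(** * Borchers' lemma for effects *)

Section Effects.
Context {H : Hilbert} (E : H -> H) (HE : is_effect E).

Lemma effect_linear : linear_op E.
Proof. apply HE. Qed.

Lemma effect_form x : Im (ip x (E x)) = 0 /\ 0 <= Re (ip x (E x)) <= Re (ip x x).
Proof. apply (proj2 HE x). Qed.

(** Polarisation: the form is real at [x + y] and at [x + i y]. *)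
Lemma effect_selfadj x y : ip (E x) y = ip x (E y).
Proof.
  pose proof effect_linear as L.
  pose proof (proj1 (effect_form (hadd x y))) as q1.
  pose proof (proj1 (effect_form (hadd x (csc Ci y)))) as q2.
  rewrite (linear_op_hadd _ _ _ L), ip_hadd_r, 2 ip_hadd_l in q1.
  rewrite (linear_op_hadd _ _ _ L), (linear_op_csc _ _ _ L), ip_hadd_r, 2 ip_hadd_l, 2 ip_csc_r, 2 ip_csc_l in q2.
  pose proof (proj1 (effect_form x)) as qx. pose proof (proj1 (effect_form y)) as qy.
  rewrite (ip_conj y (E x)).
  destruct (ip x (E x)), (ip y (E y)), (ip x (E y)), (ip y (E x)). simpl in *.
  apply injective_projections; simpl; lra.
Qed.

(** That is, [E^2 <= E]. Cauchy-Schwarz for the form [<x, E y>], applied to [E x] and [x], gives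
    [|E x|^4 <= |E x|^2 <x, E x>]. *)
Lemma effect_norm_sq x : hnorm (E x) * hnorm (E x) <= Re (ip x (E x)).
Proof.
  pose proof effect_linear as L.
  assert (cs : Cmod (ip (E x) (E x)) * Cmod (ip (E x) (E x)) <= Re (ip (E x) (E (E x))) * Re (ip x (E x))).
  { apply (form_cauchy_schwarz (fun x y => ip x (E y))).
    - intros. rewrite (linear_op_hadd _ _ _ L). apply ip_hadd_r.
    - intros. rewrite (linear_op_csc _ _ _ L). apply ip_csc_r.
    - intros a b. rewrite <- effect_selfadj. apply ip_conj.
    - intros a. apply (effect_form a). }
  pose proof (proj2 (effect_form (E x))) as q1. pose proof (proj2 (effect_form x)) as q2.
  rewrite <- hnorm_sq in q1.
  assert (e : Cmod (ip (E x) (E x)) = hnorm (E x) * hnorm (E x)).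
  { destruct (ip_self (E x)) as [e1 e2]. rewrite e1, Cmod_R, Rabs_right by lra. now rewrite <- hnorm_sq. }
  rewrite e in cs. set (n := hnorm (E x) * hnorm (E x)) in *.
  assert (hn : 0 <= n) by lra.
  destruct (Req_dec n 0) as [z|z]; [lra|].
  apply (Rmult_le_reg_l n); [lra|]. nra.
Qed.

Lemma effect_norm x : hnorm (E x) <= hnorm x.
Proof.
  pose proof (effect_norm_sq x). pose proof (proj2 (effect_form x)).
  rewrite <- hnorm_sq in *. pose proof (hnorm_ge0 x). pose proof (hnorm_ge0 (E x)).
  apply Rsqr_incr_0_var; [unfold Rsqr; lra|easy].
Qed.

Definition compl (x : H) : H := hsub x (E x).

Lemma compl_linear : linear_op compl.
Proof.
  pose proof effect_linear as L. split; unfold compl.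
  - intros x y. rewrite (linear_op_hadd _ _ _ L). vec.
  - intros a x. rewrite (proj2 L). replace a with (ofC (toC a)) by now destruct a.
    change (hsub (csc (toC a) x) (csc (toC a) (E x)) = csc (toC a) (hsub x (E x))). vec.
Qed.

Lemma compl_norm_sq x : hnorm (E x) * hnorm (E x) <= hnorm x * hnorm x - hnorm (compl x) * hnorm (compl x).
Proof.
  pose proof (effect_norm_sq x) as q. pose proof (hnorm_sq (E x)) as s.
  rewrite (hnorm_sq x), (hnorm_sq (compl x)). unfold compl.
  rewrite ip_hsub_r, 2 ip_hsub_l, (effect_selfadj x x).
  destruct (ip x x), (ip x (E x)), (ip (E x) (E x)). simpl in *. lra.
Qed.

Lemma compl_norm x : hnorm (compl x) <= hnorm x.
Proof.
  pose proof (compl_norm_sq x). pose proof (hnorm_ge0 x). pose proof (hnorm_ge0 (compl x)).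
  pose proof (hnorm_ge0 (E x)). apply Rsqr_incr_0_var; [unfold Rsqr; nra|easy].
Qed.

Definition compl_iter (m : nat) : H -> H := Nat.iter m compl.

Lemma compl_iter_linear m : linear_op (compl_iter m).
Proof.
  induction m as [|m IH]; [split; reflexivity|]. pose proof compl_linear as L.
  split; intros; simpl.
  - now rewrite (proj1 IH), (proj1 L).
  - now rewrite (proj2 IH), (proj2 L).
Qed.

Lemma compl_iter_norm m x : hnorm (compl_iter m x) <= hnorm x.
Proof. induction m as [|m IH]; simpl; [lra|]. eapply Rle_trans; [apply compl_norm|exact IH]. Qed.

Lemma compl_selfadj x y : ip (compl x) y = ip x (compl y).
Proof. unfold compl. now rewrite ip_hsub_l, ip_hsub_r, effect_selfadj. Qed.

Lemma compl_iter_selfadj m x y : ip (compl_iter m x) y = ip x (compl_iter m y).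
Proof.
  revert x y. induction m as [|m IH]; intros x y; simpl; [easy|].
  rewrite compl_selfadj, IH. f_equal. clear.
  induction m as [|m IH]; simpl; [easy|now rewrite IH].
Qed.

Lemma compl_iter_comm m x : compl_iter m (E x) = E (compl_iter m x).
Proof.
  induction m as [|m IH]; simpl; [easy|]. rewrite IH. unfold compl.
  now rewrite (linear_op_hsub _ _ _ effect_linear).
Qed.

(* [|E (1-E)^m x|^2 <= |(1-E)^m x|^2 - |(1-E)^(m+1) x|^2], a telescoping sum in [m]. *)
Lemma compl_iter_small x e : 0 < e -> exists m, hnorm (compl_iter m (E x)) <= e.
Proof.
  intros he. apply NNPP. intros n.
  assert (big : forall m, e * e <= hnorm (compl_iter m x) * hnorm (compl_iter m x) -
     hnorm (compl_iter (S m) x) * hnorm (compl_iter (S m) x)).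
  { intros m. apply Rle_trans with (2 := compl_norm_sq (compl_iter m x)).
    rewrite <- compl_iter_comm. assert (e < hnorm (compl_iter m (E x))); [|nra].
    apply Rnot_le_lt. intros h. apply n. eauto. }
  assert (sum : forall m, INR m * (e * e) + hnorm (compl_iter m x) * hnorm (compl_iter m x) <= hnorm x * hnorm x).
  { induction m as [|m IH]; [simpl; lra|]. rewrite S_INR. specialize (big m). lra. }
  destruct (INR_unbounded (hnorm x * hnorm x / (e * e))) as [m hm].
  specialize (sum m). apply (Rmult_lt_compat_r (e * e)) in hm; [|nra].
  replace (hnorm x * hnorm x / (e * e) * (e * e)) with (hnorm x * hnorm x) in hm by (field; lra).
  pose proof (Rle_0_sqr (hnorm (compl_iter m x))). unfold Rsqr in *. lra.
Qed.

(* [1 - (1-E)^m], which converges strongly to the support projection of [E]. *)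
Definition approx_support (m : nat) (x : H) : H := hsub x (compl_iter m x).

Lemma approx_support_linear m : linear_op (approx_support m).
Proof.
  pose proof (compl_iter_linear m) as L. split; unfold approx_support.
  - intros x y. rewrite (linear_op_hadd _ _ _ L). vec.
  - intros a x. rewrite (proj2 L). replace a with (ofC (toC a)) by now destruct a.
    change (hsub (csc (toC a) x) (csc (toC a) (compl_iter m x)) = csc (toC a) (hsub x (compl_iter m x))). vec.
Qed.

(** Independent of [m]. The factor 2, paid once for each [G] in a product, is beaten by the [1/4] of
    [zero_estimate]. *)
Lemma approx_support_norm m x : hnorm (approx_support m x) <= 2 * hnorm x.
Proof.
  unfold approx_support. eapply Rle_trans; [apply hnorm_hsub_le|]. pose proof (compl_iter_norm m x). lra.
Qed.

Lemma approx_support_selfadj m x y : ip (approx_support m x) y = ip x (approx_support m y).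
Proof. unfold approx_support. now rewrite ip_hsub_l, ip_hsub_r, compl_iter_selfadj. Qed.

(** One application of [G] moves [E x] by [(1-E)^m E x]; a later one at most doubles the accumulated
    error and adds the same amount, whence the [2^n - 1] of the induction. *)
Lemma approx_support_power m n x :
  hnorm (hsub (Nat.iter n (approx_support m) (E x)) (E x)) <= 2 ^ n * hnorm (compl_iter m (E x)).
Proof.
  pose proof (hnorm_ge0 (compl_iter m (E x))) as p.
  assert (q : hnorm (hsub (Nat.iter n (approx_support m) (E x)) (E x)) <=
    (2 ^ n - 1) * hnorm (compl_iter m (E x))); [|lra].
  induction n as [|n IH]; simpl; [rewrite hsub_diag, hnorm_hzero; lra|].
  set (y := Nat.iter n (approx_support m) (E x)) in *.
  replace (hsub (approx_support m y) (E x)) with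
    (hadd (approx_support m (hsub y (E x))) (csc (-1) (compl_iter m (E x)))).
  - eapply Rle_trans; [apply hnorm_hadd|]. rewrite hnorm_csc, Cmod_R, Rabs_left by lra.
    pose proof (approx_support_norm m (hsub y (E x))). lra.
  - rewrite (linear_op_hsub _ _ _ (approx_support_linear m)). unfold approx_support. vec.
Qed.

End Effects.

(** * Conjugation by the group and its continuation between analytic vectors *)

Section Sandwich.
Context {H : Hilbert} (u : R -> H -> H) (Hu : positive_group u).

Lemma W_comm z s x : W u z (u s x) = u s (W u z x).
Proof.
  unfold W. destruct Rlt_dec as [h|_].
  - pose proof (pk_adm z h) as a. symmetry. eapply is_int_unique.
    + exact (is_int_linear _ _ _ _ (pg_brl u Hu s) (adm_hcont u Hu _ _ x a) (Kint_spec u Hu _ _ x a)).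
    + eapply is_int_ext; [|exact (Kint_spec u Hu _ _ (u s x) a)]. intros t. simpl.
      rewrite (linear_op_csc _ _ _ (pg_lin u Hu s)), <- 2 (pg_add u Hu). f_equal. f_equal. ring.
  - rewrite <- 2 (pg_add u Hu). f_equal. ring.
Qed.

(** Beyond distance [m] the trivial bound [2 |x|] is already below the claimed one, which lifts the
    proximity condition of [W_lip]. *)
Lemma W_lipschitz z z' m x : 0 < m -> m <= Im z -> m <= Im z' ->
  hnorm (hsub (W u z' x) (W u z x)) <= 2 / m * hnorm x * Cmod (z' - z).
Proof.
  intros hm h1 h2. destruct (Rle_dec (Cmod (z' - z)) m) as [h|h]; [now apply W_lip|].
  eapply Rle_trans; [apply hnorm_hsub_le|].
  pose proof (W_norm u Hu z x). pose proof (W_norm u Hu z' x). pose proof (hnorm_ge0 x).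
  apply Rle_trans with (2 / m * hnorm x * m); [|apply Rmult_le_compat_l; [|lra]].
  - replace (2 / m * hnorm x * m) with (2 * hnorm x) by (field; lra). lra.
  - apply Rmult_le_pos; [apply Rdiv_le_0_compat; lra|easy].
Qed.

(** The left factor sits at [z], the right one at [i d - z], of height at least [d - T > 0]. Both
    are in the half-plane where [W] is regular, and the product rule applies. *)
Lemma sandwich_upper (v x : H) (P : H -> H) B r T d : linear_op P ->
  (forall y, hnorm (P y) <= B * hnorm y) -> 0 <= B -> T < d ->
  upper_fun (fun z => ip v (W u z (P (W u ((0, d) - z)%C x)))) r T.
Proof.
  intros hP hB hB0 hT. pose proof (hnorm_ge0 v) as pv. pose proof (hnorm_ge0 x) as px.
  assert (im : forall z, box r T z -> d - T <= Im ((0, d) - z)%C).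
  { intros z [_ hz]. destruct z; simpl in *. lra. }
  split.
  - intros z0 hz0 e he. set (y0 := W u ((0, d) - z0)%C x).
    set (e' := e / (2 * (hnorm v + 1) * (B + 1))).
    assert (he' : 0 < e').
    { apply Rdiv_lt_0_compat; [easy|]. apply Rmult_lt_0_compat; lra. }
    destruct (W_cont u Hu z0 (P y0) e' (proj1 (proj2 hz0)) he') as [d1 [hd1 h1]].
    destruct (W_cont u Hu ((0, d) - z0)%C x e' ltac:(specialize (im z0 hz0); lra) he') as [d2 [hd2 h2]].
    exists (Rmin d1 d2). split; [now apply Rmin_glb_lt|]. intros z hz hd.
    assert (q1 := Rlt_le_trans _ _ _ hd (Rmin_l _ _)). assert (q2 := Rlt_le_trans _ _ _ hd (Rmin_r _ _)).
    specialize (h1 z (proj1 (proj2 hz)) q1).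
    specialize (h2 ((0, d) - z)%C ltac:(specialize (im z hz); lra)).
    replace ((0, d) - z - ((0, d) - z0))%C with (- (z - z0))%C in h2 by ring.
    rewrite Cmod_opp in h2. specialize (h2 q2). set (y := W u ((0, d) - z)%C x) in *. fold y0 in h2.
    rewrite <- ip_hsub_r. eapply Rle_lt_trans; [apply cauchy_schwarz|].
    assert (s : hnorm (hsub (W u z (P y)) (W u z0 (P y0))) < (B + 1) * e').
    { replace (hsub (W u z (P y)) (W u z0 (P y0))) with
        (hadd (W u z (P (hsub y y0))) (hsub (W u z (P y0)) (W u z0 (P y0)))).
      - eapply Rle_lt_trans; [apply hnorm_hadd|].
        pose proof (W_norm u Hu z (P (hsub y y0))). pose proof (hB (hsub y y0)).
        assert (B * hnorm (hsub y y0) <= B * e') by (apply Rmult_le_compat_l; lra). lra.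
      - rewrite (linear_op_hsub _ _ _ hP), (linear_op_hsub _ _ _ (W_linear u Hu z)). vec. }
    pose proof (hnorm_ge0 (hsub (W u z (P y)) (W u z0 (P y0)))).
    apply Rle_lt_trans with ((hnorm v + 1) * ((B + 1) * e')).
    + apply Rmult_le_compat; lra.
    + unfold e'. replace ((hnorm v + 1) * ((B + 1) * (e / (2 * (hnorm v + 1) * (B + 1))))) with (e / 2) by (field; lra).
      lra.
  - intros m0 hm0. set (m := Rmin m0 (d - T)). assert (hm : 0 < m) by (apply Rmin_glb_lt; lra).
    assert (ml : m <= m0) by apply Rmin_l. assert (mr : m <= d - T) by apply Rmin_r.
    set (y := fun z => W u ((0, d) - z)%C x).
    set (y' := fun z => csc (-1) (dV u ((0, d) - z)%C x)).
    exists (fun z => ip v (hadd (dV u z (P (y z))) (W u z (P (y' z))))),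
      (hnorm v * (4 * B / (m * m) * hnorm x)). split.
    { apply Rmult_le_pos; [easy|]. apply Rmult_le_pos; [|easy]. apply Rdiv_le_0_compat; [lra|nra]. }
    intros z z' [hz hzm] [hz' hzm']. fold (y z) (y z').
    rewrite <- ip_hsub_r, <- ip_csc_r, <- ip_hsub_r. eapply Rle_trans; [apply cauchy_schwarz|].
    rewrite Rmult_assoc. apply Rmult_le_compat_l; [easy|].
    pose proof (W_linear u Hu z') as Lz'. pose proof (W_linear u Hu z) as Lz.
    set (h := (z' - z)%C). set (q := Cmod h). assert (pq : 0 <= q) by apply Cmod_ge_0.
    set (rho := hsub (hsub (y z') (y z)) (csc h (y' z))).
    (* Product rule: the remainder of the left factor, the remainder [rho] of the right one, and a
       mixed second-order term. They account for the constant [4 = 1 + 1 + 2]. *)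
    replace (hsub (hsub (W u z' (P (y z'))) (W u z (P (y z))))
        (csc h (hadd (dV u z (P (y z))) (W u z (P (y' z)))))) with
      (hadd (hsub (hsub (W u z' (P (y z))) (W u z (P (y z)))) (csc h (dV u z (P (y z)))))
        (hadd (W u z' (P rho)) (csc h (hsub (W u z' (P (y' z))) (W u z (P (y' z))))))).
    2:{ unfold rho. rewrite !(linear_op_hsub _ _ _ hP), (linear_op_csc _ _ _ hP),
          !(linear_op_hsub _ _ _ Lz'), (linear_op_csc _ _ _ Lz'). vec. }
    assert (im' := im z hz). assert (im'' := im z' hz').
    assert (ny : hnorm (y z) <= hnorm x) by now apply W_norm.
    assert (b1 : hnorm (hsub (hsub (W u z' (P (y z))) (W u z (P (y z)))) (csc h (dV u z (P (y z))))) <=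
       / (m * m) * (B * hnorm x) * (q * q)).
    { eapply Rle_trans; [apply (W_quad u Hu z z' m); lra|]. fold h. fold q.
      apply Rmult_le_compat_r; [nra|]. apply Rmult_le_compat_l.
      - left. apply Rinv_0_lt_compat. nra.
      - eapply Rle_trans; [apply hB|]. now apply Rmult_le_compat_l. }
    assert (b2 : hnorm (W u z' (P rho)) <= B * (/ (m * m) * hnorm x * (q * q))).
    { eapply Rle_trans; [apply (W_norm u Hu)|]. eapply Rle_trans; [apply hB|].
      apply Rmult_le_compat_l; [easy|].
      pose proof (W_quad u Hu ((0, d) - z)%C ((0, d) - z')%C m x hm ltac:(lra) ltac:(lra)) as w.
      replace ((0, d) - z' - ((0, d) - z))%C with (- h)%C in w by (unfold h; ring).
      rewrite Cmod_opp in w. fold q in w. fold (y z) (y z') in w.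
      replace rho with (hsub (hsub (y z') (y z)) (csc (- h)%C (dV u ((0, d) - z)%C x))); [exact w|].
      unfold rho, y'. vec. }
    assert (ny' : hnorm (P (y' z)) <= B * (/ m * hnorm x)).
    { eapply Rle_trans; [apply hB|]. apply Rmult_le_compat_l; [easy|]. unfold y'.
      rewrite hnorm_csc, Cmod_R, Rabs_left by lra.
      pose proof (dV_norm u Hu ((0, d) - z)%C m x hm ltac:(lra)). lra. }
    assert (b3 : hnorm (csc h (hsub (W u z' (P (y' z))) (W u z (P (y' z))))) <=
       q * (2 / m * (B * (/ m * hnorm x)) * q)).
    { rewrite hnorm_csc. fold q. apply Rmult_le_compat_l; [easy|].
      eapply Rle_trans; [apply (W_lipschitz z z' m); lra|]. fold h. fold q.
      apply Rmult_le_compat_r; [easy|]. apply Rmult_le_compat_l; [apply Rdiv_le_0_compat; lra|easy]. }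
    eapply Rle_trans; [apply hnorm_hadd|]. eapply Rle_trans; [apply Rplus_le_compat_l, hnorm_hadd|].
    replace (4 * B / (m * m) * hnorm x * (q * q)) with
      (/ (m * m) * (B * hnorm x) * (q * q) + (B * (/ (m * m) * hnorm x * (q * q)) +
        q * (2 / m * (B * (/ m * hnorm x)) * q))) by (field; lra). lra.
Qed.

Definition cj (s : R) (P : H -> H) (x : H) : H := u s (P (u (- s) x)).

Lemma cj_cancel s x : u s (u (- s) x) = x /\ u (- s) (u s x) = x.
Proof.
  rewrite <- 2 (pg_add u Hu), Rplus_opp_r, Rplus_opp_l. now rewrite (pg_0 u Hu).
Qed.

Lemma cj_selfadj s x y : ip (u s x) y = ip x (u (- s) y).
Proof. rewrite <- (pg_ip u Hu (- s)). now rewrite (proj2 (cj_cancel s x)). Qed.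

Lemma cj_adj s (Q Q' : H -> H) x y : (forall a b, ip (Q a) b = ip a (Q' b)) ->
  ip (cj s Q x) y = ip x (cj s Q' y).
Proof. intros h. unfold cj. now rewrite cj_selfadj, h, cj_selfadj, Ropp_involutive. Qed.

(* [t -> <A x, u(t) P u(-t) y>] continues to the upper half-plane as it stands, and to the lower
   half-plane after [A] has been commuted past [u(t) P u(-t)]; [2 r] is the width of the strip in
   which [y] and [x], being in the range of [W (2 i r)], are analytic vectors. *)
Lemma local_estimate (A P P' : H -> H) B r x0 y0 cs t :
  is_effect A -> linear_op P -> linear_op P' -> (forall x y, ip (P x) y = ip x (P' y)) ->
  (forall x, hnorm (P x) <= B * hnorm x) -> (forall x, hnorm (P' x) <= B * hnorm x) -> 0 <= B -> 0 < r ->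
  (forall s x, - r <= s <= r -> A (cj s P x) = cj s P (A x)) ->
  NoDup cs -> (forall c, In c cs -> Rabs c <= r / 24 /\ forall x, A (cj c P x) = hzero) ->
  Rabs t <= r / 24 ->
  Cmod (ip (A (W u (0, 2 * r) x0)) (cj t P (W u (0, 2 * r) y0))) *
    Cmod (Jdiff r (fun _ => 1) (fun _ => 1) (RtoC t)) <=
    16 * (hnorm x0 * (B * hnorm y0)) * (1 / 4) ^ length cs.
Proof.
  intros hA hP hP' hadj hB hB' hB0 hr hcom hnd hcs ht.
  set (x := W u (0, 2 * r) x0). set (y := W u (0, 2 * r) y0). set (d := 2 * r) in *.
  set (f := fun z => ip (A x) (W u z (P (W u ((0, d) - z)%C y0)))).
  set (g := fun z => ip (A y) (W u z (P' (W u ((0, d) - z)%C x0)))).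
  (* Strictly above the contour, which reaches height [r], and strictly below [d = 2 r]. *)
  set (T := 3 / 2 * r).
  assert (hf : upper_fun f r T) by (apply sandwich_upper with B; try easy; unfold T, d; lra).
  assert (hg : upper_fun g r T) by (apply sandwich_upper with B; try easy; unfold T, d; lra).
  assert (real : forall (v w : H) (Q : H -> H) s, ip v (W u (RtoC s) (Q (W u ((0, d) - RtoC s)%C w))) =
     ip v (cj s Q (W u (0, d) w))).
  { intros v w Q s. rewrite W_real. unfold cj. rewrite (W_shift u Hu). do 3 f_equal.
    apply (f_equal (fun z => W u z w)). rewrite RtoC_opp. ring. }
  assert (bd : forall (Q : H -> H) v w z, (forall x, hnorm (Q x) <= B * hnorm x) ->
     Cmod (ip (A (W u (0, d) v)) (W u z (Q (W u ((0, d) - z)%C w)))) <= hnorm v * (B * hnorm w)).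
  { intros Q v w z hQ. eapply Rle_trans; [apply cauchy_schwarz|].
    apply Rmult_le_compat; try apply hnorm_ge0.
    - eapply Rle_trans; [apply (effect_norm A hA)|]. now apply W_norm.
    - eapply Rle_trans; [apply (W_norm u Hu)|]. eapply Rle_trans; [apply hQ|].
      apply Rmult_le_compat_l; [easy|]. now apply W_norm. }
  replace (ip (A x) (cj t P y)) with (f (RtoC t)) by exact (real (A x) y0 P t).
  apply (zero_estimate r hr T ltac:(unfold T; lra) f g); try easy.
  - intros s hs. unfold f, g. rewrite 2 real. fold x y.
    rewrite (effect_selfadj A hA), hcom, <- ip_conj by easy. symmetry. apply cj_adj.
    intros a b. now rewrite ip_conj, <- hadj, <- ip_conj.
  - intros z _. now apply bd.
  - intros z _. replace (hnorm x0 * (B * hnorm y0)) with (hnorm y0 * (B * hnorm x0)) by ring. now apply bd.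
  - intros c hc. destruct (hcs c hc) as [h1 h2]. split; [easy|]. unfold f. rewrite real.
    rewrite (effect_selfadj A hA), h2. apply ip_hzero_r.
Qed.

Lemma cj_linear s (P : H -> H) : linear_op P -> linear_op (cj s P).
Proof.
  intros hP. destruct (pg_lin u Hu s) as [a1 a2]. destruct (pg_lin u Hu (- s)) as [b1 b2]. destruct hP as [c1 c2].
  split; intros; unfold cj; [now rewrite b1, c1, a1|now rewrite b2, c2, a2].
Qed.

Lemma cj_norm s (P : H -> H) B : (forall x, hnorm (P x) <= B * hnorm x) ->
  forall x, hnorm (cj s P x) <= B * hnorm x.
Proof. intros hP x. unfold cj. rewrite (pg_norm u Hu). rewrite <- (pg_norm u Hu (- s) x). apply hP. Qed.

Lemma cj_comp s (P Q : H -> H) x : cj s (fun y => P (Q y)) x = cj s P (cj s Q x).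
Proof. unfold cj. now rewrite (proj2 (cj_cancel s _)). Qed.

Lemma cj_cj s t (P : H -> H) x : cj s (cj t P) x = cj (s + t) P x.
Proof. unfold cj. replace (- (s + t)) with (- t + - s) by ring. now rewrite 2 (pg_add u Hu). Qed.

Lemma cj_0 (P : H -> H) x : cj 0 P x = P x.
Proof. unfold cj. now rewrite Ropp_0, 2 (pg_0 u Hu). Qed.

Lemma cj_cont (P : H -> H) B x e : linear_op P -> (forall x, hnorm (P x) <= B * hnorm x) -> 0 <= B -> 0 < e ->
  exists k, 0 < k /\ forall c, Rabs c <= k -> hnorm (hsub (cj c P x) (P x)) <= e.
Proof.
  intros hP hB hB0 he.
  assert (near : forall z e, 0 < e -> exists k, 0 < k /\ forall c, Rabs c <= k -> hnorm (hsub (u c z) z) <= e).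
  { intros z e' he'. destruct (pg_cont u Hu z (-1) 1 0 ltac:(lra) e' he') as [d [hd hs]].
    rewrite (pg_0 u Hu) in hs. exists (Rmin 1 (d / 2)). split; [apply Rmin_glb_lt; lra|].
    intros c hc. pose proof (Rmin_l 1 (d / 2)). pose proof (Rmin_r 1 (d / 2)). left. apply hs.
    - apply Rabs_le_between. lra.
    - rewrite Rminus_0_r. lra. }
  destruct (near x (e / 2 / (B + 1))) as [k1 [hk1 q1]]; [apply Rdiv_lt_0_compat; lra|].
  destruct (near (P x) (e / 2)) as [k2 [hk2 q2]]; [lra|].
  exists (Rmin k1 k2). split; [now apply Rmin_glb_lt|]. intros c hc.
  pose proof (Rmin_l k1 k2). pose proof (Rmin_r k1 k2).
  specialize (q1 (- c) ltac:(rewrite Rabs_Ropp; lra)). specialize (q2 c ltac:(lra)).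
  replace (hsub (cj c P x) (P x)) with (hadd (u c (P (hsub (u (- c) x) x))) (hsub (u c (P x)) (P x))).
  - eapply Rle_trans; [apply hnorm_hadd|]. rewrite (pg_norm u Hu).
    pose proof (hB (hsub (u (- c) x) x)). pose proof (hnorm_ge0 (hsub (u (- c) x) x)).
    assert (B * hnorm (hsub (u (- c) x) x) <= e / 2); [|lra].
    apply Rle_trans with ((B + 1) * (e / 2 / (B + 1))); [apply Rmult_le_compat; lra|].
    right. field. lra.
  - unfold cj. rewrite (linear_op_hsub _ _ _ hP), (linear_op_hsub _ _ _ (pg_lin u Hu c)). vec.
Qed.

(* The products [G(c_1) ... G(c_n) F] with [G(c) = u(c) G u(-c)], and their adjoints. *)
Fixpoint chain (G F : H -> H) (cs : list R) : H -> H :=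
  match cs with nil => F | cons c l => fun x => cj c G (chain G F l x) end.

Fixpoint chain_adj (G F : H -> H) (cs : list R) : H -> H :=
  match cs with nil => F | cons c l => fun x => chain_adj G F l (cj c G x) end.

Section Chain.
Variables G F A : H -> H.
Hypothesis GL : linear_op G.
Hypothesis FL : linear_op F.
Hypothesis G2 : forall x, hnorm (G x) <= 2 * hnorm x.
Hypothesis F1 : forall x, hnorm (F x) <= hnorm x.

Lemma chain_linear cs : linear_op (chain G F cs).
Proof.
  induction cs as [|c l [i1 i2]]; [easy|]. destruct (cj_linear c G GL) as [g1 g2].
  split; intros; simpl; [now rewrite i1, g1|now rewrite i2, g2].
Qed.

Lemma chain_adj_linear cs : linear_op (chain_adj G F cs).
Proof.
  induction cs as [|c l [i1 i2]]; [easy|]. destruct (cj_linear c G GL) as [g1 g2].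
  split; intros; simpl; [now rewrite g1, i1|now rewrite g2, i2].
Qed.

Lemma chain_norm cs x : hnorm (chain G F cs x) <= 2 ^ length cs * hnorm x.
Proof.
  induction cs as [|c l IH]; simpl; [specialize (F1 x); lra|].
  eapply Rle_trans; [apply cj_norm; exact G2|]. lra.
Qed.

Lemma chain_adj_norm cs x : hnorm (chain_adj G F cs x) <= 2 ^ length cs * hnorm x.
Proof.
  revert x. induction cs as [|c l IH]; intros x; simpl; [specialize (F1 x); lra|].
  eapply Rle_trans; [apply IH|]. pose proof (cj_norm c G 2 G2 x).
  assert (0 < 2 ^ length l) by (apply pow_lt; lra). nra.
Qed.

Lemma chain_adjoint cs x y : (forall x y, ip (G x) y = ip x (G y)) -> (forall x y, ip (F x) y = ip x (F y)) ->
  ip (chain G F cs x) y = ip x (chain_adj G F cs y).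
Proof.
  intros hG hF. revert x y. induction cs as [|c l IH]; intros x y; simpl; [easy|].
  now rewrite (cj_adj c G G), IH.
Qed.

Variable e : R.
Hypothesis comG : forall s x, Rabs s < e -> A (cj s G x) = cj s G (A x).
Hypothesis comF : forall s x, Rabs s < e -> A (cj s F x) = cj s F (A x).

Lemma chain_comm cs t x : Rabs t < e -> (forall c, In c cs -> Rabs (t + c) < e) ->
  A (cj t (chain G F cs) x) = cj t (chain G F cs) (A x).
Proof.
  intros ht. induction cs as [|c l IH]; intros h; simpl; [now apply comF|].
  rewrite (cj_comp t (cj c G) (chain G F l) x), (cj_comp t (cj c G) (chain G F l) (A x)), 2 cj_cj, comG by (apply h; now left).
  f_equal. apply IH. intros d hd. apply h. now right.
Qed.

(** At [t = - c] the factor of the node [c] is [G] itself. [A] commutes with the factors before it,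
    and then [A G = 0]. *)
Lemma chain_zero cs t x : linear_op A -> (forall x, A (G x) = hzero) ->
  (forall c, In c cs -> Rabs (t + c) < e) -> In (- t) cs -> A (cj t (chain G F cs) x) = hzero.
Proof.
  intros hA hG. induction cs as [|c l IH]; intros h hin; [easy|]. destruct hin as [hin|hin]; simpl in *.
  - rewrite (cj_comp t (cj c G) (chain G F l)), cj_cj. replace (t + c) with 0 by lra. now rewrite cj_0.
  - rewrite (cj_comp t (cj c G) (chain G F l)), cj_cj, comG by (apply h; now left).
    rewrite IH by auto. apply linear_op_hzero, cj_linear, GL.
Qed.

Lemma chain_limit n x eta : 0 < eta -> exists k, 0 < k /\ forall cs, length cs = n ->
  (forall c, In c cs -> Rabs c <= k) -> hnorm (hsub (chain G F cs x) (Nat.iter n G (F x))) <= eta.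
Proof.
  revert eta. induction n as [|n IH]; intros eta he.
  - exists 1. split; [lra|]. intros [|c l] hl; [|easy]. intros _. simpl. rewrite hsub_diag, hnorm_hzero. lra.
  - destruct (IH (eta / 4)) as [k1 [hk1 q1]]; [lra|].
    destruct (cj_cont G 2 (Nat.iter n G (F x)) (eta / 2) GL G2) as [k2 [hk2 q2]]; [lra|lra|].
    exists (Rmin k1 k2). split; [now apply Rmin_glb_lt|]. intros [|c l] hl hk; [easy|]. simpl.
    pose proof (Rmin_l k1 k2). pose proof (Rmin_r k1 k2).
    specialize (q1 l ltac:(simpl in hl; lia) ltac:(intros d hd; specialize (hk d (or_intror hd)); lra)).
    specialize (q2 c ltac:(specialize (hk c (or_introl eq_refl)); lra)).
    set (y := Nat.iter n G (F x)) in *. set (z := chain G F l x) in *.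
    eapply Rle_trans; [apply (hnorm_hsub_triangle _ (cj c G y))|].
    rewrite <- (linear_op_hsub _ _ _ (cj_linear c G GL)).
    pose proof (cj_norm c G 2 G2 (hsub z y)). lra.
Qed.

End Chain.

Section Borchers.
Variables A F : H -> H.
Hypothesis EA : is_effect A.
Hypothesis EF : is_effect F.
Hypothesis AF0 : forall x, A (F x) = hzero.
Variable e : R.
Hypothesis he : 0 < e.
Hypothesis comF : forall s x, Rabs s < e -> A (cj s F x) = cj s F (A x).

Lemma A_compl_iter m x : A (compl_iter F m x) = A x.
Proof.
  induction m as [|m IH]; simpl; [easy|]. unfold compl at 1.
  rewrite (linear_op_hsub _ _ _ (effect_linear A EA)), AF0, IH. vec.
Qed.

Lemma A_approx_support m x : A (approx_support F m x) = hzero.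
Proof.
  unfold approx_support. rewrite (linear_op_hsub _ _ _ (effect_linear A EA)), A_compl_iter. apply hsub_diag.
Qed.

Lemma cj_compl s x : cj s (compl F) x = hsub x (cj s F x).
Proof.
  unfold cj, compl. now rewrite (linear_op_hsub _ _ _ (pg_lin u Hu s)), (proj1 (cj_cancel s x)).
Qed.

Lemma com_compl_iter m s x : Rabs s < e -> A (cj s (compl_iter F m) x) = cj s (compl_iter F m) (A x).
Proof.
  intros hs. induction m as [|m IH]; simpl.
  - unfold cj; simpl. now rewrite 2 (proj1 (cj_cancel s _)).
  - change (compl_iter F (S m)) with (fun y => compl F (compl_iter F m y)).
    rewrite (cj_comp s (compl F) (compl_iter F m) x), (cj_comp s (compl F) (compl_iter F m) (A x)), 2 cj_compl, (linear_op_hsub _ _ _ (effect_linear A EA)), comF by easy.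
    now rewrite IH.
Qed.

Lemma com_approx_support m s x : Rabs s < e ->
  A (cj s (approx_support F m) x) = cj s (approx_support F m) (A x).
Proof.
  intros hs.
  assert (q : forall y, cj s (approx_support F m) y = hsub y (cj s (compl_iter F m) y)).
  { intros y. unfold cj, approx_support.
    now rewrite (linear_op_hsub _ _ _ (pg_lin u Hu s)), (proj1 (cj_cancel s y)). }
  now rewrite 2 q, (linear_op_hsub _ _ _ (effect_linear A EA)), com_compl_iter.
Qed.

Lemma borchers_local r t x0 y0 : 0 < r -> r <= e / 4 -> Rabs t <= r / 24 ->
  ip (A (W u (0, 2 * r) x0)) (cj t F (W u (0, 2 * r) y0)) = 0.
Proof.
  intros hr hre ht. set (y := W u (0, 2 * r) y0). set (x := W u (0, 2 * r) x0).
  set (J := Jdiff r (fun _ => 1) (fun _ => 1) (RtoC t)).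
  assert (hJ : J <> 0) by (apply Jdiff_one_neq0; lra).
  set (M := 16 * (hnorm x0 * hnorm y0)).
  assert (bound : forall n, Cmod (ip (A x) (cj t F y)) * Cmod J <= M * (1 / 2) ^ n).
  { intros n. apply le_epsilon. intros eps heps.
    set (L := (hnorm x + 1) * (Cmod J + 1)).
    assert (hx := hnorm_ge0 x). assert (pJ := Cmod_ge_0 J).
    assert (hL : 0 < L) by (apply Rmult_lt_0_compat; lra).
    (* All approximations are strong ones at the single vector [yt]. One [eta] is spent on [m] and
       one on the nodes; [L] absorbs the factors [|x|] and [|J|]. *)
    set (yt := u (- t) y). set (eta := eps / (2 * L)).
    assert (heta : 0 < eta) by (apply Rdiv_lt_0_compat; lra).
    (* The division by [2 ^ n] offsets the growth in [approx_support_power]; [m] is thus chosen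
       after [n]. *)
    destruct (compl_iter_small F EF yt (eta / 2 ^ n)) as [m hm].
    { apply Rdiv_lt_0_compat; [easy|]. apply pow_lt. lra. }
    set (G := approx_support F m).
    pose proof (approx_support_linear F EF m) as GL. fold G in GL.
    pose proof (approx_support_norm F EF m) as G2. fold G in G2.
    pose proof (effect_linear F EF) as FL. pose proof (effect_norm F EF) as F1.
    assert (p1 : hnorm (hsub (Nat.iter n G (F yt)) (F yt)) <= eta).
    { eapply Rle_trans; [apply approx_support_power; exact EF|].
      apply Rle_trans with (2 ^ n * (eta / 2 ^ n)).
      - apply Rmult_le_compat_l; [apply pow_le; lra|exact hm].
      - right. field. apply pow_nonzero. lra. }
    destruct (chain_limit G F GL G2 n yt eta heta) as [k [hk lim]].
    destruct (distinct_nodes n (Rmin k (r / 24))) as [cs [nd [len hcs]]]; [apply Rmin_glb_lt; lra|].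
    pose proof (Rmin_l k (r / 24)). pose proof (Rmin_r k (r / 24)).
    specialize (lim cs len ltac:(intros c hc; specialize (hcs c hc); rewrite Rabs_right; lra)).
    (* The nodes are negated: the factor of node [c] produces a zero at [t = - c]. *)
    assert (est := local_estimate A (chain G F cs) (chain_adj G F cs) (2 ^ n) r x0 y0 (map Ropp cs) t EA).
    specialize (est (chain_linear G F GL FL cs) (chain_adj_linear G F GL FL cs)).
    specialize (est (fun a b => chain_adjoint G F cs a b (approx_support_selfadj F EF m) (effect_selfadj F EF))).
    pose proof (chain_norm G F G2 F1 cs) as cn. pose proof (chain_adj_norm G F G2 F1 cs) as cn'.
    rewrite len in cn, cn'. specialize (est cn cn').
    specialize (est (pow_le 2 n ltac:(lra)) hr).
    (* With [r <= e/4] and nodes at most [r/24], every parameter [s + c] on the real edge of the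
       diamond stays where commutation is assumed. *)
    assert (range : forall s c, Rabs s <= r -> In c cs -> Rabs (s + c) < e).
    { intros s c h1 h2. specialize (hcs c h2). eapply Rle_lt_trans; [apply Rabs_triang|].
      rewrite (Rabs_right c); lra. }
    assert (cG : forall s x, Rabs s < e -> A (cj s G x) = cj s G (A x)) by (intros; now apply com_approx_support).
    assert (c1 : forall s a, - r <= s <= r -> A (cj s (chain G F cs) a) = cj s (chain G F cs) (A a)).
    { intros s a hs. assert (Rabs s <= r) by now apply Rabs_le_between.
      apply (chain_comm G F A e cG comF); [lra|]. intros c hc. now apply range. }
    specialize (est c1).
    assert (nd' : NoDup (map Ropp cs)).
    { apply Injective_map_NoDup; [|easy]. intros a b. lra. }
    specialize (est nd').
    assert (z1 : forall c, In c (map Ropp cs) -> Rabs c <= r / 24 /\ forall a, A (cj c (chain G F cs) a) = hzero).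
    { intros c hc. apply in_map_iff in hc. destruct hc as [b [<- hb]]. pose proof (hcs b hb).
      assert (Rabs (- b) <= r / 24) by (rewrite Rabs_Ropp, Rabs_right; lra). split; [easy|]. intros a.
      apply (chain_zero G F A GL e cG); [exact (effect_linear A EA)|apply A_approx_support| |].
      - intros d hd. apply range; [lra|easy].
      - now rewrite Ropp_involutive. }
    specialize (est z1 ht). fold x y J in est. rewrite length_map, len in est.
    replace (16 * (hnorm x0 * (2 ^ n * hnorm y0)) * (1 / 4) ^ n) with (M * (1 / 2) ^ n) in est.
    2:{ unfold M. replace (1 / 2) with (2 * (1 / 4)) by field. rewrite Rpow_mult_distr. ring. }
    assert (diff : Cmod (ip (A x) (cj t F y)) <= Cmod (ip (A x) (cj t (chain G F cs) y)) + (hnorm x + 1) * (2 * eta)).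
    { replace (ip (A x) (cj t F y)) with (ip (A x) (cj t (chain G F cs) y) +
        ip (A x) (hsub (cj t F y) (cj t (chain G F cs) y)))%C by (rewrite ip_hsub_r; ring).
      eapply Rle_trans; [apply Cmod_triangle|]. apply Rplus_le_compat_l.
      eapply Rle_trans; [apply cauchy_schwarz|]. pose proof (effect_norm A EA x).
      apply Rmult_le_compat; try apply hnorm_ge0; [lra|].
      unfold cj. rewrite <- (linear_op_hsub _ _ _ (pg_lin u Hu t)), (pg_norm u Hu). fold yt.
      eapply Rle_trans; [apply (hnorm_hsub_triangle _ (Nat.iter n G (F yt)))|].
      rewrite hnorm_hsub_comm in p1. rewrite hnorm_hsub_comm in lim. lra. }
    apply Rle_trans with ((Cmod (ip (A x) (cj t (chain G F cs) y)) + (hnorm x + 1) * (2 * eta)) * Cmod J).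
    { now apply Rmult_le_compat_r. }
    rewrite Rmult_plus_distr_r. apply Rplus_le_compat; [exact est|].
    apply Rle_trans with ((hnorm x + 1) * (2 * eta) * (Cmod J + 1)).
    - apply Rmult_le_compat_l; [|lra]. apply Rmult_le_pos; lra.
    - right. unfold eta, L. field. split; lra. }
  apply Cmod_eq_0. pose proof (proj1 (Cmod_gt_0 J) hJ) as pJ. set (v := Cmod (ip (A x) (cj t F y))) in *.
  assert (hv : 0 <= v) by apply Cmod_ge_0.
  destruct (Req_dec v 0) as [|n]; [easy|exfalso].
  destruct (geometric_small (1 / 2) M (v * Cmod J)) as [k hk]; [lra|apply Rmult_lt_0_compat; lra|].
  specialize (bound k). lra.
Qed.

Lemma W_small x eta : 0 < eta -> exists d, 0 < d /\ forall y, 0 < y <= d -> hnorm (hsub (W u (0, y) x) x) <= eta.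
Proof.
  intros h. destruct (W_cont u Hu 0 x eta (Rle_refl 0) h) as [d [hd hs]].
  exists (d / 2). split; [lra|]. intros y hy. specialize (hs (0, y) ltac:(simpl; lra)).
  rewrite (W_real u 0), (pg_0 u Hu) in hs. left. apply hs.
  eapply Rle_lt_trans; [apply Cmod_le_Re_Im|]. simpl.
  replace (0 + - 0) with 0 by ring. replace (y + - 0) with y by ring. rewrite Rabs_R0, Rabs_right; lra.
Qed.

Lemma borchers t x : A (u t (F x)) = hzero.
Proof.
  pose proof (effect_linear A EA) as AL. pose proof (effect_linear F EF) as FL.
  assert (step : forall r a b, 0 < r -> r <= e / 4 ->
    ip (A (W u (0, 2 * r) a)) (u t (F (W u (0, 2 * r) b))) = 0).
  { intros r a b hr hre. apply (group_vanishing u _ _ (- (r / 24)) (r / 24) Hu); [lra|].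
    (* Using [u s b] in place of [b] cancels the inner [u(-s)] of [cj s F]. What remains is a matrix
       element of [u(s)] alone, to which uniqueness of continuation applies. *)
    intros s hs. rewrite <- (borchers_local r s a (u s b) hr hre) by (apply Rabs_le_between; lra).
    unfold cj. now rewrite W_comm, (proj2 (cj_cancel s _)). }
  apply ip_ext. intros v. rewrite ip_hzero_r. rewrite <- (effect_selfadj A EA).
  apply Cmod_eq_0. apply Rle_antisym; [|apply Cmod_ge_0]. apply le_epsilon. intros eps heps. rewrite Rplus_0_l.
  set (L := hnorm v + hnorm x + 1). pose proof (hnorm_ge0 v) as pv. pose proof (hnorm_ge0 x) as px.
  assert (hL : 0 < L) by (unfold L; lra).
  (* As [r] tends to 0, [W (2 i r) v] and [W (2 i r) x] tend to [v] and [x], which carries [step]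
     over to arbitrary vectors. *)
  destruct (W_small v (eps / (2 * L))) as [d1 [hd1 q1]]; [apply Rdiv_lt_0_compat; lra|].
  destruct (W_small x (eps / (2 * L))) as [d2 [hd2 q2]]; [apply Rdiv_lt_0_compat; lra|].
  set (r := Rmin (e / 4) (Rmin d1 d2 / 2)).
  assert (hr : 0 < r) by (repeat apply Rmin_glb_lt; try lra; pose proof (Rmin_glb_lt d1 d2 0 hd1 hd2); lra).
  assert (hr1 : r <= e / 4) by apply Rmin_l. assert (hr2 : r <= Rmin d1 d2 / 2) by apply Rmin_r.
  pose proof (Rmin_l d1 d2). pose proof (Rmin_r d1 d2).
  specialize (q1 (2 * r) ltac:(lra)). specialize (q2 (2 * r) ltac:(lra)).
  pose proof (step r v x hr hr1) as z.
  set (v' := W u (0, 2 * r) v) in *. set (x' := W u (0, 2 * r) x) in *.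
  assert (nv : hnorm v' <= hnorm v) by now apply W_norm.
  replace (ip (A v) (u t (F x))) with
    (- (ip (A (hsub v' v)) (u t (F x)) + ip (A v') (u t (F (hsub x' x)))))%C.
  - rewrite Cmod_opp. eapply Rle_trans; [apply Cmod_triangle|].
    assert (b : forall a c, Cmod (ip (A a) (u t (F c))) <= hnorm a * hnorm c).
    { intros a c. eapply Rle_trans; [apply cauchy_schwarz|]. rewrite (pg_norm u Hu).
      apply Rmult_le_compat; try apply hnorm_ge0; now apply effect_norm. }
    pose proof (b (hsub v' v) x) as b1. pose proof (b v' (hsub x' x)) as b2.
    assert (eps / (2 * L) * hnorm x + hnorm v * (eps / (2 * L)) <= eps).
    { apply Rle_trans with (eps / (2 * L) * L).
      - assert (pq : 0 < eps / (2 * L)) by (apply Rdiv_lt_0_compat; lra).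
        set (q := eps / (2 * L)) in *. clearbody q. unfold L. lra.
      - replace (eps / (2 * L) * L) with (eps / 2) by (field; lra). lra. }
    pose proof (hnorm_ge0 (hsub v' v)). pose proof (hnorm_ge0 (hsub x' x)). pose proof (hnorm_ge0 v').
    assert (hnorm (hsub v' v) * hnorm x <= eps / (2 * L) * hnorm x) by (apply Rmult_le_compat_r; lra).
    assert (hnorm v' * hnorm (hsub x' x) <= hnorm v * (eps / (2 * L))) by (apply Rmult_le_compat; lra).
    lra.
  - rewrite (linear_op_hsub _ _ _ AL), (linear_op_hsub _ _ _ FL), (linear_op_hsub _ _ _ (pg_lin u Hu t)).
    rewrite ip_hsub_l, ip_hsub_r, z. ring.
Qed.

End Borchers.

End Sandwich.

(** * Translations of Minkowski space *)

Definition cis (r : R) : C := (cos r, sin r).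

Lemma Cmod_cis r : Cmod (cis r) = 1.
Proof.
  unfold Cmod, cis; simpl. pose proof (sin2_cos2 r) as e. unfold Rsqr in e.
  replace (cos r * (cos r * 1) + sin r * (sin r * 1)) with 1 by lra. apply sqrt_1.
Qed.

Lemma cis_add r s : cis (r + s) = (cis r * cis s)%C.
Proof. unfold cis. rewrite cos_plus, sin_plus. apply injective_projections; simpl; ring. Qed.

Lemma cis_0 : cis 0 = 1.
Proof. unfold cis. now rewrite cos_0, sin_0. Qed.

Lemma cis_inv r : (cis r * cis (- r) = 1)%C.
Proof. now rewrite <- cis_add, Rplus_opp_r, cis_0. Qed.

Lemma hcont_cis c : hcont (H:=CH) (fun t => cis (c * t)).
Proof.
  intros a b t _ e he.
  assert (cc : continuous (fun t => cos (c * t)) t).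
  { apply (ex_derive_continuous (V:=R_NormedModule)). auto_derive. easy. }
  assert (cs : continuous (fun t => sin (c * t)) t).
  { apply (ex_derive_continuous (V:=R_NormedModule)). auto_derive. easy. }
  assert (he2 : 0 < e / 2) by lra.
  destruct (proj1 (filterlim_locally _ _) cc (mkposreal _ he2)) as [d1 h1].
  destruct (proj1 (filterlim_locally _ _) cs (mkposreal _ he2)) as [d2 h2].
  exists (Rmin d1 d2). split; [apply Rmin_glb_lt; apply cond_pos|]. intros s _ hs.
  specialize (h1 s (Rlt_le_trans _ _ _ hs (Rmin_l _ _))). specialize (h2 s (Rlt_le_trans _ _ _ hs (Rmin_r _ _))).
  change (Rabs (cos (c * s) - cos (c * t)) < e / 2) in h1.
  change (Rabs (sin (c * s) - sin (c * t)) < e / 2) in h2.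
  rewrite hnorm_CH. change (Cmod (cis (c * s) - cis (c * t)) < e).
  eapply Rle_lt_trans; [apply Cmod_le_Re_Im|]. unfold cis; simpl. unfold Rminus in *. lra.
Qed.

Lemma cis_derivative c e : 0 < e -> exists d, 0 < d /\ forall t, t <> 0 -> Rabs t < d ->
  Cmod (RtoC (/ t) * (cis (c * t) - 1) - RtoC c * Ci) <= e.
Proof.
  intros he.
  assert (dc : derivable_pt_lim (fun t => cos (c * t)) 0 0).
  { apply is_derive_Reals. auto_derive; [easy|]. rewrite !Rmult_0_r, sin_0. ring. }
  assert (ds : derivable_pt_lim (fun t => sin (c * t)) 0 c).
  { apply is_derive_Reals. auto_derive; [easy|]. rewrite !Rmult_0_r, cos_0. ring. }
  destruct (dc (e / 2)) as [d1 h1]; [lra|]. destruct (ds (e / 2)) as [d2 h2]; [lra|].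
  exists (Rmin d1 d2). split; [apply Rmin_glb_lt; apply cond_pos|]. intros t ht hd.
  specialize (h1 t ht (Rlt_le_trans _ _ _ hd (Rmin_l _ _))). specialize (h2 t ht (Rlt_le_trans _ _ _ hd (Rmin_r _ _))).
  rewrite Rplus_0_l, Rmult_0_r in h1, h2. rewrite cos_0 in h1. rewrite sin_0 in h2.
  eapply Rle_trans; [apply Cmod_le_Re_Im|]. unfold cis; simpl.
  replace (/ t * (cos (c * t) + - (1)) - 0 * (sin (c * t) + - 0) + - (c * 0 - 0 * 1)) with
    ((cos (c * t) - 1) / t - 0) by (field; easy).
  replace (/ t * (sin (c * t) + - 0) + 0 * (cos (c * t) + - (1)) + - (c * 1 + 0 * 0)) with
    ((sin (c * t) - 0) / t - c) by (field; easy). lra.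
Qed.

Lemma mink_ext x y : m0 x = m0 y -> m1 x = m1 y -> m2 x = m2 y -> m3 x = m3 y -> x = y.
Proof. destruct x, y; simpl; intros; now subst. Qed.

Section Representation.
Context {H : Hilbert} (U : mink -> H -> H) (HU : unitary_rep U).

Lemma U_linear a : linear_op (U a).
Proof. apply HU. Qed.

Lemma U_ip a x y : ip (U a x) (U a y) = ip x y.
Proof. unfold ip. f_equal. apply (proj1 HU a). Qed.

Lemma U_add a b x : U (madd a b) x = U a (U b x).
Proof. apply HU. Qed.

Lemma U_zero x : U mzero x = x.
Proof. apply HU. Qed.

Lemma U_opp' a x : U (mopp a) (U a x) = x.
Proof.
  rewrite <- U_add. replace (madd (mopp a) a) with mzero by (apply mink_ext; simpl; ring). apply U_zero.
Qed.

Lemma U_adjoint a : adjoint_of (U a) (U (mopp a)).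
Proof.
  intros x y. pose proof (proj1 (proj2 (proj1 HU (mopp a))) (U a x) y) as e. now rewrite U_opp' in e.
Qed.

(* [exp(- i c t) U(t a)]: the phase makes the generator nonnegative when [H(a) >= c]. *)
Definition phased (a : mink) (c t : R) (x : H) : H := csc (cis (- c * t)) (U (mscal t a) x).

Lemma phased_cj a c s (P : H -> H) x : linear_op P ->
  phased a c s (P (phased a c (- s) x)) = U (mscal s a) (P (U (mopp (mscal s a)) x)).
Proof.
  intros hP. unfold phased. rewrite (linear_op_csc _ _ _ hP), (linear_op_csc _ _ _ (U_linear _)), csc_csc.
  replace (- c * - s) with (- (- c * s)) by ring. rewrite cis_inv, csc_1.
  do 3 f_equal. apply mink_ext; simpl; ring.
Qed.

(** If [x'] is the derivative of the phased orbit of [x], that of the orbit under [U] is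
    [x' + i c x]. Multiplication by [- i] gives [- i x' + c x], so the lower bound [c] turns into
    0. *)
Lemma phased_group (a : mink) c : strongly_continuous U ->
  (forall psi phi, gen_derivative U a psi phi ->
    Cre (hinner psi (hscal (Defs.Copp Defs.Ci) phi)) >= c * Cre (hinner psi psi)) ->
  positive_group (phased a c).
Proof.
  intros HUc Hc. split.
  - intros t. destruct (U_linear (mscal t a)) as [l1 l2]. split; unfold phased.
    + intros x y. now rewrite l1, csc_hadd.
    + intros b x. rewrite l2. replace b with (ofC (toC b)) by now destruct b.
      change (csc (cis (- c * t)) (csc (toC b) (U (mscal t a) x)) = csc (toC b) (csc (cis (- c * t)) (U (mscal t a) x))).
      rewrite 2 csc_csc. f_equal. ring.
  - intros t x y. unfold phased. rewrite ip_csc_l, ip_csc_r, U_ip, Cmult_assoc.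
    replace (Cconj (cis (- c * t)) * cis (- c * t))%C with (RtoC 1); [ring|].
    rewrite Cmult_comm, <- Cmod2_conj, Cmod_cis. f_equal. ring.
  - intros x. unfold phased. rewrite Rmult_0_r, cis_0, csc_1.
    replace (mscal 0 a) with mzero by (apply mink_ext; simpl; ring). apply U_zero.
  - intros s t x. unfold phased. rewrite (linear_op_csc _ _ _ (U_linear _)), csc_csc, <- U_add, <- cis_add.
    f_equal; [f_equal; ring|]. f_equal. apply mink_ext; simpl; ring.
  - intros x. apply hcont_csc; [apply hcont_cis|]. intros p q t _ e he.
    destruct (HUc x (mscal t a) e he) as [d [hd hs]]. pose proof (sqrt_pos (m0 a * m0 a + m1 a * m1 a + m2 a * m2 a + m3 a * m3 a)) as pe.
    fold (enorm a) in pe. exists (d / (enorm a + 1)). split; [apply Rdiv_lt_0_compat; lra|]. intros s _ hst.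
    apply hs. replace (enorm (msub (mscal s a) (mscal t a))) with (Rabs (s - t) * enorm a).
    + pose proof (Rabs_pos (s - t)). rewrite Rmult_comm. apply (lt_absorb _ (enorm a)); lra.
    + unfold enorm. rewrite <- sqrt_Rsqr_abs, <- sqrt_mult_alt by apply Rle_0_sqr. f_equal. unfold Rsqr; simpl. ring.
  - intros x x' hd.
    assert (g : gen_derivative U a x (hadd x' (csc (RtoC c * Ci)%C x))).
    { intros e he. pose proof (hnorm_ge0 x) as px. pose proof (hnorm_ge0 x') as px'. pose proof (Rabs_pos c) as pc.
      destruct (hd (e / 4)) as [d1 [hd1 q1]]; [lra|].
      destruct (cis_derivative c (Rmin 1 (e / 4 / (hnorm x + 1)))) as [d2 [hd2 q2]].
      { apply Rmin_glb_lt; [lra|]. apply Rdiv_lt_0_compat; lra. }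
      set (d3 := e / 4 / ((Rabs c + 1) * (hnorm x' + 1))).
      assert (hd3 : 0 < d3) by (apply Rdiv_lt_0_compat; [lra|apply Rmult_lt_0_compat; lra]).
      exists (Rmin d1 (Rmin d2 d3)). split; [repeat apply Rmin_glb_lt; easy|]. intros t ht htd.
      assert (t1 := Rlt_le_trans _ _ _ htd (Rmin_l _ _)). assert (t23 := Rlt_le_trans _ _ _ htd (Rmin_r _ _)).
      assert (t2 := Rlt_le_trans _ _ _ t23 (Rmin_l _ _)). assert (t3 := Rlt_le_trans _ _ _ t23 (Rmin_r _ _)).
      specialize (q1 t ht t1). specialize (q2 t ht t2).
      pose proof (Rmin_l 1 (e / 4 / (hnorm x + 1))). pose proof (Rmin_r 1 (e / 4 / (hnorm x + 1))).
      set (w := cis (c * t)) in *. set (k := (RtoC (/ t) * (w - 1) - RtoC c * Ci)%C) in *.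
      assert (eU : U (mscal t a) x = csc w (phased a c t x)).
      { unfold phased, w. rewrite csc_csc. replace (- c * t) with (- (c * t)) by ring. now rewrite cis_inv, csc_1. }
      change (hnorm (hsub (csc (RtoC (/ t)) (hsub (U (mscal t a) x) x)) (hadd x' (csc (RtoC c * Ci)%C x))) < e).
      assert (htc : RtoC t <> 0) by (intros z; apply RtoC_inj in z; easy).
      (* Product rule for phase times phased orbit; [k] is the error of the difference quotient of
         the phase. *)
      replace (hsub (csc (RtoC (/ t)) (hsub (U (mscal t a) x) x)) (hadd x' (csc (RtoC c * Ci)%C x))) with
        (hadd (csc w (hsub (csc (RtoC (/ t)) (hsub (phased a c t x) x)) x'))
          (hadd (csc (w - 1)%C x') (csc k x))) by (rewrite eU; unfold k; vec).
      eapply Rle_lt_trans; [apply hnorm_hadd|]. eapply Rle_lt_trans; [apply Rplus_le_compat_l, hnorm_hadd|].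
      rewrite 3 hnorm_csc. unfold w at 1. rewrite Cmod_cis, Rmult_1_l.
      assert (b3 : Cmod k * hnorm x <= e / 4).
      { apply Rle_trans with (e / 4 / (hnorm x + 1) * (hnorm x + 1)).
        - apply Rmult_le_compat; try lra. apply Cmod_ge_0.
        - right. field. lra. }
      assert (b2 : Cmod (w - 1) * hnorm x' <= e / 4).
      { assert (cw : Cmod (w - 1) <= Rabs t * (Rabs c + 1)).
        { replace (w - 1)%C with (RtoC t * (k + RtoC c * Ci))%C by (unfold k; rewrite RtoC_inv by easy; field; easy).
          rewrite Cmod_mult, Cmod_R. apply Rmult_le_compat_l; [apply Rabs_pos|].
          eapply Rle_trans; [apply Cmod_triangle|]. rewrite Cmod_mult, Cmod_R.
          rewrite Cmod_Ci. lra. }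
        apply Rle_trans with (d3 * (Rabs c + 1) * (hnorm x' + 1)).
        - apply Rmult_le_compat; [apply Cmod_ge_0|easy| |lra].
          eapply Rle_trans; [exact cw|]. apply Rmult_le_compat_r; lra.
        - right. unfold d3. field. lra. }
      lra. }
    specialize (Hc x _ g).
    change (Re (ip x (csc (- Ci)%C (hadd x' (csc (RtoC c * Ci)%C x)))) >= c * Re (ip x x)) in Hc.
    rewrite csc_hadd, csc_csc, ip_hadd_r, ip_csc_r in Hc.
    rewrite ip_csc_r. rewrite ip_csc_r in Hc.
    destruct (ip x x), (ip x x'). simpl in *. lra.
Qed.

End Representation.

(** * Spacelike separation and timelike displacements *)

Definition mq (v : mink) : R := - mdot v v.

Definition msp (v : mink) : R := m1 v * m1 v + m2 v * m2 v + m3 v * m3 v.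

Lemma mdot_cauchy_schwarz v a : mdot v a * mdot v a <=
  (m0 v * m0 v + msp v) * (m0 a * m0 a + m1 a * m1 a + m2 a * m2 a + m3 a * m3 a).
Proof.
  destruct v as [b x y z], a as [a p q r]. unfold msp, mdot; simpl.
  pose proof (Rle_0_sqr (b * p + x * a)). pose proof (Rle_0_sqr (b * q + y * a)).
  pose proof (Rle_0_sqr (b * r + z * a)). pose proof (Rle_0_sqr (p * y - q * x)).
  pose proof (Rle_0_sqr (p * z - r * x)). pose proof (Rle_0_sqr (q * z - r * y)). unfold Rsqr in *. lra.
Qed.

Section Geometry.
Variable n : mink.
Hypothesis Hn : timelike n.

Lemma n0_sq : 0 < m0 n * m0 n.
Proof. unfold timelike, mdot in Hn. nra. Qed.

(* Negative definiteness on the orthogonal complement of [n], by Lagrange's identity. *)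
Lemma mq_lower v : mdot n v = 0 -> mdot n n * msp v <= m0 n * m0 n * mq v.
Proof.
  destruct n as [a p q r], v as [b x y z]. unfold mdot, mq, msp, mdot; simpl. intros h.
  assert (e : a * b = p * x + q * y + r * z) by lra.
  assert (l : (p * x + q * y + r * z) * (p * x + q * y + r * z) <= (p * p + q * q + r * r) * (x * x + y * y + z * z)).
  { pose proof (Rle_0_sqr (p * y - q * x)). pose proof (Rle_0_sqr (p * z - r * x)).
    pose proof (Rle_0_sqr (q * z - r * y)). unfold Rsqr in *. lra. }
  rewrite <- e in l.
  replace (a * a * - (b * b - x * x - y * y - z * z)) with (a * a * (x * x + y * y + z * z) - a * b * (a * b)) by ring.
  lra.
Qed.

Lemma msp_ge0 v : 0 <= msp v.
Proof. unfold msp. nra. Qed.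

Lemma mq_ge0 v : mdot n v = 0 -> 0 <= mq v.
Proof.
  intros h. pose proof (mq_lower v h). pose proof (msp_ge0 v). pose proof n0_sq.
  unfold timelike in Hn. apply (Rmult_le_reg_l (m0 n * m0 n)); [easy|]. nra.
Qed.

(** On vectors orthogonal to [n], [mq] is a squared Euclidean length. It is at least 1 for
    [v = d - b], and bounded above, which bounds all coordinates of [v] and hence [mdot v a]. A
    displacement by small [s a] then keeps [v] spacelike, uniformly in [d]. *)
Lemma spacelike_shift Rb b a : mdot a a = 1 -> mdot n b = 0 -> 2 * Rb + 2 <= mq b ->
  exists e, 0 < e /\ forall d s, mdot n d = 0 -> mq d <= Rb -> Rabs s < e ->
    spacelike (msub (msub d b) (mscal s a)).
Proof.
  intros ha hb hbig. set (Q := 2 * Rb + 2 * mq b).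
  set (N := m0 a * m0 a + m1 a * m1 a + m2 a * m2 a + m3 a * m3 a).
  set (V2 := m0 n * m0 n * Rabs Q / mdot n n).
  pose proof n0_sq as pn. unfold timelike in Hn.
  assert (pV : 0 <= V2).
  { apply Rdiv_le_0_compat; [|lra]. apply Rmult_le_pos; [lra|apply Rabs_pos]. }
  assert (pN : 0 <= N) by (unfold N; nra).
  set (K := 1 + 2 * V2 * N). assert (hK : 1 <= K) by (unfold K; nra).
  (* [K] bounds [|mdot v a|], so the cross term changes the square of [v] by at most [1/2] and [s^2]
     by less than [1/4], against a value at most -1. *)
  exists (1 / (4 * K)). split; [apply Rdiv_lt_0_compat; lra|]. intros d s hd hq hs.
  set (v := msub d b).
  assert (hv : mdot n v = 0).
  { unfold v. destruct n, d, b. unfold mdot, msub, madd, mopp in *; simpl in *. lra. }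
  (* Parallelogram law for [b = d - v]: the difference of the two sides is [mq (d + v) >= 0]. *)
  assert (par1 : mq b <= 2 * mq d + 2 * mq v).
  { assert (h : mdot n (madd d v) = 0).
    { unfold v. destruct n, d, b. unfold mdot, msub, madd, mopp in *; simpl in *. lra. }
    pose proof (mq_ge0 _ h) as p. unfold v in *. destruct d, b. unfold mq, mdot, msub, madd, mopp in *; simpl in *. lra. }
  assert (par2 : mq v <= 2 * mq d + 2 * mq b).
  { assert (h : mdot n (madd d b) = 0).
    { destruct n, d, b. unfold mdot, msub, madd, mopp in *; simpl in *. lra. }
    pose proof (mq_ge0 _ h) as p. unfold v in *. destruct d, b. unfold mq, mdot, msub, madd, mopp in *; simpl in *. lra. }
  assert (q1 : 1 <= mq v) by lra.
  assert (sp : msp v <= V2).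
  { apply (Rmult_le_reg_l (mdot n n)); [lra|]. unfold V2.
    replace (mdot n n * (m0 n * m0 n * Rabs Q / mdot n n)) with (m0 n * m0 n * Rabs Q) by (field; lra).
    eapply Rle_trans; [apply mq_lower; exact hv|]. apply Rmult_le_compat_l; [lra|].
    pose proof (Rle_abs Q). unfold Q in *. lra. }
  assert (va : mdot v a * mdot v a <= 2 * V2 * N).
  { assert (hv0 : m0 v * m0 v <= V2) by (unfold mq, mdot, msp in *; lra).
    apply Rle_trans with ((m0 v * m0 v + msp v) * N); [|apply Rmult_le_compat_r; lra].
    apply mdot_cauchy_schwarz. }
  assert (absva : Rabs (mdot v a) <= K).
  { unfold K. set (m := mdot v a) in *. pose proof (Rabs_mul_self m). pose proof (Rabs_pos m).
    pose proof (Rle_0_sqr (Rabs m - 1)). unfold Rsqr in *. nra. }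
  assert (exp : mdot (msub v (mscal s a)) (msub v (mscal s a)) = - mq v - 2 * (s * mdot v a) + s * s * mdot a a).
  { unfold mq. destruct v, a. unfold mdot, msub, madd, mopp, mscal; simpl. ring. }
  unfold spacelike. fold v. rewrite exp, ha.
  assert (sK : Rabs s * K < 1 / 4).
  { apply (Rmult_lt_compat_r K) in hs; [|lra]. now replace (1 / (4 * K) * K) with (1 / 4) in hs by (field; lra). }
  pose proof (Rabs_pos s).
  assert (s4 : Rabs s < 1 / 4) by nra.
  assert (ss : s * s < 1 / 4) by (rewrite <- Rabs_mul_self; nra).
  assert (sv : - (s * mdot v a) <= 1 / 4).
  { pose proof (Rle_abs (- (s * mdot v a))) as q. rewrite Rabs_Ropp, Rabs_mult in q.
    assert (Rabs s * Rabs (mdot v a) <= Rabs s * K) by (apply Rmult_le_compat_l; lra). lra. }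
  lra.
Qed.

Lemma far_translation Q : exists b, mdot n b = 0 /\ Q <= mq b.
Proof.
  (* Orthogonal to [n] by symmetry, and spacelike because [n] is timelike; a multiple of it is long
     enough. *)
  pose (w := Mk (m1 n) (m0 n) 0 0).
  assert (hw : 0 < mq w).
  { unfold w, mq, mdot; simpl. unfold timelike, mdot in Hn. pose proof (Rle_0_sqr (m2 n)).
    pose proof (Rle_0_sqr (m3 n)). unfold Rsqr in *. lra. }
  set (l := Rabs Q / mq w + 1). assert (hl : 1 <= l).
  { unfold l. assert (0 <= Rabs Q / mq w); [|lra]. apply Rdiv_le_0_compat; [apply Rabs_pos|easy]. }
  exists (mscal l w). split; [unfold w, mdot; simpl; ring|].
  replace (mq (mscal l w)) with (l * l * mq w) by (unfold mq, mdot; simpl; ring).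
  apply Rle_trans with (l * mq w).
  - unfold l. replace ((Rabs Q / mq w + 1) * mq w) with (Rabs Q + mq w) by (field; lra).
    pose proof (Rle_abs Q). lra.
  - apply Rmult_le_compat_r; nra.
Qed.

(** The future-directed unit normal of the hyperplanes; [n] itself may point to the past. *)
Definition nhat : mink := mscal ((if Rlt_dec 0 (m0 n) then 1 else -1) / sqrt (mdot n n)) n.

Lemma nhat_facts : future_timelike_unit nhat /\ forall b, mdot n b = 0 -> mdot nhat b = 0.
Proof.
  pose proof n0_sq as pn. assert (hs : 0 < sqrt (mdot n n)) by now apply sqrt_lt_R0.
  assert (e : sqrt (mdot n n) * sqrt (mdot n n) = mdot n n) by (apply sqrt_sqrt; unfold timelike in Hn; lra).
  set (k := (if Rlt_dec 0 (m0 n) then 1 else -1) / sqrt (mdot n n)) in *.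
  assert (hk : k * k * mdot n n = 1).
  { rewrite <- e. unfold k. destruct Rlt_dec; field; lra. }
  change nhat with (mscal k n). split; [split|].
  - rewrite <- hk. unfold mdot; simpl. ring.
  - simpl. unfold k. destruct Rlt_dec as [p|p].
    + apply Rmult_lt_0_compat; [apply Rdiv_lt_0_compat; lra|easy].
    + assert (m0 n < 0) by nra. replace (-1 / sqrt (mdot n n) * m0 n) with (- m0 n / sqrt (mdot n n)) by (field; lra).
      apply Rdiv_lt_0_compat; lra.
  - intros b hb. replace (mdot (mscal k n) b) with (k * mdot n b) by (unfold mdot; simpl; ring).
    rewrite hb. ring.
Qed.

(** As [b] is orthogonal to [nhat], the square of [s nhat - b] is [s^2 - mq b]; the vector is
    timelike and future-directed once [s] is large. *)
Lemma timelike_beyond b : mdot n b = 0 -> 0 <= mq b ->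
  exists S, forall s, S <= s -> exists a t, future_timelike_unit a /\ madd (mscal t a) b = mscal s nhat.
Proof.
  intros hb hq. destruct nhat_facts as [[h1 h2] h3]. specialize (h3 b hb).
  (* The first and last summands give [s^2 > mq b]; the middle one makes the time component of
     [s nhat - b] positive. *)
  exists (mq b + Rabs (m0 b) / m0 nhat + 1). intros s hs.
  pose proof (Rabs_pos (m0 b)) as pb. pose proof (Rle_abs (m0 b)).
  assert (0 <= Rabs (m0 b) / m0 nhat) by (apply Rdiv_le_0_compat; lra).
  set (v := msub (mscal s nhat) b).
  assert (hv : mdot v v = s * s - mq b).
  { unfold v. transitivity (s * s * mdot nhat nhat - 2 * s * mdot nhat b - mq b).
    - unfold mq, mdot, msub; simpl. ring.
    - rewrite h1, h3. ring. }
  assert (pv : 0 < mdot v v) by (rewrite hv; nra).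
  assert (pv0 : 0 < m0 v).
  { change (m0 v) with (s * m0 nhat + - m0 b).
    assert (q : Rabs (m0 b) / m0 nhat * m0 nhat < s * m0 nhat) by (apply Rmult_lt_compat_r; lra).
    replace (Rabs (m0 b) / m0 nhat * m0 nhat) with (Rabs (m0 b)) in q by (field; lra). lra. }
  set (t := sqrt (mdot v v)). assert (ht : 0 < t) by now apply sqrt_lt_R0.
  assert (tt : t * t = mdot v v) by (apply sqrt_sqrt; lra).
  exists (mscal (/ t) v), t. split; [split|].
  - transitivity (/ t * / t * mdot v v); [unfold mdot; simpl; ring|]. rewrite <- tt. field. lra.
  - change (m0 (mscal (/ t) v)) with (/ t * m0 v).
    apply Rmult_lt_0_compat; [now apply Rinv_0_lt_compat|easy].
  - unfold v. generalize (mscal s nhat). intros w. apply mink_ext; simpl; field; lra.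
Qed.

End Geometry.

(** * Vanishing of the effects of bounded spatial sets *)

Theorem theorem2
  (H : Hilbert) (U : mink -> H -> H)
  (HU : unitary_rep U) (HUc : strongly_continuous U)
  (Hspec : forall a, future_timelike_unit a -> generator_bounded_below U a)
  (* foliation S_c = { x | mdot n x = c }, c in R, by parallel spacelike hyperplanes *)
  (n : mink) (Hn : timelike n)
  (* F c = family of spatial sets in S_c *)
  (F : R -> mset -> Prop)
  (HFsub : forall c D, F c D -> forall x, D x -> mdot n x = c)
  (HFcover : forall c x, mdot n x = c ->
     exists D, F c D /\ bounded_spatial D /\ D x)
  (HFtransl : forall c a D,
     F (c + mdot n a) D <-> exists D', F c D' /\ D = translate D' a)
  (E : mset -> H -> H)
  (HEeff : forall c D, F c D -> is_effect (E D))
  (Hcov : forall a c D T, F c D -> adjoint_of (U a) T ->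
     forall psi, U a (E D (T psi)) = E (translate D a) psi)
  (Hloc : forall c D1 D2, F c D1 -> F c D2 -> (forall x, ~ (D1 x /\ D2 x)) ->
     forall psi, E D1 (E D2 psi) = hzero /\ E D2 (E D1 psi) = hzero)
  (Hcomm : forall c1 c2 D1 D2, F c1 D1 -> F c2 D2 -> spacelike_separated D1 D2 ->
     forall psi, E D1 (E D2 psi) = E D2 (E D1 psi)) :
  forall c D, F c D -> bounded_spatial D -> forall psi, E D psi = hzero.
Proof.
  intros c D HD [Rb HRb] psi.
  assert (orth : forall x y, D x -> D y -> mdot n (msub x y) = 0).
  { intros x y hx hy. pose proof (HFsub c D HD x hx). pose proof (HFsub c D HD y hy).
    unfold mdot, msub in *; simpl in *. lra. }
  assert (tr : forall c' D' a, F c' D' -> F (c' + mdot n a) (translate D' a)).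
  { intros c' D' a h. apply HFtransl. eauto. }
  assert (cov : forall a c' D' x, F c' D' -> E (translate D' a) x = U a (E D' (U (mopp a) x))).
  { intros a c' D' x h. symmetry. apply (Hcov a c' D' _ h). now apply U_adjoint. }
  pose proof (HEeff c D HD) as ED. pose proof (effect_linear _ ED) as LD.
  (* The absolute value matters when [D] is empty, where [Rb] may be negative. The length of [b]
     serves both disjointness from [D] and spacelike separation under small time translations. *)
  destruct (far_translation n Hn (2 * Rabs Rb + 2)) as [b [hb hfar]].
  pose proof (Rle_abs Rb) as hRb. pose proof (Rabs_pos Rb) as hRb0.
  set (D' := translate D b).
  assert (HD' : F c D') by (unfold D'; specialize (tr c D b HD); now rewrite hb, Rplus_0_r in tr).
  pose proof (HEeff c D' HD') as ED'.
  assert (disj : forall x, ~ (D x /\ D' x)).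
  { intros x [h1 h2]. unfold D', translate in h2. specialize (HRb x (msub x b) h1 h2).
    replace (msub x (msub x b)) with b in HRb by (apply mink_ext; simpl; ring).
    unfold mq in hfar. lra. }
  assert (AF0 : forall x, E D (E D' x) = hzero) by (intros x; now apply (Hloc c D D')).
  assert (key : forall a t x, future_timelike_unit a -> E D (U (mscal t a) (E D' x)) = hzero).
  { intros a t x ha. destruct (Hspec a ha) as [k hk].
    pose proof (phased_group U HU a k HUc hk) as PG.
    destruct (spacelike_shift n Hn Rb b a (proj1 ha) hb ltac:(lra)) as [e [he sep]].
    (* Localizability gives the product zero at [s = 0] only; local commutativity holds for all
       small [s], since [D' + s a] is still spacelike to [D]. *)
    assert (com : forall s y, Rabs s < e -> E D (cj (phased U a k) s (E D') y) = cj (phased U a k) s (E D') (E D y)).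
    { intros s y hs. unfold cj. rewrite 2 (phased_cj U HU a k s (E D')) by now apply effect_linear.
      rewrite <- 2 (cov _ c) by easy.
      apply (Hcomm c (c + mdot n (mscal s a))); [easy|now apply tr|].
      intros p q hp hq. unfold D', translate in hq.
      replace (msub p q) with (msub (msub (msub p (msub (msub q (mscal s a)) b)) b) (mscal s a))
        by (apply mink_ext; simpl; ring).
      apply sep; [now apply orth| |easy]. now apply HRb. }
    pose proof (borchers (phased U a k) PG (E D) (E D') ED ED' AF0 e he com t x) as z.
    unfold phased in z. rewrite (linear_op_csc _ _ _ LD) in z.
    apply (f_equal (csc (cis (k * t)))) in z. rewrite csc_csc in z.
    replace (- k * t) with (- (k * t)) in z by ring. rewrite cis_inv, csc_1 in z. rewrite z.
    rewrite <- (csc_0 hzero), csc_csc. f_equal. ring. }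
  destruct (nhat_facts n Hn) as [hn _].
  destruct (timelike_beyond n Hn b hb ltac:(lra)) as [S hS].
  destruct (Hspec _ hn) as [k hk]. pose proof (phased_group U HU (nhat n) k HUc hk) as PG.
  assert (van : forall t, ip (E D psi) (phased U (nhat n) k t (E D psi)) = 0).
  { apply (group_vanishing (phased U (nhat n) k) _ _ S (S + 1) PG); [lra|]. intros s hs.
    (* [U(s nhat) = U(t a) U(b)], and by covariance [U(b) E D psi = E D' (U(b) psi)], so that [key]
       applies with the vector [U(b) psi]. *)
    destruct (hS s ltac:(lra)) as [a [t [ha e]]].
    unfold phased. rewrite ip_csc_r, <- e, (U_add U HU), (effect_selfadj _ ED).
    specialize (key a t (U b psi) ha). unfold D' in key. rewrite (cov b c D) in key by easy.
    rewrite (U_opp' U HU) in key. rewrite key, ip_hzero_r. ring. }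
  (* At parameter 0 the matrix element is the squared norm of [E D psi]. *)
  specialize (van 0). rewrite (pg_0 _ PG) in van.
  apply hnorm_eq0. pose proof (hnorm_sq (E D psi)) as q. rewrite van in q. simpl in q.
  pose proof (hnorm_ge0 (E D psi)). nra.
Qed.
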